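(* Let $q$ be a power of a prime $p$, let $\ell\ne p$ be a prime, and let $m$ be an odd positive integer. Let $(V,h)$ be a nondegenerate hermitian space over $\mathbb{F}_{q^2}$ of finite dimension $n\ge 1$, and let $\psi\colon\mathbb{F}_{q,+}\to\overline{\mathbb{Q}}_\ell^\times$ be a non-trivial character. Let $1\le i\le m$ be an integer, set $d=\gcd(m,i)$, and take an integer $t$ such that $ti\equiv d\pmod m$. Then there is a unique extension $\widetilde{\rho}_{\mathbf{HU}_{(V,h)}(\mathbb{F}_{q^m}),\psi_m}$ of the Heisenberg--Weil representation $\rho_{\mathbf{HU}_{(V,h)}(\mathbb{F}_{q^m}),\psi_m}$ to $\mathbf{HU}_{(V,h)}(\mathbb{F}_{q^m})\rtimes\Gamma$ such that $$\operatorname{tr}\widetilde{\rho}_{\mathbf{HU}_{(V,h)}(\mathbb{F}_{q^m}),\psi_m}(g,\sigma^i)=\operatorname{tr}\widetilde{\rho}_{\mathbf{HU}_{(V,h)}(\mathbb{F}_{q^d}),\psi_d}\bigl(\mathrm{N}_{i,t}(g,\sigma^i)\bigr)$$ for any $g\in \mathbf{HU}_{(V,h)}(\mathbb{F}_{q^m})$.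
   Context: Representations are over $\overline{\mathbb{Q}}_\ell$. For $k\ge1$, $\mathbb{F}_{q^k,+}=\{x\in\overline{\mathbb{F}}_q\mid x^{q^k}+x=0\}$. Unitary groups. Let $Q$ be a power of $p$. A hermitian form $h$ on an $\mathbb{F}_{Q^2}$-vector space $V$ (for the involution $x\mapsto x^Q$) is sesquilinear in the first coordinate and linear in the second. Write $h_R$ for the $R$-linear extension of $h$ to $V\otimes_{\mathbb{F}_Q}R$ ($R$ an $\mathbb{F}_Q$-algebra). Define algebraic groups over $\mathbb{F}_Q$ by: $\mathbf{H}_{(V,h)}(R)=\{(v,a)\in (V\otimes_{\mathbb{F}_Q}R)\times(\mathbb{F}_{Q^2}\otimes_{\mathbb{F}_Q}R)\mid \bar a+a=h_R(v,v)\}$, where $\bar a$ is the image of $a$ under ($x\mapsto x^Q$ on $\mathbb{F}_{Q^2}$)$\,\otimes\mathrm{id}_R$, with group law $(v,a)(v',a')=(v+v',a+a'+h_R(v,v'))$; $\mathbf{U}_{(V,h)}(R)$ = the group of $\mathbb{F}_{Q^2}\otimes_{\mathbb{F}_Q} R$-linear automorphisms of $V\otimes_{\mathbb{F}_Q} R$ preserving $h_R$, acting on $\mathbf{H}_{(V,h)}$ by $(v,a)\mapsto(gv,a)$; and $\mathbf{HU}_{(V,h)}=\mathbf{H}_{(V,h)}\rtimes\mathbf{U}_{(V,h)}$. Put $\mathrm{H}(V,h)$, $\mathrm{U}(V,h)$, $\mathrm{HU}(V,h)$ for the groups of $\mathbb{F}_Q$-points. Heisenberg--Weil representation. For $(V,h)$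 nondegenerate of dimension $n$ over $\mathbb{F}_{Q^2}$ and a non-trivial character $\psi$ of $\mathbb{F}_{Q,+}$, $\rho_{\mathrm{HU}(V,h),\psi}$ is the unique representation of $\mathrm{HU}(V,h)$ such that (i) its restriction to $\mathrm{H}(V,h)$ is the unique irreducible representation whose restriction to the center $\{(0,a)\}\cong\mathbb{F}_{Q,+}$ contains $\psi$, and (ii) its trace at $g\in\mathrm{U}(V,h)$ is $(-1)^n(-Q)^{\dim_{\mathbb{F}_{Q^2}}\ker(g-\mathrm{id}_V)}$. Base change. For $k$ odd, $\mathbb{F}_{q^2}\otimes_{\mathbb{F}_q}\mathbb{F}_{q^k}\cong\mathbb{F}_{q^{2k}}$, so for $(V,h)$ over $\mathbb{F}_{q^2}$ one has $\mathbf{HU}_{(V,h)}(\mathbb{F}_{q^k})=\mathrm{HU}(V',h')$ for the hermitian space $(V',h')=(V\otimes_{\mathbb{F}_q}\mathbb{F}_{q^k},h_{\mathbb{F}_{q^k}})$ over $\mathbb{F}_{Q^2}$ with $Q=q^k$. Put $\psi_k=\psi\circ\mathrm{Tr}_{\mathbb{F}_{q^{2k}}/\mathbb{F}_{q^2}}\colon\mathbb{F}_{q^k,+}\to\overline{\mathbb{Q}}_\ell^\times$; this gives $\rho_{\mathbf{HU}_{(V,h)}(\mathbb{F}_{q^k}),\psi_k}$. Right-hand side of the identity. $\widetilde{\rho}_{\mathbf{HU}_{(V,h)}(\mathbb{F}_{q^d}),\psi_d}$ denotes the corresponding extended representation at level $d$, an extension of $\rho_{\mathbf{HU}_{(V,h)}(\mathbb{F}_{q^d}),\psi_d}$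 to the semidirect product of $\mathbf{HU}_{(V,h)}(\mathbb{F}_{q^d})$ with a cyclic group of order $d$ whose generator acts by Frobenius. In the identity it is evaluated only at elements of $\mathbf{HU}_{(V,h)}(\mathbb{F}_{q^d})$, where it agrees with $\rho_{\mathbf{HU}_{(V,h)}(\mathbb{F}_{q^d}),\psi_d}$. Norm map. Let $\mathbf{G}=\mathbf{HU}_{(V,h)}$ (connected over $\mathbb{F}_q$), $F$ its ($q$-power) Frobenius endomorphism, $G=\mathbf{G}^{F^m}=\mathbf{G}(\mathbb{F}_{q^m})$, and let $\Gamma$ be a cyclic group of order $m$ with generator $\sigma$ acting on $G$ as $F$ (concretely, $\Gamma=\mathrm{Gal}(\mathbb{F}_{q^{2m}}/\mathbb{F}_{q^2})$ and $\sigma=\mathrm{Fr}_{q^2}^{(m-1)/2}$, where $\mathrm{Fr}_{q^2}$ is the geometric Frobenius $x\mapsto x^{q^{-2}}$, which acts on $G$ as $F^{-2}$). With $i,d,t$ as in the claim and $\mu=m/d$: for $g\in G$ choose, by Lang's theorem, $\alpha\in\mathbf{G}(\overline{\mathbb{F}}_q)$ with $\alpha^{-1}F^d(\alpha)=(g,\sigma^i)^t(1,\sigma^{-it})\in G$, and put $\mathrm{N}_{i,t}(g,\sigma^i)=\alpha\, gF^i(g)\cdots F^{i(\mu-1)}(g)\,\alpha^{-1}$. This lies in $G^{F^i}=\mathbf{G}^{F^d}=\mathbf{G}(\mathbb{F}_{q^d})$, and its conjugacy class there does not depend on the choice of $\alpha$.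
   Formalization: For fixed i with d>1 uniqueness fails (twist by a character of Γ trivial on σ^i; e.g. m=i=3). Proved instead: one extension satisfies the identity for all (i,t), and any extension satisfying it for a given (i,t) agrees with it on G⋊⟨σ^i⟩, which is the whole group if d=1. *)

(* Defs.v *)
From HB Require Import structures.
From mathcomp Require Import all_boot all_order all_fingroup all_algebra.
From mathcomp Require Import all_solvable all_field all_character.

Set Implicit Arguments.
Unset Strict Implicit.
Unset Printing Implicit Defensive.

Import Order.TTheory GRing.Theory Num.Theory.
Local Open Scope ring_scope.

#[short(type="finComAlgType")]
HB.structure Definition FinComAlgebra (k : nzRingType) :=
  {R of GRing.ComAlgebra k R & Finite R}.

Section Frobenius.
Variables (k : finFieldType) (R : comAlgType k).

Definition frob (x : R) : R := x ^+ #|k|.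

Lemma pchar_alg p : p \in [pchar k] -> p \in [pchar R].
Proof.
case/andP=> p_pr /eqP pk0; apply/andP; split=> //; apply/eqP.
by rewrite -(rmorph_nat (in_alg R)) pk0 raddf0.
Qed.

Lemma pchar_nat_card : [pchar R].-nat #|k|.
Proof.
have [p p_pr pk] := finPcharP k.
have := abelem_pgroup (fin_ring_pchar_abelem pk); rewrite /pgroup cardsT.
by apply: sub_in_pnat => r _ /eqP->; apply: pchar_alg.
Qed.

Fact frob_is_zmod_morphism : zmod_morphism frob.
Proof.
move=> x y; rewrite /frob exprDn_pchar ?pchar_nat_card //.
by rewrite exprNn_pchar ?pchar_nat_card.
Qed.
Fact frob_is_monoid_morphism : monoid_morphism frob.
Proof. by split=> [|x y]; rewrite /frob ?expr1n ?exprMn. Qed.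
Fact frob_is_scalable : scalable frob.
Proof. by move=> a x; rewrite /frob exprZn expf_card. Qed.
HB.instance Definition _ :=
  GRing.isZmodMorphism.Build R R frob frob_is_zmod_morphism.
HB.instance Definition _ :=
  GRing.isMonoidMorphism.Build R R frob frob_is_monoid_morphism.
HB.instance Definition _ :=
  GRing.isScalable.Build k R R *:%R frob frob_is_scalable.

End Frobenius.

(* [tens L R] is L (x)_k R, the row (r_i)_i standing for sum_i e_i (x) r_i,   *)
(* where (e_i)_i is the k-basis [vbasis {:L}] of L.                           *)
Definition tens (k : fieldType) (L : fieldExtType k) (R : comAlgType k) : Type :=
  'rV[R]_(\dim {:L}).

Section TensDef.
Variables (k : fieldType) (L : fieldExtType k) (R : comAlgType k).

HB.instance Definition _ := GRing.Lmodule.on (tens L R).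

(* x |-> x (x) 1 *)
Definition tens_of (x : L) : tens L R :=
  \row_i (coord (vbasis {:L}) i x)%:A.

Definition tens_basis (i : 'I_(\dim {:L})) : L := (vbasis {:L})`_i.

Definition tens_mul (x y : tens L R) : tens L R :=
  \sum_i \sum_j (x 0 i * y 0 j) *: tens_of (tens_basis i * tens_basis j).

Fact tens_of_linear a u v :
  tens_of (a *: u + v) = a%:A *: tens_of u + tens_of v.
Proof.
by apply/rowP=> i; rewrite !mxE linearP /= scalerDl -scalerA mulr_algl.
Qed.

Fact tens_ofD u v : tens_of (u + v) = tens_of u + tens_of v.
Proof. by rewrite -[u]scale1r tens_of_linear !scale1r. Qed.

Fact tens_of0 : tens_of 0 = 0.
Proof. by apply/rowP=> i; rewrite !mxE linear0 scale0r. Qed.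

Fact tens_ofZ a u : tens_of (a *: u) = a%:A *: tens_of u.
Proof. by rewrite -[a *: u]addr0 tens_of_linear tens_of0 addr0. Qed.

Fact tens_of_sum I r (P : pred I) F :
  tens_of (\sum_(i <- r | P i) F i) = \sum_(i <- r | P i) tens_of (F i).
Proof. exact: (big_morph tens_of tens_ofD tens_of0). Qed.

Fact tens_coordE (x : L) :
  x = \sum_i coord (vbasis {:L}) i x *: tens_basis i.
Proof. exact: (coord_vbasis (memvf x)). Qed.

Fact tens_of_basis i : tens_of (tens_basis i) = delta_mx 0 i.
Proof.
apply/rowP=> j; rewrite !mxE /tens_basis coord_free ?(basis_free (vbasisP _)) //.
by rewrite eqxx eq_sym scaler_nat.
Qed.

Fact tens_sumE (x : tens L R) : x = \sum_i x 0 i *: tens_of (tens_basis i).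
Proof.
by rewrite [LHS]row_sum_delta; apply: eq_bigr => i _; rewrite tens_of_basis.
Qed.

Fact tens_mulDl : left_distributive tens_mul +%R.
Proof.
move=> x y z; rewrite /tens_mul -big_split; apply: eq_bigr => i _ /=.
rewrite -big_split; apply: eq_bigr => j _ /=.
by rewrite mxE mulrDl scalerDl.
Qed.

Fact tens_mulC : commutative tens_mul.
Proof.
move=> x y; rewrite /tens_mul exchange_big; apply: eq_bigr => i _ /=.
by apply: eq_bigr => j _; rewrite mulrC [_ * tens_basis _]mulrC.
Qed.

Fact tens_mulDr : right_distributive tens_mul +%R.
Proof. by move=> x y z; rewrite tens_mulC tens_mulDl !(tens_mulC x). Qed.

Fact tens_mulZl a x y : tens_mul (a *: x) y = a *: tens_mul x y.
Proof.
rewrite /tens_mul scaler_sumr; apply: eq_bigr => i _.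
rewrite scaler_sumr; apply: eq_bigr => j _.
by rewrite mxE scalerA mulrA.
Qed.

Fact tens_mulZr a x y : tens_mul x (a *: y) = a *: tens_mul x y.
Proof. by rewrite tens_mulC tens_mulZl tens_mulC. Qed.

Fact tens_mul0l x : tens_mul 0 x = 0.
Proof. by rewrite -[0 in LHS](scale0r 0) tens_mulZl scale0r. Qed.

Fact tens_mul_suml I r (P : pred I) F y :
  tens_mul (\sum_(i <- r | P i) F i) y = \sum_(i <- r | P i) tens_mul (F i) y.
Proof.
by apply: (big_morph (tens_mul^~ y) _ (tens_mul0l y)) => u v; apply: tens_mulDl.
Qed.

Fact tens_mul_sumr I r (P : pred I) F y :
  tens_mul y (\sum_(i <- r | P i) F i) = \sum_(i <- r | P i) tens_mul y (F i).
Proof.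
by rewrite tens_mulC tens_mul_suml; apply: eq_bigr => i _; rewrite tens_mulC.
Qed.

Fact tens_ofM u v : tens_of (u * v) = tens_mul (tens_of u) (tens_of v).
Proof.
rewrite {1}[u]tens_coordE {1}[v]tens_coordE mulr_suml tens_of_sum.
apply: eq_bigr => i _; rewrite mulr_sumr tens_of_sum; apply: eq_bigr => j _.
by rewrite !mxE -scalerAl -scalerAr !tens_ofZ scalerA.
Qed.

Fact tens_mulA : associative tens_mul.
Proof.
move: tens_mul tens_mul_suml tens_mul_sumr tens_mulZl tens_mulZr tens_ofM.
move=> f fsl fsr fZl fZr fM x y z.
rewrite [z]tens_sumE !fsr; apply: eq_bigr => l _.
rewrite [y]tens_sumE !(fsl, fsr); apply: eq_bigr => j _.
rewrite [x]tens_sumE !fsl; apply: eq_bigr => i _.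
by rewrite !(fZl, fZr) -!fM mulrA !scalerA; congr (_ *: _); rewrite mulrC mulrA.
Qed.

Fact tens_mul1 : left_id (tens_of 1) tens_mul.
Proof.
move=> x; rewrite {1}[x]tens_sumE tens_mul_sumr [RHS]tens_sumE.
by apply: eq_bigr => i _; rewrite tens_mulZr -tens_ofM mul1r.
Qed.

HB.instance Definition _ := GRing.Zmodule_isComPzRing.Build (tens L R)
  tens_mulA tens_mulC tens_mul1 tens_mulDl.

Fact tens_scalerAl a (x y : tens L R) : a *: (x * y) = a *: x * y.
Proof. by rewrite [RHS]tens_mulZl. Qed.

Fact tens_scalerAr a (x y : tens L R) : a *: (x * y) = x * (a *: y).
Proof. by rewrite [RHS]tens_mulZr. Qed.

Fact tens_of_mul u v : tens_of (u * v) = tens_of u * tens_of v.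
Proof. exact: tens_ofM. Qed.

End TensDef.

HB.instance Definition _ (k : fieldType) (L : fieldExtType k)
  (R : finComAlgType k) := Finite.on (tens L R).

Section TensMap.
Variables (k : fieldType) (L : fieldExtType k).

(* id (x) phi *)
Definition tens_map (R S : comAlgType k) (phi : {lrmorphism R -> S})
  (x : tens L R) : tens L S := map_mx phi x.

(* s (x) id *)
Definition tens_lift (R : comAlgType k) (s : {lrmorphism L -> L})
  (x : tens L R) : tens L R := \sum_i x 0 i *: tens_of R (s (tens_basis i)).

Section Map.
Variables (R S : comAlgType k) (phi : {lrmorphism R -> S}).

Fact tens_map_of x : tens_map phi (tens_of R x) = tens_of S x.
Proof. by apply/rowP=> i; rewrite !mxE linearZ /= rmorph1. Qed.

Fact tens_mapZ a x : tens_map phi (a *: x) = phi a *: tens_map phi x.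
Proof. by apply/rowP=> i; rewrite !mxE rmorphM. Qed.

Fact tens_map_is_zmod_morphism : zmod_morphism (tens_map phi).
Proof. by move=> x y; apply/rowP=> i; rewrite !mxE rmorphB. Qed.
HB.instance Definition _ := GRing.isZmodMorphism.Build
  (tens L R) (tens L S) (tens_map phi) tens_map_is_zmod_morphism.

Fact tens_map_is_monoid_morphism : monoid_morphism (tens_map phi).
Proof.
split=> [|x y]; first exact: tens_map_of.
rewrite [x * y]/(tens_mul x y) [RHS]/(tens_mul _ _) /tens_mul raddf_sum.
apply: eq_bigr => i _; rewrite raddf_sum; apply: eq_bigr => j _.
by rewrite /= tens_mapZ tens_map_of rmorphM !mxE.
Qed.
HB.instance Definition _ := GRing.isMonoidMorphism.Build
  (tens L R) (tens L S) (tens_map phi) tens_map_is_monoid_morphism.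
End Map.

Section Lift.
Variables (R : comAlgType k) (s : {lrmorphism L -> L}).

Fact tens_lift_is_zmod_morphism : zmod_morphism (@tens_lift R s).
Proof.
move=> x y; rewrite /tens_lift -sumrB; apply: eq_bigr => i _.
by rewrite !mxE scalerBl.
Qed.
HB.instance Definition _ := GRing.isZmodMorphism.Build
  (tens L R) (tens L R) (@tens_lift R s) tens_lift_is_zmod_morphism.

Fact tens_liftZ a x : @tens_lift R s (a *: x) = a *: @tens_lift R s x.
Proof.
by rewrite /tens_lift scaler_sumr; apply: eq_bigr => i _; rewrite mxE scalerA.
Qed.

Fact tens_lift_of x : tens_lift s (tens_of R x) = tens_of R (s x).
Proof.
rewrite [in RHS](tens_coordE x) linear_sum tens_of_sum.
by apply: eq_bigr => i _; rewrite mxE linearZ /= tens_ofZ.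
Qed.

Fact tens_lift_is_monoid_morphism : monoid_morphism (@tens_lift R s).
Proof.
split=> [|x y]; first by rewrite tens_lift_of rmorph1.
rewrite [y]tens_sumE mulr_sumr !raddf_sum mulr_sumr; apply: eq_bigr => j _.
rewrite [x]tens_sumE mulr_suml !raddf_sum mulr_suml; apply: eq_bigr => i _.
rewrite -tens_scalerAr -tens_scalerAl /= !tens_liftZ -tens_scalerAr -tens_scalerAl.
by rewrite -tens_of_mul !tens_lift_of rmorphM tens_of_mul.
Qed.
HB.instance Definition _ := GRing.isMonoidMorphism.Build
  (tens L R) (tens L R) (@tens_lift R s) tens_lift_is_monoid_morphism.
End Lift.

Fact tens_map_lift (R S : comAlgType k) (phi : {lrmorphism R -> S})
    (s : {lrmorphism L -> L}) x :
  tens_map phi (tens_lift s x) = tens_lift s (tens_map phi x).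
Proof.
rewrite /tens_lift raddf_sum; apply: eq_bigr => i _.
by rewrite /= tens_mapZ tens_map_of mxE.
Qed.

End TensMap.

Section SemidirectProduct.
Local Open Scope group_scope.

(* left actions of H on N by group automorphisms *)
Record leftaut (N H : groupType) := LeftAut {
  lact :> H -> N -> N;
  lact1 : forall x, lact 1 x = x;
  lactM : forall a b x, lact (a * b) x = lact a (lact b x);
  lact_mul : forall a x y, lact a (x * y) = lact a x * lact a y }.

Definition sdp (N H : groupType) (to : leftaut N H) : Type := (N * H)%type.

Section Group.
Variables (N H : groupType) (to : leftaut N H).

Definition sdp_mul (x y : sdp to) : sdp to := (x.1 * to x.2 y.1, x.2 * y.2).
Definition sdp_one : sdp to := (1, 1).
Definition sdp_inv (x : sdp to) : sdp to := (to x.2^-1 x.1^-1, x.2^-1).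

Fact lactE1 a : to a 1 = 1.
Proof. by apply: (mulgI (to a 1)); rewrite -lact_mul !mulg1. Qed.
Fact sdp_mulA : associative sdp_mul.
Proof.
by move=> x y z; rewrite /sdp_mul /= lact_mul -lactM !mulgA.
Qed.
Fact sdp_mul1g : left_id sdp_one sdp_mul.
Proof. by case=> x a; rewrite /sdp_mul /= lact1 !mul1g. Qed.
Fact sdp_mulg1 : right_id sdp_one sdp_mul.
Proof. by case=> x a; rewrite /sdp_mul /= lactE1 !mulg1. Qed.
Fact sdp_mulVg : left_inverse sdp_one sdp_inv sdp_mul.
Proof. by case=> x a; rewrite /sdp_mul /= -lact_mul !mulVg lactE1. Qed.
Fact sdp_mulgV : right_inverse sdp_one sdp_inv sdp_mul.
Proof. by case=> x a; rewrite /sdp_mul /= -lactM !mulgV lact1 mulgV. Qed.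

HB.instance Definition _ := Choice.on (sdp to).
HB.instance Definition _ := isGroup.Build (sdp to)
  sdp_mulA sdp_mul1g sdp_mulg1 sdp_mulVg sdp_mulgV.
End Group.

HB.instance Definition _ (N H : finGroupType) (to : leftaut N H) :=
  Finite.on (sdp to).

Section NormalFactor.
Variables (N H : finGroupType) (to : leftaut N H).
(* N inside the semidirect product *)
Definition sdp_normal : {set sdp to} := [set x | x.2 == 1].
Fact sdp_normal_group_set : group_set sdp_normal.
Proof.
apply/group_setP; split=> [|x y]; rewrite !inE ?eqxx // => /eqP x1 /eqP y1.
by rewrite /= x1 y1 mulg1.
Qed.
Canonical sdp_normal_group := Group sdp_normal_group_set.
End NormalFactor.

End SemidirectProduct.

Record quadExt (k : fieldType) := QuadExt {
  quad_ext :> fieldExtType k;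
  quad_dim : \dim {:quad_ext} = 2 }.

Section HermitianSpace.
Variables (k : finFieldType) (L : quadExt k).

Fact frobK : involutive (frob (R:=L)).
Proof.
pose fL : fieldExtType k := finvect_type L.
move=> x; have := expf_card (x : finvect_type L).
rewrite -(card_vspacef (Vector.class (fL : vectType k))) (card_vspace _).
by rewrite [X in (_ ^ X)%N](quad_dim L) /frob -exprM mulnn.
Qed.

(* sesquilinear in the first variable, linear in the second *)
Record hermSpace := HermSpace {
  hs_space :> vectType L;
  herm : {bilinear hs_space -> hs_space -> L | frob (R:=L) \; *%R & *%R};
  herm_sym : forall v w, frob (herm v w) = herm w v }.

Definition herm_nondegenerate (V : hermSpace) : Prop :=
  forall v : V, (forall w, herm V v w = 0) -> v = 0.

End HermitianSpace.

(* As V is free over L, V (x)_k R = V (x)_L (L (x)_k R): it is represented by *)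
(* coordinate columns over [tens L R] in the basis [vbasis {:V}].             *)
Section UnitaryHeisenberg.
Variables (k : finFieldType) (L : quadExt k) (V : hermSpace L).
Variable R : comAlgType k.
Local Notation n := (\dim {:V}).
Local Notation LR := (tens L R).
Local Notation VR := 'cV[LR]_n.

Definition conjR : LR -> LR := tens_lift (frob (R:=L)).
HB.instance Definition _ := GRing.RMorphism.on conjR.

Fact conjRK : involutive conjR.
Proof.
move=> x; rewrite [RHS]tens_sumE [X in conjR X]/conjR /tens_lift raddf_sum.
by apply: eq_bigr => i _; rewrite /= /conjR tens_liftZ tens_lift_of /= frobK.
Qed.

Fact conjR_of x : conjR (tens_of R x) = tens_of R (frob x).
Proof. exact: tens_lift_of. Qed.

Definition gram : 'M[LR]_n :=
  \matrix_(i, j) tens_of R (herm V (vbasis {:V})`_i (vbasis {:V})`_j).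

Definition adjmx m p (A : 'M[LR]_(m, p)) : 'M[LR]_(p, m) := (map_mx conjR A)^T.

(* the R-linear extension of the form *)
Definition hermR (v w : VR) : LR := (adjmx v *m gram *m w) 0 0.

Fact adjmxK m p : cancel (@adjmx m p) (@adjmx p m).
Proof. by move=> A; apply/matrixP=> i j; rewrite !mxE conjRK. Qed.
Fact adjmxM m p r (A : 'M[LR]_(m, p)) (B : 'M[LR]_(p, r)) :
  adjmx (A *m B) = adjmx B *m adjmx A.
Proof. by rewrite /adjmx map_mxM trmx_mul. Qed.
Fact adjmxD m p (A B : 'M[LR]_(m, p)) : adjmx (A + B) = adjmx A + adjmx B.
Proof. by rewrite /adjmx map_mxD linearD. Qed.
Fact adjmxN m p (A : 'M[LR]_(m, p)) : adjmx (- A) = - adjmx A.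
Proof. by rewrite /adjmx map_mxN linearN. Qed.
Fact adjmx0 m p : adjmx (0 : 'M[LR]_(m, p)) = 0.
Proof. by rewrite /adjmx map_mx0 trmx0. Qed.
Fact adjmx1 m : adjmx (1%:M : 'M[LR]_m) = 1%:M.
Proof. by rewrite /adjmx map_mx1 trmx1. Qed.
Fact adj_gram : adjmx gram = gram.
Proof. by apply/matrixP=> i j; rewrite !mxE conjR_of herm_sym. Qed.

Fact hermRC v w : conjR (hermR v w) = hermR w v.
Proof.
have conj11 (x : 'M[LR]_1) : conjR (x 0 0) = adjmx x 0 0 by rewrite !mxE.
by rewrite [in LHS]/hermR conj11 !adjmxM adjmxK adj_gram mulmxA.
Qed.
Fact hermRDl u v w : hermR (u + v) w = hermR u w + hermR v w.
Proof. by rewrite /hermR adjmxD !mulmxDl mxE. Qed.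
Fact hermRDr u v w : hermR w (u + v) = hermR w u + hermR w v.
Proof. by rewrite /hermR mulmxDr mxE. Qed.
Fact hermRNl v w : hermR (- v) w = - hermR v w.
Proof. by rewrite /hermR adjmxN !mulNmx mxE. Qed.
Fact hermRNr v w : hermR v (- w) = - hermR v w.
Proof. by rewrite /hermR mulmxN mxE. Qed.
Fact hermR0r v : hermR v 0 = 0.
Proof. by rewrite /hermR mulmx0 mxE. Qed.
Fact hermR0l v : hermR 0 v = 0.
Proof. by rewrite /hermR adjmx0 !mul0mx mxE. Qed.

Definition heis_pred (x : VR * LR) := conjR x.2 + x.2 == hermR x.1 x.1.
Definition Heis : Type := {x | heis_pred x}.
HB.instance Definition _ := Choice.on Heis.
Definition mk_heis v a : heis_pred (v, a) -> Heis := exist heis_pred (v, a).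
Definition heis_vec (x : Heis) : VR := (val x).1.
Definition heis_sca (x : Heis) : LR := (val x).2.

Fact heisE x : conjR (heis_sca x) + heis_sca x = hermR (heis_vec x) (heis_vec x).
Proof. exact/eqP/(valP x). Qed.
Fact heis_inj x y :
  heis_vec x = heis_vec y -> heis_sca x = heis_sca y -> x = y.
Proof.
by case: x y => [[v a] ?] [[w b] ?] /= ev ea; apply: val_inj; congr (_, _).
Qed.

Fact heis_mul_subproof x y :
  heis_pred (heis_vec x + heis_vec y,
             heis_sca x + heis_sca y + hermR (heis_vec x) (heis_vec y)).
Proof.
apply/eqP; rewrite !rmorphD /= hermRC !(hermRDl, hermRDr) -!heisE.
by rewrite [LHS](AC (3*3) ((1*4*6)*(3*(2*5)))).
Qed.
Definition heis_mul (x y : Heis) : Heis := mk_heis (heis_mul_subproof x y).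

Fact heis_one_subproof : heis_pred (0, 0).
Proof. by rewrite /heis_pred /= raddf0 addr0 hermR0r. Qed.
Definition heis_one : Heis := mk_heis heis_one_subproof.

Fact heis_inv_subproof x : heis_pred (- heis_vec x, conjR (heis_sca x)).
Proof.
by apply/eqP; rewrite /= conjRK hermRNl hermRNr opprK -heisE addrC.
Qed.
Definition heis_inv (x : Heis) : Heis := mk_heis (heis_inv_subproof x).

Fact heis_vecM x y : heis_vec (heis_mul x y) = heis_vec x + heis_vec y.
Proof. by []. Qed.
Fact heis_scaM x y : heis_sca (heis_mul x y) =
  heis_sca x + heis_sca y + hermR (heis_vec x) (heis_vec y).
Proof. by []. Qed.
Fact heis_mulA : associative heis_mul.
Proof.
move=> x y z; apply: heis_inj; first exact: addrA.
rewrite !heis_scaM !heis_vecM hermRDl hermRDr.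
by rewrite [LHS](AC ((1*3)*2) ((((1*2)*5)*3)*(6*4))).
Qed.
Fact heis_mul1g : left_id heis_one heis_mul.
Proof.
move=> x; apply: heis_inj; first exact: add0r.
by rewrite heis_scaM hermR0l addr0; apply: add0r.
Qed.
Fact heis_mulg1 : right_id heis_one heis_mul.
Proof.
move=> x; apply: heis_inj; first exact: addr0.
by rewrite heis_scaM hermR0r addr0; apply: addr0.
Qed.
Fact heis_mulVg : left_inverse heis_one heis_inv heis_mul.
Proof.
move=> x; apply: heis_inj; first exact: addNr.
by rewrite heis_scaM hermRNl heisE subrr.
Qed.
Fact heis_mulgV : right_inverse heis_one heis_inv heis_mul.
Proof.
move=> x; apply: heis_inj; first exact: addrN.
by rewrite heis_scaM hermRNr [X in X - _]addrC heisE subrr.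
Qed.
HB.instance Definition _ := isGroup.Build Heis
  heis_mulA heis_mul1g heis_mulg1 heis_mulVg heis_mulgV.

(* [tens L R] carries no unit predicate, so an automorphism is given together *)
(* with its inverse.                                                          *)
Definition unitary_pred (A : 'M[LR]_n * 'M[LR]_n) :=
  [&& A.1 *m A.2 == 1%:M, A.2 *m A.1 == 1%:M
    & adjmx A.1 *m gram *m A.1 == gram].
Definition Unitary : Type := {A | unitary_pred A}.
HB.instance Definition _ := Choice.on Unitary.
Definition mk_unitary A A' : unitary_pred (A, A') -> Unitary :=
  exist unitary_pred (A, A').
Definition umx (g : Unitary) : 'M[LR]_n := (val g).1.
Definition umx_inv (g : Unitary) : 'M[LR]_n := (val g).2.

Fact umxP g : [/\ umx g *m umx_inv g = 1%:M, umx_inv g *m umx g = 1%:M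
                & adjmx (umx g) *m gram *m umx g = gram].
Proof. by case/and3P: (valP g) => /eqP gg' /eqP g'g /eqP. Qed.

Fact umx_inj : injective umx.
Proof.
move=> g h eq_gh; have [[gg' g'g _] [hh' _ _]] := (umxP g, umxP h).
have eq_gh' : umx_inv g = umx_inv h.
  by rewrite -[LHS]mulmx1 -hh' mulmxA -eq_gh g'g mul1mx.
case: g h eq_gh eq_gh' {gg' g'g hh'} => [[A A'] ?] [[B B'] ?] /= eA eA'.
by apply: val_inj; congr (_, _).
Qed.

Fact hermR_umx g v w : hermR (umx g *m v) (umx g *m w) = hermR v w.
Proof.
have [_ _ hg] := umxP g.
by rewrite /hermR -[in RHS]hg adjmxM !mulmxA.
Qed.

Fact unitary_mul_subproof g h :
  unitary_pred (umx g *m umx h, umx_inv h *m umx_inv g).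
Proof.
have [[A1 A2 hA] [B1 B2 hB]] := (umxP g, umxP h).
apply/and3P; split; apply/eqP => /=.
- by rewrite mulmxA -(mulmxA (umx g)) B1 mulmx1.
- by rewrite mulmxA -(mulmxA (umx_inv h)) A2 mulmx1.
- by rewrite adjmxM -[RHS]hB -[in RHS]hA !mulmxA.
Qed.
Definition unitary_mul (g h : Unitary) : Unitary :=
  mk_unitary (unitary_mul_subproof g h).

Fact unitary_one_subproof : unitary_pred (1%:M, 1%:M).
Proof. by rewrite /unitary_pred /= !mulmx1 adjmx1 mul1mx !eqxx. Qed.
Definition unitary_one : Unitary := mk_unitary unitary_one_subproof.

Fact unitary_inv_subproof g : unitary_pred (umx_inv g, umx g).
Proof.
have [A1 A2 hA] := umxP g.
rewrite /unitary_pred /= A1 A2 !eqxx /= -[X in _ *m X *m _]hA !mulmxA -adjmxM.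
by rewrite A1 adjmx1 mul1mx -mulmxA A1 mulmx1.
Qed.
Definition unitary_inv (g : Unitary) : Unitary :=
  mk_unitary (unitary_inv_subproof g).

Fact unitary_mulA : associative unitary_mul.
Proof. by move=> x y z; apply: umx_inj; apply: mulmxA. Qed.
Fact unitary_mul1g : left_id unitary_one unitary_mul.
Proof. by move=> x; apply: umx_inj; apply: mul1mx. Qed.
Fact unitary_mulg1 : right_id unitary_one unitary_mul.
Proof. by move=> x; apply: umx_inj; apply: mulmx1. Qed.
Fact unitary_mulVg : left_inverse unitary_one unitary_inv unitary_mul.
Proof. by move=> x; apply: umx_inj; case: (umxP x). Qed.
Fact unitary_mulgV : right_inverse unitary_one unitary_inv unitary_mul.
Proof. by move=> x; apply: umx_inj; case: (umxP x). Qed.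
HB.instance Definition _ := isGroup.Build Unitary
  unitary_mulA unitary_mul1g unitary_mulg1 unitary_mulVg unitary_mulgV.

Fact unitary_act_subproof g x : heis_pred (umx g *m heis_vec x, heis_sca x).
Proof. by rewrite /heis_pred /= hermR_umx heisE. Qed.
Definition unitary_act (g : Unitary) (x : Heis) : Heis :=
  mk_heis (unitary_act_subproof g x).

Fact unitary_act1 x : unitary_act 1%g x = x.
Proof. by apply: heis_inj; first exact: mul1mx. Qed.
Fact unitary_actM g h x :
  unitary_act (g * h)%g x = unitary_act g (unitary_act h x).
Proof. by apply: heis_inj => //; rewrite [RHS]mulmxA. Qed.
Fact unitary_act_mul g x y :
  unitary_act g (x * y)%g = (unitary_act g x * unitary_act g y)%g.
Proof.
apply: heis_inj; first exact: mulmxDr.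
by congr (_ + _); rewrite [RHS]hermR_umx.
Qed.
Definition unitary_aut : leftaut Heis Unitary :=
  LeftAut unitary_act1 unitary_actM unitary_act_mul.

End UnitaryHeisenberg.

Notation HU V R := (sdp (unitary_aut V R)).

Section Extends.
Variables (k : finFieldType) (L : quadExt k) (V : hermSpace L).
Variable R : comAlgType k.

(* v |-> v (x) 1 *)
Definition vec_of (v : V) : 'cV[tens L R]_(\dim {:V}) :=
  \col_i tens_of R (coord (vbasis {:V}) i v).

Fact hermR_of v w : hermR (V := V) (vec_of v) (vec_of w) = tens_of R (herm V v w).
Proof.
rewrite [in RHS](coord_vbasis (memvf v)) [in RHS](coord_vbasis (memvf w)).
rewrite linear_sumr tens_of_sum /hermR mxE; apply: eq_bigr => j _.
rewrite linearZr_LR /= linear_sumlz mulr_sumr tens_of_sum mxE mulr_suml.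
apply: eq_bigr => i _.
rewrite linearZl_LR /= !mxE conjR_of -!tens_of_mul.
by congr (tens_of _ _); rewrite mulrC.
Qed.

End Extends.

HB.instance Definition _ (k : finFieldType) (L : quadExt k) (V : hermSpace L)
  (R : finComAlgType k) := Finite.on (Heis V R).
HB.instance Definition _ (k : finFieldType) (L : quadExt k) (V : hermSpace L)
  (R : finComAlgType k) := Finite.on (Unitary V R).
Section Functoriality.
Variables (k : finFieldType) (L : quadExt k) (V : hermSpace L).
Variables (R S : comAlgType k) (phi : {lrmorphism R -> S}).
Local Notation T := (tens_map phi : tens L R -> tens L S).

Fact tens_map_conj a : T (conjR a) = conjR (T a).
Proof. exact: tens_map_lift. Qed.

Fact map_gram : map_mx T (gram V R) = gram V S.
Proof. by apply/matrixP=> i j; rewrite !mxE tens_map_of. Qed.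

Fact map_adjmx m p (A : 'M[tens L R]_(m, p)) :
  map_mx T (adjmx A) = adjmx (map_mx T A).
Proof. by apply/matrixP=> i j; rewrite !mxE tens_map_conj. Qed.

Fact map_hermR v w :
  T (hermR (V := V) v w) = hermR (V := V) (map_mx T v) (map_mx T w).
Proof. by rewrite /hermR -map_gram -map_adjmx -!map_mxM [RHS]mxE. Qed.

Fact heis_map_subproof (x : Heis V R) :
  heis_pred (V := V) (map_mx T (heis_vec x), T (heis_sca x)).
Proof.
by rewrite /heis_pred /= -tens_map_conj -map_hermR -heisE rmorphD.
Qed.
Definition heis_map (x : Heis V R) : Heis V S := mk_heis (heis_map_subproof x).

Fact unitary_map_subproof (g : Unitary V R) :
  unitary_pred (V := V) (map_mx T (umx g), map_mx T (umx_inv g)).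
Proof.
have [gg' g'g hg] := umxP g.
rewrite /unitary_pred /= -map_gram -map_adjmx -!map_mxM gg' g'g hg.
by rewrite !map_mx1 !eqxx.
Qed.
Definition unitary_map (g : Unitary V R) : Unitary V S :=
  mk_unitary (unitary_map_subproof g).

Definition HU_map (x : HU V R) : HU V S := (heis_map x.1, unitary_map x.2).

Fact heis_map_mul x y : heis_map (x * y)%g = (heis_map x * heis_map y)%g.
Proof.
apply: heis_inj; first exact: map_mxD.
rewrite [RHS](_ : _ = heis_sca (heis_map x) + heis_sca (heis_map y) +
  hermR (heis_vec (heis_map x)) (heis_vec (heis_map y))) //.
by rewrite -map_hermR [LHS]rmorphD; congr (_ + _); apply: rmorphD.
Qed.
Fact unitary_map_mul g h :
  unitary_map (g * h)%g = (unitary_map g * unitary_map h)%g.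
Proof. by apply: umx_inj; apply: map_mxM. Qed.
Fact heis_map_act g x :
  heis_map (unitary_act g x) = unitary_act (unitary_map g) (heis_map x).
Proof. by apply: heis_inj => //; apply: map_mxM. Qed.
Fact HU_map_mul (x y : HU V R) : HU_map (x * y)%g = (HU_map x * HU_map y)%g.
Proof.
case: x y => [x g] [y h]; congr (_, _); last exact: unitary_map_mul.
by rewrite [LHS]heis_map_mul; congr (_ * _)%g; apply: heis_map_act.
Qed.
Fact HU_map1 : HU_map 1%g = 1%g.
Proof. by apply: (mulgI (HU_map 1%g)); rewrite -HU_map_mul !mulg1. Qed.
HB.instance Definition _ := isMultiplicative.Build (HU V R) (HU V S)
  HU_map HU_map_mul.
HB.instance Definition _ := Multiplicative_isUMagmaMorphism.Build
  (HU V R) (HU V S) HU_map HU_map1.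
End Functoriality.

(* the q-power Frobenius endomorphism on R-points *)
Definition HU_frob (k : finFieldType) (L : quadExt k) (V : hermSpace L)
  (R : comAlgType k) : HU V R -> HU V R := HU_map (frob (R:=R)).

Section AlgebraicClosure.
Variable k : finFieldType.

Definition Fbar : Type := tag (countable_algebraic_closure k).
HB.instance Definition _ := CountRing.ClosedField.on Fbar.
Definition Fbar_inj : {rmorphism k -> Fbar} :=
  sval (tagged (countable_algebraic_closure k)).

Definition Fbar_scale (a : k) (x : Fbar) : Fbar := Fbar_inj a * x.
Fact Fbar_scalerA a b x : Fbar_scale a (Fbar_scale b x) = Fbar_scale (a * b) x.
Proof. by rewrite /Fbar_scale rmorphM mulrA. Qed.
Fact Fbar_scale1r : left_id 1 Fbar_scale.
Proof. by move=> x; rewrite /Fbar_scale rmorph1 mul1r. Qed.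
Fact Fbar_scalerDr : right_distributive Fbar_scale +%R.
Proof. by move=> a x y; apply: mulrDr. Qed.
Fact Fbar_scalerDl x : {morph Fbar_scale^~ x : a b / a + b}.
Proof. by move=> a b; rewrite /Fbar_scale rmorphD mulrDl. Qed.
HB.instance Definition _ := GRing.Zmodule_isLmodule.Build k Fbar
  Fbar_scalerA Fbar_scale1r Fbar_scalerDr Fbar_scalerDl.
Fact Fbar_scalerAl a (x y : Fbar) : a *: (x * y) = a *: x * y.
Proof. exact: mulrA. Qed.
HB.instance Definition _ := GRing.Lmodule_isLalgebra.Build k Fbar Fbar_scalerAl.
HB.instance Definition _ := GRing.Lalgebra_isComAlgebra.Build k Fbar.

(* [Fq j] is the subfield of order q^j of [Fbar], for j > 0 and q = #|k|; the *)
(* junk index j = 0 is read as 1.                                             *)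
Definition Fq_order j : nat := #|k| ^ j.-1.+1.

Definition Fq_pred j : {pred Fbar} := [pred x | x ^+ Fq_order j == x].

Fact expf_Fq_order j (a : k) : a ^+ Fq_order j = a.
Proof.
by rewrite /Fq_order; elim: _.+1 => // e IHe; rewrite expnS exprM expf_card.
Qed.

Fact pchar_Fq_order j : [pchar Fbar].-nat (Fq_order j).
Proof. by rewrite pnatX pchar_nat_card. Qed.

Fact Fq_divalg_closed j : divalg_closed (Fq_pred j).
Proof.
split=> [|a x y|x y]; rewrite !inE ?expr1n //.
  move=> /eqP xF /eqP yF.
  by rewrite exprDn_pchar ?pchar_Fq_order // exprZn expf_Fq_order xF yF.
by move=> /eqP xF /eqP yF; rewrite expr_div_n xF yF.
Qed.
HB.instance Definition _ j := GRing.isDivalgClosed.Build k Fbar (Fq_pred j)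
  (Fq_divalg_closed j).

Record Fq j : Type := MkFq { Fq_val : Fbar; Fq_valP : Fq_val \in Fq_pred j }.
HB.instance Definition _ j := [isSub for @Fq_val j].
HB.instance Definition _ j := [Countable of Fq j by <:].
HB.instance Definition _ j := [SubChoice_isSubIntegralDomain of Fq j by <:].
HB.instance Definition _ j := [SubIntegralDomain_isSubField of Fq j by <:].
HB.instance Definition _ j := [SubZmodule_isSubLmodule of Fq j by <:].
HB.instance Definition _ j :=
  [SubNzRing_SubLmodule_isSubLalgebra of Fq j by <:].
HB.instance Definition _ j := [SubLalgebra_isSubAlgebra of Fq j by <:].

Definition Fq_enum j : seq (Fq j) :=
  pmap insub (undup (sval (closed_field_poly_normal
    ('X^(Fq_order j) - 'X : {poly Fbar})))).
Fact Fq_enumP j : Finite.axiom (Fq_enum j).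
Proof.
move=> x; rewrite count_uniq_mem ?pmap_sub_uniq ?undup_uniq // mem_pmap_sub.
rewrite mem_undup; case: closed_field_poly_normal => r /= rE.
have q_gt1 : (1 < Fq_order j)%N.
  by rewrite -(exp1n j.-1.+1) ltn_exp2r // finNzRing_gt1.
have p_neq0 : ('X^(Fq_order j) - 'X : {poly Fbar}) != 0.
  rewrite -size_poly_gt0 size_polyDl ?size_polyXn // size_polyN size_polyX.
  exact: q_gt1.
have: root ('X^(Fq_order j) - 'X) (Fq_val x).
  by rewrite rootE !hornerE /= (eqP (Fq_valP x)) subrr.
by rewrite rE rootZ ?lead_coef_eq0 // root_prod_XsubC => ->.
Qed.
HB.instance Definition _ j := isFinite.Build (Fq j) (@Fq_enumP j).

HB.instance Definition _ j :=
  GRing.RMorphism.copy (@Fq_val j) (val : Fq j -> Fbar).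
HB.instance Definition _ j :=
  GRing.Linear.copy (@Fq_val j) (val : Fq j -> Fbar).

End AlgebraicClosure.

Section GaloisAction.
Variables (k : finFieldType) (L : quadExt k) (V : hermSpace L).

Section IterFrob.
Variable R : comAlgType k.
Local Notation frobn j := (fun x : R => x ^+ (#|k| ^ j)).

Fact iter_HU_fst j (x : HU V R) :
  heis_sca (iter j (HU_frob (R:=R)) x).1 = map_mx (frobn j) (heis_sca x.1).
Proof.
elim: j => [|j IHj] /=; first by apply/rowP=> i; rewrite !mxE.
rewrite [LHS](_ : _ = tens_map (frob (R:=R))
  (heis_sca (iter j (HU_frob (R:=R)) x).1)) // IHj.
by apply/rowP=> i; rewrite !mxE /= /frob -exprM expnSr.
Qed.
Fact iter_HU_vec j (x : HU V R) :
  heis_vec (iter j (HU_frob (R:=R)) x).1 =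
    map_mx (map_mx (frobn j)) (heis_vec x.1).
Proof.
elim: j => [|j IHj] /=; first by apply/colP=> i; apply/rowP=> l; rewrite !mxE.
rewrite [LHS](_ : _ = map_mx (tens_map (frob (R:=R)))
  (heis_vec (iter j (HU_frob (R:=R)) x).1)) // IHj.
by apply/colP=> i; apply/rowP=> l; rewrite !mxE /= /frob -exprM expnSr.
Qed.
Fact iter_HU_umx j (x : HU V R) :
  umx (iter j (HU_frob (R:=R)) x).2 = map_mx (map_mx (frobn j)) (umx x.2).
Proof.
elim: j => [|j IHj] /=.
  by apply/matrixP=> i l; apply/rowP=> s; rewrite !mxE.
rewrite [LHS](_ : _ = map_mx (tens_map (frob (R:=R)))
  (umx (iter j (HU_frob (R:=R)) x).2)) // IHj.
by apply/matrixP=> i l; apply/rowP=> s; rewrite !mxE /= /frob -exprM expnSr.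
Qed.
Fact iter_HU_frobM j (x y : HU V R) :
  iter j (HU_frob (R:=R)) (x * y)%g =
    (iter j (HU_frob (R:=R)) x * iter j (HU_frob (R:=R)) y)%g.
Proof. by elim: j => //= j ->; apply: HU_map_mul. Qed.
End IterFrob.

Fact expr_Fq j (x : Fq k j) : x ^+ (#|k| ^ j.-1.+1) = x.
Proof. by apply: val_inj; rewrite rmorphXn; apply/eqP/(Fq_valP x). Qed.

Variable m : nat.
Local Notation Gm := (HU V (Fq k m)).
Local Notation F := (HU_frob (R := Fq k m)).

Fact iter_HU_frob_id (x : Gm) : iter m.-1.+1 F x = x.
Proof.
have id_row (a : tens L (Fq k m)) :
    map_mx (fun x => x ^+ (#|k| ^ m.-1.+1)) a = a.
  by apply/rowP=> i; rewrite mxE expr_Fq.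
apply/eqP/andP; split; apply/eqP; last first.
  by apply: umx_inj; rewrite iter_HU_umx; apply/matrixP=> i l; rewrite mxE id_row.
apply: heis_inj; last by rewrite iter_HU_fst id_row.
by rewrite iter_HU_vec; apply/colP=> i; rewrite mxE id_row.
Qed.

(* cyclic group of order m, for m > 0; sigma generates it and acts as F *)
Definition Gam : finGroupType := 'I_m.-1.+1.
Definition sigma : Gam := inZp 1.

Definition gal_act (a : Gam) (x : Gm) : Gm := iter (a : 'I_m.-1.+1) F x.
Fact gal_act1 x : gal_act 1%g x = x. Proof. by []. Qed.
Fact gal_actM a b x : gal_act (a * b)%g x = gal_act a (gal_act b x).
Proof.
rewrite /gal_act -iterD.
rewrite [in RHS](divn_eq (a + b) m.-1.+1) addnC iterD; congr (iter _ F _).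
by elim: (_ %/ _)%N => // r IHr; rewrite mulSn iterD -IHr iter_HU_frob_id.
Qed.
Fact gal_act_mul a x y : gal_act a (x * y)%g = (gal_act a x * gal_act a y)%g.
Proof. exact: iter_HU_frobM. Qed.
Definition gal_aut : leftaut Gm Gam := LeftAut gal_act1 gal_actM gal_act_mul.

Definition HUG : finGroupType := sdp gal_aut.

End GaloisAction.

(* [K] is an algebraic closure of a completion of rat for an absolute value   *)
(* that is non-archimedean with |ell| = 1/ell, hence the ell-adic one.        *)
Record padic_absval (ell : nat) (Q : fieldType) (nu : Q -> rat) : Prop := {
  absval_ge0 : forall x, 0 <= nu x;
  absval_eq0 : forall x, (nu x == 0) = (x == 0);
  absvalM : forall x y, nu (x * y) = nu x * nu y;
  absvalD : forall x y, nu (x + y) <= Num.max (nu x) (nu y);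
  absval_ell : nu ell%:R = ell%:R^-1 }.

Definition absval_dense (Q : fieldType) (nu : Q -> rat) : Prop :=
  forall (x : Q) (eps : rat), 0 < eps -> exists r : rat, nu (x - ratr r) < eps.

Definition absval_complete (Q : fieldType) (nu : Q -> rat) : Prop :=
  forall u : nat -> Q,
    (forall eps : rat, 0 < eps -> exists N, forall a b : nat,
       (N <= a)%N -> (N <= b)%N -> nu (u a - u b) < eps) ->
  exists x : Q, forall eps : rat, 0 < eps -> exists N, forall a : nat,
    (N <= a)%N -> nu (u a - x) < eps.

Definition is_Qlbar (ell : nat) (K : closedFieldType) : Prop :=
  exists (Q : fieldType) (nu : Q -> rat) (iota : {rmorphism Q -> K}),
    [/\ padic_absval ell nu, absval_dense nu, absval_complete nu
      & integralRange iota].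

Definition expgz (G : groupType) (x : G) (t : int) : G :=
  match t with Posz a => (x ^+ a)%g | Negz a => (x ^- a.+1)%g end.

Section HeisenbergWeil.
Variables (k : finFieldType) (L : quadExt k) (V : hermSpace L).
Variables (kappa : {lrmorphism L -> Fbar k}) (K : closedFieldType).
Local Notation q := #|k|.
Local Notation G j := (HU V (Fq k j)).

(* F_{q^j,+}, inside Fbar *)
Definition Fplus j : {pred Fbar k} := [pred x | x ^+ (q ^ j) + x == 0].

Record is_char_Fplus (psi : Fbar k -> K) : Prop := {
  charD : {in Fplus 1 &, forall x y, psi (x + y) = psi x * psi y};
  char_neq0 : {in Fplus 1, forall x, psi x != 0} }.

Definition nontrivial_Fplus (psi : Fbar k -> K) : Prop :=
  exists2 x, x \in Fplus 1 & psi x != 1.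

(* psi composed with the trace of F_{q^2j} over F_{q^2} *)
Definition psi_level (psi : Fbar k -> K) j (x : Fbar k) : K :=
  psi (\sum_(s < j) x ^+ (q ^ (2 * s))).

(* x (x) r |-> kappa x * r, for j odd an isomorphism of L (x)_k F_{q^j} onto  *)
(* F_{q^2j}                                                                   *)
Definition tens_eval j (x : tens L (Fq k j)) : Fbar k :=
  \sum_i kappa (tens_basis i) * Fq_val (x 0 i).

(* dimension over F_{q^2j} of ker(g - id), g acting on columns *)
Definition fix_dim j (g : Unitary V (Fq k j)) : nat :=
  \rank (kermx (map_mx (@tens_eval j) (umx g - 1%:M))^T).

Record is_HeisenbergWeil (psi : Fbar k -> K) j N
    (rho : mx_representation K [set: G j] N) : Prop := {
  HW_irr : mx_irreducible (subg_repr rho (subsetT (sdp_normal_group (unitary_aut V (Fq k j)))));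
  HW_central : exists2 v : 'rV[K]_N, v != 0 &
    forall x : G j, x.2 = 1%g -> heis_vec x.1 = 0 ->
      v *m rho x = psi_level psi j (tens_eval (heis_sca x.1)) *: v;
  HW_trace : forall g : Unitary V (Fq k j),
    \tr (rho (1%g, g)) =
      (-1) ^+ \dim {:V} * (- (q ^ j)%:R) ^+ fix_dim g }.

(* the representation space is unchanged *)
Definition extends m N (rhot : mx_representation K [set: HUG V m] N)
    (rho : mx_representation K [set: G m] N) : Prop :=
  forall g : G m, rhot (g, 1%g) = rho g.

(* y in G(F_{q^d}) represents the class N_{i,t}(g, sigma^i), d = gcd(m, i)    *)
Definition is_norm m i (t : int) (g : G m) (y : G (gcdn m i)) : Prop :=
  let F j := iter j (HU_frob (V := V) (R := Fbar k)) in
  let incl j := HU_map (V := V) (@Fq_val k j) in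
  let d := gcdn m i in
  let c : HUG V m := (expgz ((g, sigma m ^+ i) : HUG V m) t *
                      ((1, expgz (sigma m) (- (i%:Z * t))) : HUG V m))%g in
  exists alpha : HU V (Fbar k),
    (alpha^-1 * F d alpha = incl m c.1)%g /\
    (incl d y = alpha * (\prod_(0 <= s < m %/ d) F (i * s)%N (incl m g)) *
                alpha^-1)%g.

Definition trace_identity (rho_deg : nat -> nat)
    (rho : forall j, mx_representation K [set: G j] (rho_deg j))
    m i t (rhot : mx_representation K [set: HUG V m] (rho_deg m)) : Prop :=
  forall (g : G m) (y : G (gcdn m i)), is_norm t g y ->
    \tr (rhot (g, (sigma m ^+ i)%g)) = \tr (rho (gcdn m i) y).

End HeisenbergWeil.

(* Main.v *)
Require Import Defs.
From HB Require Import structures.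
From mathcomp Require Import all_boot all_order all_fingroup all_algebra.
From mathcomp Require Import all_solvable all_field all_character.
From mathcomp Require Import ring zify.

(** Restricting scalars to L puts the unitary group and Frobenius on the same
    footing: with V_j = V (x) F_(q^j), both act L-linearly on V_m and preserve
    the L-valued hermitian form obtained from h by the trace F_(q^m) -> k. An
    automorphism A of this kind is lifted, up to a scalar, to an operator T with
    T W(v) = W(A v) T, where W(v) is the operator of a lift of v to the
    Heisenberg group. The point is a canonical choice of the scalar.

    The sum of the W(v) W(A v)^-1 over v is tr(T) T^-1 up to the degree N of the
    representation. Its trace counts fixed points, so tr(T) tr(T^-1) is the
    number of v with A v = v. Call T normal if tr(T) and tr(T^-1) are the same
    integer, congruent to (-1)^n modulo q + 1; as 1 and -1 differ modulo q + 1,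
    normal lifts are unique ([weyl_normal_inj]). They are multiplicative
    ([weyl_normal_mul]): expanding two lifts turns the trace of their product
    into a Gauss sum over an L-subspace of V x V, with a phase multiplied by the
    norm of x when the argument is multiplied by x in L. The group L^* acts
    freely away from 0, and the norm is onto k^*, so the sum is an integer
    congruent to 1 modulo q + 1 ([gauss_sum_mod]).

    The traces prescribed on U(V_j) are those of normal lifts ([rhoU_normal]),
    since q is -1 modulo q + 1 and j is odd. Hence, if T is the normal lift of
    Frobenius, then rho_m(g) T^s defines a representation of the semidirect
    product ([HW_frobenius_operator]). This is the extension.

    For the trace identity write g = (h, u) with h in the Heisenberg group. The
    trace of rho_m(g) T^i is 0 unless the affine map v |-> h + u F^i v has a
    fixed point, and then it is the value of the central character at the
    defect of this fixed point times the trace of the normal lift rho_m(u) T^i.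
    The same holds for the norm y at level d. In the semidirect product of
    HU(V)(Fbar) with the powers of F, conjugation by alpha carries the group
    generated by g F^i and F^m onto the one generated by y and F^d
    ([twisted_fixed]). So the fixed points at level m correspond to those at
    level d ([card_fix_src_dst]), in the affine and in the linear case, and the
    defects have the same trace to L ([defect_trL]). The two traces of normal
    lifts are integers with equal squares and equal classes modulo q + 1, hence
    equal ([ext_trace_identity]).

    Uniqueness is Schur's lemma, together with the identity at g = 1
    ([ext_unique]). *)

Set Implicit Arguments.
Unset Strict Implicit.
Unset Printing Implicit Defensive.

Import Order.TTheory GRing.Theory Num.Theory.
Local Open Scope ring_scope.

(** * Gauss sums modulo q + 1 *)

Lemma predn_sqr a : ((a ^ 2).-1 = a.+1 * a.-1)%N.
Proof. by case: a => // a; rewrite -mulnn; lia. Qed.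

Lemma pchar0_intr_inj (K : fieldType) :
  [pchar K] =i pred0 -> injective (intr : int -> K).
Proof.
move=> K0 s t /eqP; rewrite -subr_eq0 -rmorphB /= => /eqP st.
apply/eqP; rewrite -subr_eq0; case: (s - t) st => r /eqP /=.
  by rewrite -pmulrn ((pcharf0P K).1 K0).
by rewrite NegzE mulrNz oppr_eq0 -pmulrn ((pcharf0P K).1 K0).
Qed.

(** A square root in the integers is determined by its class modulo q + 1,
    because 1 and -1 are distinct there. *)
Lemma signed_root_inj (q n : nat) (s t : int) : (1 < q)%N ->
  s%:~R = (-1) ^+ n :> 'Z_q.+1 -> t%:~R = (-1) ^+ n :> 'Z_q.+1 ->
  s ^+ 2 = t ^+ 2 -> s = t.
Proof.
move=> q_gt1 sE tE /eqP; rewrite eqf_sqr => /orP[/eqP //|/eqP st].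
have: 2%:R = 0 :> 'Z_q.+1.
  move: sE; rewrite st rmorphN /= tE => /eqP; rewrite eq_sym -addr_eq0 -mulr2n.
  by rewrite -signr_odd; case: odd; rewrite ?mulNrn ?oppr_eq0 => /eqP.
by move/(congr1 (@nat_of_ord _)); rewrite val_Zp_nat ?modn_small // ltnS ltnW.
Qed.

Lemma card_free_action (X : finGroupType) (T : finType) (f : X -> T -> T)
    (S : {set T}) :
  (forall t, f 1%g t = t) -> (forall x y t, f (x * y)%g t = f x (f y t)) ->
  (forall x t, t \in S -> f x t \in S) ->
  (forall x t, t \in S -> f x t = t -> x = 1%g) ->
  (#|X| %| #|S|)%N.
Proof.
move=> f1 fM fS f_free.
have act1 : (fun t x => f x^-1%g t)^~ 1%g =1 id by move=> t; rewrite /= invg1.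
have actM t : act_morph (fun t x => f x^-1%g t) t.
  by move=> x y; rewrite invMg fM.
pose to := TotalAction act1 actM.
have toS : [acts [set: X], on S | to].
  apply/actsP=> x _ t; apply/idP/idP=> [St|]; last exact: fS.
  by have := fS x _ St; rewrite /= -fM mulgV f1.
rewrite -(acts_sum_card_orbit toS).
apply: dvdn_sum => _ /imsetP[t St ->].
rewrite card_orbit (_ : 'C_([set: X])[t | to]%g = 1%g) ?indexg1 ?cardsT //.
apply/setP=> x; rewrite !inE /=; apply/idP/idP => [|/eqP->]; last first.
  rewrite sub1set inE; apply/eqP; exact: act1.
rewrite sub1set inE /= => /eqP xt; rewrite -eq_invg1; apply/eqP.
exact: f_free St xt.
Qed.

Section GaussSums.
Variables (k : finFieldType) (X : finGroupType) (Nm : X -> k).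
Variables (Lam : lmodType k) (K : fieldType).
Hypothesis K0 : [pchar K] =i pred0.
Hypothesis cardX : #|X| = (#|k| ^ 2).-1.
Hypothesis Nm_onto : forall c, c != 0 -> exists x, Nm x = c.

Definition add_char (chi : Lam -> K) :=
  chi 0 = 1 /\ forall a b, chi (a + b) = chi a * chi b.

Lemma add_char_neq0 chi a : add_char chi -> chi a != 0.
Proof.
case=> chi0 chiD; apply/eqP => chia0.
by have := oner_neq0 K; rewrite -chi0 -(subrr a) chiD chia0 mul0r eqxx.
Qed.

Lemma add_charV chi a : add_char chi -> chi (- a) = (chi a)^-1.
Proof.
move=> chiP; apply: (mulfI (add_char_neq0 a chiP)).
by rewrite mulfV ?add_char_neq0 //; case: chiP => chi0 chiD; rewrite -chiD subrr.
Qed.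

Lemma add_charN chi : add_char chi -> add_char (fun a => chi (- a)).
Proof. by case=> chi0 chiD; split=> [|a b]; rewrite ?oppr0 // opprD chiD. Qed.

(** Grouping the terms of a Gauss sum by the k-lines they lie on: a line
    contributes according to whether chi is trivial on it. *)
Definition line_trivial (chi : Lam -> K) l := [forall c : k, chi (c *: l) == 1].

Lemma line_trivialN chi l :
  line_trivial (fun a => chi (- a)) l = line_trivial chi l.
Proof.
apply/forallP/forallP => h c; have := h (- c); first by rewrite scaleNr opprK.
by rewrite scaleNr.
Qed.

Lemma sum_line chi l : add_char chi -> ~~ line_trivial chi l ->
  \sum_(c : k) chi (c *: l) = 0.
Proof.
move=> [_ chiD] /forallPn[c0 c0l].
apply/eqP; have : (chi (c0 *: l) - 1) * (\sum_(c : k) chi (c *: l)) = 0.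
  rewrite mulrBl mul1r mulr_sumr [X in _ - X](reindex_inj (addrI c0)) /=.
  apply/eqP; rewrite subr_eq0 eq_sym; apply/eqP.
  by apply: eq_bigr => c _; rewrite -chiD -scalerDl.
by move/eqP; rewrite mulf_eq0 subr_eq0 (negPf c0l).
Qed.

Variables (Y : finType) (f : X -> Y -> Y) (G : Y -> Lam) (y0 : Y) (S : {set Y}).
Hypothesis f1 : forall y, f 1%g y = y.
Hypothesis fM : forall x x' y, f (x * x')%g y = f x (f x' y).
Hypothesis f0 : forall x, f x y0 = y0.
Hypothesis f_free : forall x y, y != y0 -> f x y = y -> x = 1%g.
Hypothesis fG : forall x y, G (f x y) = Nm x *: G y.
Hypothesis G0 : G y0 = 0.
Hypothesis fS : forall x y, y \in S -> f x y \in S.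
Hypothesis Sy0 : y0 \in S.

Lemma line_trivial_act chi x y :
  line_trivial chi (G y) -> line_trivial chi (G (f x y)).
Proof.
by move=> /forallP h; apply/forallP => c; rewrite fG scalerA; apply: h.
Qed.

(** As Nm is onto k^*, the terms on the lines where chi is nontrivial can be
    averaged over k^*, where chi has mean - 1 / (q - 1); as the action is free,
    their number is a multiple of q^2 - 1. *)
Lemma gauss_sum_count chi : add_char chi ->
  let S0 := [set y in S | line_trivial chi (G y)] in
  \sum_(y in S) chi (G y) =
   (#|S0|%:Z - (#|S :\: S0| %/ (#|k| ^ 2).-1 * #|k|.+1)%:Z)%:~R.
Proof.
move=> chiP S0; have [chi0 chiD] := chiP.
have fK x : cancel (f x) (f x^-1%g) by move=> y; rewrite -fM mulVg f1.
have fKV x : cancel (f x^-1%g) (f x) by move=> y; rewrite -fM mulgV f1.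
have fN x y : (f x y \in S :\: S0) = (y \in S :\: S0).
  have dir z y' : y' \in S :\: S0 -> f z y' \in S :\: S0.
    rewrite !inE => /andP[h y'S]; rewrite y'S fS // !andbT /= in h *.
    by apply: contra h => /(line_trivial_act z^-1%g); rewrite fK.
  by apply/idP/idP => [/(dir x^-1%g)|]; rewrite ?fK //; apply: dir.
have q_gt1 : (1 < #|k|)%N by apply: finNzRing_gt1.
have [r rE] : exists r, #|S :\: S0| = (r * (#|k| ^ 2).-1)%N.
  apply/dvdnP; rewrite -cardX; apply: (@card_free_action X Y f) => //.
    by move=> x y; rewrite fN.
  move=> x y; rewrite !inE => /andP[h yS]; apply: f_free.
  apply: contra h => /eqP->; rewrite Sy0; apply/forallP => c.
  by rewrite G0 scaler0 chi0.
rewrite (bigID (mem S0)) /= rmorphB /=; congr (_ + _).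
  rewrite (eq_bigr (fun=> 1)) => [|y].
    rewrite (eq_bigl (mem S0)) ?sumr_const // => y.
    by rewrite !inE andbA andbb.
  by rewrite !inE => /and3P[_ _ /forallP/(_ 1)]; rewrite scale1r => /eqP.
rewrite (eq_bigl (mem (S :\: S0))) => [|y]; last by rewrite /= !inE andbC.
have S1E c : c != 0 -> \sum_(y in S :\: S0) chi (c *: G y) =
    \sum_(y in S :\: S0) chi (G y).
  move=> /Nm_onto[x <-]; rewrite [RHS](reindex_inj (can_inj (fK x))) /=.
  by apply: eq_big => y; rewrite ?fN ?fG.
have: \sum_(c : k | c != 0) \sum_(y in S :\: S0) chi (c *: G y) =
    - #|S :\: S0|%:R.
  rewrite exchange_big /= -sum1_card natr_sum -sumrN; apply: eq_bigr => y.
  rewrite !inE => /andP[h yS]; rewrite yS /= in h.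
  have := sum_line chiP h; rewrite (bigD1 0) //= scale0r chi0 addrC => /eqP.
  by rewrite addr_eq0 => /eqP.
rewrite (eq_bigr _ S1E) sumr_const.
rewrite (_ : #|[pred c : k | c != 0]| = #|k|.-1); last first.
  by rewrite (cardC1 (0 : k)).
have q1 : (#|k|.-1)%:R != 0 :> K.
  by rewrite ((pcharf0P K).1 K0); case: #|k| q_gt1 => [|[|]].
rewrite rE mulnK; last by case: #|k| q_gt1 => [|[|?]].
have -> : (#|k| ^ 2).-1 = (#|k|.+1 * #|k|.-1)%N.
  exact: predn_sqr.
move=> h; apply: (mulIf q1); by rewrite mulr_natr h mulnA natrM -mulNr.
Qed.

(** The fixed point y0 contributes 1, and everything else comes in free orbits
    of q^2 - 1 elements, a multiple of q + 1. The count does not distinguish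
    chi from its inverse. Both facts are what pins down signs later on. *)
Lemma gauss_sum_mod chi : add_char chi -> exists2 E : int,
  E%:~R = 1 :> 'Z_(#|k|.+1) &
  \sum_(y in S) chi (G y) = E%:~R /\ \sum_(y in S) chi (- G y) = E%:~R.
Proof.
move=> chiP; have chiNP := add_charN chiP.
pose S0 := [set y in S | line_trivial chi (G y)].
exists (#|S0|%:Z - (#|S :\: S0| %/ (#|k| ^ 2).-1 * #|k|.+1)%:Z); last first.
  split; first exact: gauss_sum_count.
  rewrite (gauss_sum_count chiNP) /S0.
  have -> // : [set y in S | line_trivial (fun a => chi (- a)) (G y)] = S0.
  by apply/setP=> y; rewrite !inE line_trivialN.
have [chi0 _] := chiP.
have S0y0 : y0 \in S0.
  by rewrite inE Sy0; apply/forallP=> c; rewrite G0 scaler0 chi0.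
have : (#|X| %| #|S0 :\ y0|)%N.
  apply: (@card_free_action X Y f) => //.
    move=> x y; rewrite !inE => /and3P[yy0 yS yt].
    rewrite fS // line_trivial_act // !andbT.
    apply: contra yy0 => /eqP/(congr1 (f x^-1%g)).
    by rewrite -fM mulVg f1 f0 => ->.
  by move=> x y; rewrite !inE => /andP[yy0 _]; apply: f_free.
rewrite cardX (cardsD1 y0 S0) S0y0 => /dvdnP[r ->].
have q_gt1 : (1 < #|k|)%N by apply: finNzRing_gt1.
have -> : (#|k| ^ 2).-1 = (#|k|.+1 * #|k|.-1)%N.
  exact: predn_sqr.
set s := (_ %/ _)%N.
have q0 : #|k|.+1%:R = 0 :> 'Z_(#|k|.+1) by rewrite pchar_Zp // ltnS ltnW.
by rewrite rmorphB /= -!pmulrn natrD !natrM q0 !(mul0r, mulr0) subr0 addr0.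
Qed.
End GaussSums.

(** * Weyl systems and normalized lifts *)

Lemma invmx_mul (K : fieldType) N (A B : 'M[K]_N) :
  A \in unitmx -> B \in unitmx -> invmx (A *m B) = invmx B *m invmx A.
Proof.
move=> uA uB; have uAB : A *m B \in unitmx by rewrite unitmx_mul uA.
by apply: (can_inj (mulKmx uAB)); rewrite mulmxV // mulmxA mulmxK // mulmxV.
Qed.

Section WeylSystems.
Variables (k : finFieldType) (X : finGroupType) (Nm : X -> k).
Variables (Lam : lmodType k) (K : fieldType).
Hypothesis K0 : [pchar K] =i pred0.
Hypothesis cardX : #|X| = (#|k| ^ 2).-1.
Hypothesis Nm_onto : forall c, c != 0 -> exists x, Nm x = c.
Variables (V : finZmodType) (sc : X -> V -> V) (g : V -> V -> Lam).
Hypothesis sc1 : forall v, sc 1%g v = v.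
Hypothesis scM : forall x y v, sc (x * y)%g v = sc x (sc y v).
Hypothesis scD : forall x v w, sc x (v + w) = sc x v + sc x w.
Hypothesis sc_free : forall x v, v != 0 -> sc x v = v -> x = 1%g.
Hypothesis g_sc : forall x v w, g (sc x v) (sc x w) = Nm x *: g v w.
Hypothesis g00 : g 0 0 = 0.
Variable chi : Lam -> K.
Hypothesis chiP : add_char chi.
Variables (N n : nat) (W : V -> 'M[K]_N).
Hypothesis W0 : W 0 = 1%:M.
Hypothesis WM : forall v w, W v *m W w = chi (g v w) *: W (v + w).
Hypothesis trW : forall v, v != 0 -> \tr (W v) = 0.
Hypothesis W_cent :
  forall M, (forall v, M *m W v = W v *m M) -> is_scalar_mx M.
Hypothesis cardV : #|V| = (N ^ 2)%N.
Local Notation Zq := 'Z_(#|k|.+1).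
Hypothesis N_mod : N%:R = (-1) ^+ n :> Zq.

Let chi_neq0 a : chi a != 0. Proof. exact: add_char_neq0 chiP. Qed.
Let chi0 : chi 0 = 1. Proof. by case: chiP. Qed.
Let chiD a b : chi (a + b) = chi a * chi b. Proof. by case: chiP. Qed.
Let chiN a : chi (- a) = (chi a)^-1. Proof. exact: add_charV. Qed.

Lemma weyl_deg_gt0 : (0 < N)%N.
Proof.
have : (0 < #|V|)%N by apply/card_gt0P; exists 0.
by rewrite cardV; case: N.
Qed.

Lemma weyl_deg_neq0 : N%:R != 0 :> K.
Proof. by rewrite ((pcharf0P K).1 K0) -lt0n weyl_deg_gt0. Qed.

Lemma weyl_unit v : W v \in unitmx.
Proof.
have: W v *m ((chi (g v (- v)))^-1 *: W (- v)) = 1%:M.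
  by rewrite -scalemxAr WM scalerA mulVf // scale1r subrr W0.
by case/mulmx1_unit.
Qed.

Local Notation Wi v := (invmx (W v)).

Lemma weyl_inv v : Wi v = chi (- g v (- v)) *: W (- v).
Proof.
apply: (can_inj (mulKmx (weyl_unit v))); rewrite mulmxV ?weyl_unit //.
by rewrite -scalemxAr WM scalerA chiN mulVf // scale1r subrr W0.
Qed.

Lemma weyl_conjD u v M : W u *m (W v *m M *m Wi v) *m Wi u =
  W (u + v) *m M *m Wi (u + v).
Proof.
have uW v := weyl_unit v.
have -> : Wi (u + v) = chi (g u v) *: (Wi v *m Wi u).
  rewrite -invmx_mul ?uW // WM invmxZ ?uW // ?unitrZ ?unitfE //.
    by rewrite scalerA mulfV // scale1r.
  by rewrite unitmxZ ?unitfE.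
rewrite -scalemxAr scalemxAl -!mulmxA.
by rewrite 2!mulmxA WM -!scalemxAl.
Qed.

(** Schur's lemma turns an average over the Weyl operators into a trace. *)
Lemma weyl_average M :
  \sum_v W v *m M *m Wi v = (N%:R * \tr M)%:M.
Proof.
have /is_scalar_mxP[c sumE] : is_scalar_mx (\sum_v W v *m M *m Wi v).
  apply: W_cent => u; rewrite -[RHS](mulmxKV (weyl_unit u)); congr (_ *m _).
  rewrite mulmx_sumr mulmx_suml [LHS](reindex_inj (addrI u)) /=.
  by apply: eq_bigr => v _; rewrite weyl_conjD.
rewrite sumE; congr _%:M.
have := congr1 mxtrace sumE; rewrite mxtrace_scalar raddf_sum /=.
rewrite (eq_bigr (fun=> \tr M)) => [|v _]; last first.
  by rewrite mxtrace_mulC mulmxA mulVmx ?weyl_unit // mul1mx.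
rewrite sumr_const cardV => trE; apply: (mulIf weyl_deg_neq0).
by rewrite mulr_natr -trE -[_ *+ _]mulr_natr -mulnn natrM; ring.
Qed.

Lemma weyl_traceV v w : \tr (W v *m Wi w) = if v == w then N%:R else 0.
Proof.
rewrite weyl_inv -scalemxAr WM scalerA mxtraceZ.
case: eqP => [->|/eqP vw]; last by rewrite trW ?mulr0 // subr_eq0.
by rewrite subrr W0 mxtrace1 chiN mulVf // mul1r.
Qed.

Definition weyl_aut (A : V -> V) :=
  [/\ forall v w, A (v + w) = A v + A w,
      forall v w, g (A v) (A w) = g v w
    & forall x v, A (sc x v) = sc x (A v)].

Definition weyl_fix (A : V -> V) := [set v | A v == v].

(** Lifts are unique up to a scalar c, which multiplies the trace by c and the
    trace of the inverse by c^-1. Requiring the two traces to be the same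
    integer leaves a sign, and prescribing its class modulo q + 1, where 1
    and -1 differ, removes it; hence the notion of normal lift below. *)
Definition weyl_lift (T : 'M[K]_N) (A : V -> V) :=
  T \in unitmx /\ forall v, T *m W v = W (A v) *m T.

Definition weyl_normal (T : 'M[K]_N) (A : V -> V) :=
  weyl_lift T A /\ exists2 t : int, t%:~R = (-1) ^+ n :> Zq &
    \tr T = t%:~R /\ \tr (invmx T) = t%:~R.

Lemma weyl_lift_mul S T A B :
  weyl_lift S A -> weyl_lift T B -> weyl_lift (S *m T) (A \o B).
Proof.
move=> [uS SA] [uT TB]; split=> [|v]; first by rewrite unitmx_mul uS.
by rewrite -mulmxA TB mulmxA SA mulmxA.
Qed.

(** A lift T turns W (A v) into T W(v) T^-1, so that the sum is an average of T
    multiplied by T^-1. *)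
Lemma weyl_sumV T A : weyl_lift T A ->
  \sum_v W v *m Wi (A v) = (N%:R * \tr T) *: invmx T.
Proof.
move=> [uT TA]; rewrite -mul_scalar_mx -weyl_average mulmx_suml.
apply: eq_bigr => v _; apply: (can_inj (mulmxK uT)); rewrite mulmxKV //.
apply: (can_inj (mulmxK (weyl_unit v))); rewrite mulmxKV ?weyl_unit //.
by rewrite -!mulmxA TA mulKmx ?weyl_unit.
Qed.

Lemma weyl_sum T A : weyl_lift T A ->
  \sum_v W (A v) *m Wi v = (N%:R * \tr (invmx T)) *: T.
Proof.
move=> [uT TA]; rewrite -mul_mx_scalar -weyl_average mulmx_sumr.
by apply: eq_bigr => v _; rewrite !mulmxA TA mulmxK.
Qed.

(** Taking traces in [weyl_sumV]: only the v with A v = v survive. *)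
Lemma weyl_lift_trace T A : weyl_lift T A ->
  \tr T * \tr (invmx T) = #|weyl_fix A|%:R.
Proof.
move=> TA; apply: (mulfI weyl_deg_neq0); rewrite mulrA -mxtraceZ -(weyl_sumV TA).
rewrite raddf_sum /= -sum1_card natr_sum mulr_sumr [RHS]big_mkcond /=.
by apply: eq_bigr => v _; rewrite weyl_traceV inE eq_sym mulr1.
Qed.

Let aut0 A : weyl_aut A -> A 0 = 0.
Proof. by case=> AD _ _; apply: (addrI (A 0)); rewrite -AD !addr0. Qed.

Lemma weyl_fix_gt0 A : weyl_aut A -> (0 < #|weyl_fix A|)%N.
Proof.
by move=> /aut0 A0; apply/card_gt0P; exists 0; rewrite inE A0.
Qed.

Lemma weyl_lift_trace_neq0 T A : weyl_aut A -> weyl_lift T A -> \tr T != 0.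
Proof.
move=> /weyl_fix_gt0 A_gt0 /weyl_lift_trace trE; apply/eqP => tr0.
move/eqP: trE; rewrite tr0 mul0r eq_sym ((pcharf0P K).1 K0).
by case: #|_| A_gt0.
Qed.

(** T is a combination of the products of W (A v) and W(v)^-1, that is of
    Weyl operators at differences A v - v. *)
Lemma weyl_affine_fix T A b : weyl_aut A -> weyl_lift T A ->
  \tr (W b *m T) != 0 -> exists v, b + A v = v.
Proof.
move=> Aaut TA tr0; suff /existsP[v /eqP vE] : [exists v, b + A v == v].
  by exists v.
apply: contraNT tr0 => /existsPn noV.
have trV : \tr (invmx T) != 0.
  have := weyl_lift_trace TA; apply: contra_eq_neq => ->.
  rewrite mulr0 eq_sym ((pcharf0P K).1 K0) -lt0n.
  exact: weyl_fix_gt0.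
suff: (N%:R * \tr (invmx T)) * \tr (W b *m T) == 0.
  by rewrite !mulf_eq0 (negPf weyl_deg_neq0) (negPf trV).
rewrite -(mxtraceZ (N%:R * _)) scalemxAr -(weyl_sum TA) mulmx_sumr raddf_sum /=.
rewrite big1 // => v _.
rewrite mulmxA WM -scalemxAl mxtraceZ weyl_traceV ifN ?mulr0 //.
Qed.

Let sc0 x : sc x 0 = 0.
Proof. by apply: (addrI (sc x 0)); rewrite -scD !addr0. Qed.
Let scN x v : sc x (- v) = - sc x v.
Proof. by apply: (addrI (sc x v)); rewrite -scD !subrr sc0. Qed.

Definition weyl_disp (A : V -> V) v := g v (- A v) - g (A v) (- A v).

Lemma weyl_dispE A v : W v *m Wi (A v) = chi (weyl_disp A v) *: W (v - A v).
Proof. by rewrite weyl_inv -scalemxAr WM scalerA mulrC -chiD. Qed.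

Lemma weyl_disp_sc A x v : weyl_aut A ->
  weyl_disp A (sc x v) = Nm x *: weyl_disp A v.
Proof.
by case=> _ _ Asc; rewrite /weyl_disp Asc -scN !g_sc scalerBr.
Qed.

(** Expanding both lifts in Weyl operators makes the trace of the product a
    Gauss sum over the pairs (v, w) with (w - B w) + (v - A v) = 0, on which X
    acts freely away from 0. The product and its inverse give the sums for
    chi and for its inverse. *)
Lemma weyl_product_trace S T A B : weyl_aut A -> weyl_aut B ->
    weyl_lift S A -> weyl_lift T B ->
  exists2 E : int, E%:~R = 1 :> Zq &
    N%:R * \tr S * \tr T * \tr (invmx (S *m T)) = E%:~R /\
    N%:R * \tr (invmx S) * \tr (invmx T) * \tr (S *m T) = E%:~R.
Proof.
move=> Aaut Baut SA TB.
have [[AD Ag Asc] [BD Bg Bsc]] := (Aaut, Baut).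
pose Y := (V * V)%type; pose f x (y : Y) : Y := (sc x y.1, sc x y.2).
pose u (y : Y) := (y.2 - B y.2) + (y.1 - A y.1).
pose G (y : Y) := weyl_disp B y.2 + weyl_disp A y.1 +
  g (y.2 - B y.2) (y.1 - A y.1).
have uE (y : Y) : (W y.2 *m Wi (B y.2)) *m (W y.1 *m Wi (A y.1)) =
    chi (G y) *: W (u y).
  rewrite !weyl_dispE -scalemxAl -scalemxAr WM !scalerA -!chiD.
  by congr (chi _ *: _); rewrite /G !addrA.
have scB x v w : sc x v - sc x w = sc x (v - w) by rewrite scD scN.
have u_sc x y : u (f x y) = sc x (u y) by rewrite /u /f /= Asc Bsc !scB -scD.
have [E E1 [E2 E3]] : exists2 E : int, E%:~R = 1 :> Zq &
    \sum_(y in [set y | u y == 0]) chi (G y) = E%:~R /\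
    \sum_(y in [set y | u y == 0]) chi (- G y) = E%:~R.
  apply: (@gauss_sum_mod k X Nm Lam K K0 cardX Nm_onto Y f G (0, 0)) => //.
  - by case=> v w; rewrite /f /= !sc1.
  - by move=> x x' [v w]; rewrite /f /= !scM.
  - by move=> x; rewrite /f /= !sc0.
  - move=> x [v w]; rewrite xpair_eqE negb_and.
    by case/orP=> /sc_free nz [h h']; apply: nz.
  - move=> x y; rewrite /G !weyl_disp_sc // Asc Bsc !scB g_sc.
    by rewrite !scalerDr.
  - rewrite /G /weyl_disp /= (aut0 Aaut) (aut0 Baut) !oppr0 !addr0.
    by rewrite g00 !subrr !add0r.
  - by move=> x y; rewrite !inE u_sc => /eqP->; rewrite sc0.
  - by rewrite inE /u /= (aut0 Aaut) (aut0 Baut) !subrr addr0.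
have u0E y : u y == 0 -> W (u y) = 1%:M by move/eqP->; apply: W0.
exists E => //; have [[uS _] [uT _]] := (SA, TB).
have sumE (F F' : V -> 'M[K]_N) :
    \tr ((\sum_w F w) *m (\sum_v F' v)) = \sum_(y : Y) \tr (F y.2 *m F' y.1).
  rewrite mulmx_suml raddf_sum /= -(pair_bigA _ (fun v w => \tr (F w *m F' v))).
  rewrite exchange_big /=.
  by apply: eq_bigr => w _; rewrite mulmx_sumr raddf_sum.
split; apply: (mulfI weyl_deg_neq0); [rewrite -E2 | rewrite -E3];
  rewrite [RHS]mulr_sumr.
  transitivity (\tr ((\sum_w W w *m Wi (B w)) *m (\sum_v W v *m Wi (A v)))).
    rewrite !(weyl_sumV SA, weyl_sumV TB) -scalemxAl -scalemxAr scalerA.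
    by rewrite -invmx_mul // mxtraceZ; ring.
  rewrite sumE [RHS]big_mkcond; apply: eq_bigr => y _; rewrite uE mxtraceZ inE.
  have [/u0E->|/trW->] := boolP (u y == 0); last by rewrite mulr0.
  by rewrite mxtrace1 mulrC.
transitivity (\tr ((\sum_v W (A v) *m Wi v) *m (\sum_w W (B w) *m Wi w))).
  rewrite !(weyl_sum SA, weyl_sum TB) -scalemxAl -scalemxAr scalerA.
  by rewrite mxtraceZ; ring.
rewrite mxtrace_mulC sumE [RHS]big_mkcond; apply: eq_bigr => y _.
rewrite mxtrace_mulC.
have uD v (C : V -> V) : W v *m Wi (C v) \in unitmx.
  by rewrite unitmx_mul unitmx_inv !weyl_unit.
have invD v (C : V -> V) : W (C v) *m Wi v = invmx (W v *m Wi (C v)).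
  by rewrite invmx_mul ?unitmx_inv ?weyl_unit // invmxK.
rewrite !invD -invmx_mul ?uD // uE invmxZ; last first.
  by rewrite unitmxZ ?weyl_unit // unitfE.
rewrite mxtraceZ -chiN inE.
have [/u0E->|nz] := boolP (u y == 0); first by rewrite invmx1 mxtrace1 mulrC.
by rewrite weyl_inv mxtraceZ trW ?oppr_eq0 // !mulr0.
Qed.

(** By [weyl_product_trace] the product and its inverse have the same trace, a
    rational number; its square is a number of fixed points, so it is an
    integer, and the Gauss sum gives its class modulo q + 1. In particular the
    projective representation A |-> T is a representation once normalized. *)
Lemma weyl_normal_mul S T A B : weyl_aut A -> weyl_aut B ->
  weyl_normal S A -> weyl_normal T B -> weyl_normal (S *m T) (A \o B).
Proof.
move=> Aaut Baut [SA [a aE [trS trSV]]] [TB [b bE [trT trTV]]].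
have ST := weyl_lift_mul SA TB; split=> //.
have [E E1 [E2 E3]] := weyl_product_trace Aaut Baut SA TB.
rewrite trS trT in E2; rewrite trSV trTV in E3.
have ABaut : weyl_aut (A \o B).
  case: Aaut Baut => [AD Ag Asc] [BD Bg Bsc].
  by split=> [v w|v w|x v] /=; rewrite ?BD ?AD ?Ag ?Bg ?Bsc ?Asc.
have lift_neq0 (t : int) (R : 'M[K]_N) C :
    weyl_aut C -> weyl_lift R C -> \tr R = t%:~R -> t != 0.
  move=> Caut RC Rt; apply: contra_neq (weyl_lift_trace_neq0 Caut RC) => t0.
  by rewrite Rt t0.
have a0 := lift_neq0 _ _ _ Aaut SA trS; have b0 := lift_neq0 _ _ _ Baut TB trT.
pose c := (N%:Z * a * b : int).
have c0 : c != 0 by rewrite !mulf_neq0 // eqz_nat -lt0n weyl_deg_gt0.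
have intK := pchar0_intr_inj K0.
have cK : c%:~R = N%:R * a%:~R * b%:~R :> K by rewrite !rmorphM.
have cK0 : c%:~R != 0 :> K by rewrite -(inj_eq intK) in c0.
have trE : \tr (invmx (S *m T)) = \tr (S *m T).
  by apply: (mulfI cK0); rewrite cK E2 E3.
have cE : E ^+ 2 = c ^+ 2 * #|weyl_fix (A \o B)|%:Z.
  have FE : #|weyl_fix (A \o B)|%:Z%:~R = \tr (S *m T) * \tr (S *m T) :> K.
    by rewrite -{2}trE (weyl_lift_trace ST).
  apply: intK; rewrite !expr2 [LHS]rmorphM /= [RHS]rmorphM /= FE.
  by rewrite [(c * c)%:~R]rmorphM /= -E3 -cK; ring.
(* c^2 divides E^2 *)
have /dvdzP[t tE] : (c %| E)%Z.
  rewrite dvdzE -(@dvdn_pexp2r _ _ 2) //; apply/dvdnP.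
  exists #|weyl_fix (A \o B)|; have := congr1 absz cE.
  by rewrite abszM !abszX /= mulnC.
have trt : \tr (S *m T) = t%:~R.
  by apply: (mulfI cK0); rewrite {1}cK E3 tE mulrC rmorphM.
exists t; last by rewrite trE trt.
have : (c * t)%:~R = 1 :> Zq by rewrite mulrC -tE.
rewrite !rmorphM /= aE bE -pmulrn N_mod -!mulrA.
rewrite [X in _ * X]mulrA -expr2 -exprM mulnC exprM sqrrN !expr1n mul1r.
by move/(congr1 ( *%R ((-1) ^+ n))); rewrite mulrA -expr2 -exprM mulnC exprM
  sqrrN !expr1n mul1r mulr1.
Qed.

Lemma weyl_lift_scal T T' A : weyl_lift T A -> weyl_lift T' A ->
  exists c, T' = c *: T.
Proof.
move=> [uT TA] [_ T'A].
have /is_scalar_mxP[c cE] : is_scalar_mx (invmx T *m T').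
  apply: W_cent => v; apply: (can_inj (mulKmx uT)).
  by rewrite -mulmxA mulKVmx // T'A !mulmxA TA mulmxK.
by exists c; rewrite -(mulKVmx uT T') cE mul_mx_scalar.
Qed.

Lemma weyl_normal_inj T T' A : weyl_aut A ->
  weyl_normal T A -> weyl_normal T' A -> T = T'.
Proof.
move=> Aaut [TA [t tE [trT trTV]]] [T'A [t' t'E [trT' trT'V]]].
have [c cE] := weyl_lift_scal TA T'A.
have trT0 := weyl_lift_trace_neq0 Aaut TA.
have tt' : t = t'.
  apply: (signed_root_inj (finNzRing_gt1 k) tE t'E).
  apply: (pchar0_intr_inj K0); rewrite !expr2 !rmorphM /= -{1}trT -trTV.
  by rewrite -{1}trT' -trT'V !(weyl_lift_trace TA, weyl_lift_trace T'A).
suff c1 : c = 1 by rewrite cE c1 scale1r.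
by apply: (mulIf trT0); rewrite mul1r -mxtraceZ -cE trT trT' tt'.
Qed.

(** Q below intertwines W and W o A by construction. It is invertible because
    its product with the opposite intertwiner P is a scalar of nonzero trace. *)
Lemma weyl_normal_exists A (b : int) : weyl_aut A ->
    b%:~R = (-1) ^+ n :> Zq -> #|weyl_fix A|%:Z = b ^+ 2 ->
  exists T, weyl_normal T A.
Proof.
move=> Aaut bE fixE; have [AD Ag _] := Aaut.
have uW := weyl_unit.
have conjD u w (C B : V -> V) :
    {morph C : x y / x + y} -> {morph B : x y / x + y} ->
    (forall x y, g (C x) (C y) = g x y) -> (forall x y, g (B x) (B y) = g x y) ->
    W (C u) *m (W (C w) *m Wi (B w)) *m Wi (B u) =
    W (C (u + w)) *m Wi (B (u + w)).
  move=> CD BD Cg Bg; rewrite !mulmxA WM -CD Cg -!scalemxAl -mulmxA -invmx_mul //.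
  rewrite WM -BD Bg invmxZ ?unitmxZ ?unitfE // -scalemxAr scalerA mulfV //.
  by rewrite scale1r.
(* by [weyl_sum], Q is a multiple of every lift of A *)
pose P := \sum_v W v *m Wi (A v); pose Q := \sum_v W (A v) *m Wi v.
have conjs (C B : V -> V) :
    {morph C : x y / x + y} -> {morph B : x y / x + y} ->
    (forall x y, g (C x) (C y) = g x y) -> (forall x y, g (B x) (B y) = g x y) ->
    forall u, (\sum_v W (C v) *m Wi (B v)) *m W (B u) =
      W (C u) *m (\sum_v W (C v) *m Wi (B v)).
  move=> CD BD Cg Bg u; rewrite -[RHS](mulmxKV (uW (B u))); congr (_ *m _).
  rewrite mulmx_sumr mulmx_suml [LHS](reindex_inj (addrI u)) /=.
  by apply: eq_bigr => v _; rewrite conjD.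
have QW u : Q *m W u = W (A u) *m Q by apply: (conjs A id).
have PW u : P *m W (A u) = W u *m P by apply: (conjs id A).
have uQ : Q \in unitmx.
  have /is_scalar_mxP[c cE] : is_scalar_mx (P *m Q).
    by apply: W_cent => v; rewrite -mulmxA QW mulmxA PW mulmxA.
  suff c0 : c != 0.
    have : (c^-1 *: P) *m Q = 1%:M.
      by rewrite -scalemxAl cE scale_scalar_mx mulVf.
    by case/mulmx1_unit.
  apply: contraTneq isT => c0; have := congr1 mxtrace cE.
  rewrite c0 mxtrace_scalar mul0rn => /eqP.
  suff -> : \tr (P *m Q) = (#|V| * (N * #|weyl_fix A|))%:R.
    rewrite ((pcharf0P K).1 K0) gtn_eqF // cardV !muln_gt0.
    by rewrite weyl_deg_gt0 weyl_fix_gt0.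
  rewrite mulmx_suml raddf_sum /= natrM [#|V|%:R * _]mulrC mulr_natr -sumr_const.
  apply: eq_bigr => v _; rewrite mulmx_sumr raddf_sum /= (reindex_inj (addrI v)).
  rewrite natrM -sum1_card natr_sum mulr_sumr [RHS]big_mkcond /=.
  apply: eq_bigr => u _; rewrite inE mulr1 -weyl_traceV.
  have -> : W (A (v + u)) = (chi (g v u))^-1 *: (W (A v) *m W (A u)).
    by rewrite WM -AD Ag scalerA mulVf // scale1r.
  have -> : Wi (v + u) = chi (g v u) *: (Wi u *m Wi v).
    rewrite -invmx_mul // WM invmxZ ?unitmxZ ?unitfE // scalerA mulfV //.
    by rewrite scale1r.
  rewrite -scalemxAl -!scalemxAr scalerA mulVf // scale1r mxtrace_mulC.
  by rewrite !mulmxA mulmxKV // -mulmxA -mulmxA mxtrace_mulC mulmxA mulmxKV.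
have intK := pchar0_intr_inj K0.
have fixK : #|weyl_fix A|%:R = b%:~R * b%:~R :> K.
  by rewrite -rmorphM -expr2 -fixE.
have b0 : b%:~R != 0 :> K.
  have : #|weyl_fix A|%:R != 0 :> K.
    by rewrite ((pcharf0P K).1 K0) -lt0n weyl_fix_gt0.
  by rewrite fixK mulf_eq0 negb_or => /andP[].
pose a := (N%:R * b%:~R)^-1 : K; have N0 := weyl_deg_neq0.
have a0 : a != 0 by rewrite invr_neq0 ?mulf_neq0.
have QA : weyl_lift (a *: Q) A.
  split=> [|v]; first by rewrite unitmxZ ?unitfE.
  by rewrite -scalemxAl QW scalemxAr.
have trQ : \tr (a *: Q) = b%:~R.
  rewrite mxtraceZ raddf_sum /= (_ : \sum_v _ = N%:R * #|weyl_fix A|%:R).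
    by rewrite fixK [X in a * X]mulrA mulKf // mulf_neq0.
  rewrite -sum1_card natr_sum mulr_sumr [RHS]big_mkcond /=.
  by apply: eq_bigr => v _; rewrite weyl_traceV inE mulr1.
exists (a *: Q); split=> //; exists b => //; split=> //.
by apply: (mulfI b0); rewrite -{1}trQ (weyl_lift_trace QA) fixK.
Qed.
End WeylSystems.

(** * The fields of level j and their traces *)

(** The image of F already supplies #|F| roots of 'X^#|F| - 'X. *)
Lemma fixed_by_frobenius (F : finFieldType) (E : fieldType)
    (f : {rmorphism F -> E}) x : x ^+ #|F| = x -> exists c, x = f c.
Proof.
move=> xq; suff /mapP[c _ ->] : x \in map f (enum F) by exists c.
apply: contraT => x_notin.
pose P : {poly E} := 'X^(#|F|) - 'X.
have q_gt1 := finNzRing_gt1 F.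
have szP : size P = #|F|.+1.
  by rewrite size_polyDl ?size_polyXn // size_polyN size_polyX.
have P0 : P != 0 by rewrite -size_poly_gt0 szP.
have Pr y : y ^+ #|F| = y -> root P y.
  by move=> yq; rewrite rootE !hornerE yq subrr.
have : all (root P) (x :: map f (enum F)).
  rewrite /= Pr //; apply/allP=> _ /mapP[c _ ->].
  by apply: Pr; rewrite -rmorphXn expf_card.
move/(max_poly_roots P0); rewrite szP /= x_notin size_map -cardE ltnn; apply.
by rewrite map_inj_uniq ?enum_uniq //; apply: fmorph_inj.
Qed.

(** Multiplication by u permutes the residues modulo m. *)
Lemma sum_periodic (M : nmodType) (f : nat -> M) m u :
  coprime u m -> (forall s, f (s + m)%N = f s) ->
  \sum_(s < m) f (u * s)%N = \sum_(s < m) f s.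
Proof.
move=> u_m fm; case: m u_m fm => [|m] u_m fm; first by rewrite !big_ord0.
have fmod s : f (s %% m.+1)%N = f s.
  rewrite {2}(divn_eq s m.+1) addnC; elim: (_ %/ _)%N => [|r IHr].
    by rewrite addn0.
  by rewrite IHr -fm -addnA -mulSnr.
pose h (s : 'I_m.+1) : 'I_m.+1 := inord ((u * s) %% m.+1).
have hE s : h s = ((u * s) %% m.+1)%N :> nat by rewrite inordK // ltn_mod.
have h_inj : injective h.
  have main (s t : 'I_m.+1) : (s <= t)%N -> h s = h t -> s = t.
    move=> st /(congr1 (@nat_of_ord _)); rewrite !hE => /eqP.
    rewrite eq_sym eqn_mod_dvd ?leq_mul // -mulnBr Gauss_dvdr; last first.
      by rewrite coprime_sym.
    move=> /dvdn_leq le_m; apply/val_inj/anti_leq => /=.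
    rewrite st leqNgt -subn_gt0; apply/negP=> /le_m.
    by rewrite leqNgt (leq_ltn_trans (leq_subr s t)).
  move=> s t st; case: (leqP s t) => [/main|/ltnW/main ts]; first exact.
  by rewrite ts.
rewrite [RHS](reindex_inj h_inj) /=.
by apply: eq_bigr => s _; rewrite hE fmod.
Qed.

Lemma sum_shift (M : nmodType) (f : nat -> M) m : f m = f 0%N ->
  \sum_(s < m) f s.+1 = \sum_(s < m) f s.
Proof.
case: m => [|m] fm; first by rewrite !big_ord0.
by rewrite big_ord_recr big_ord_recl /= fm addrC.
Qed.

Section FrobeniusPowers.
Variables (k : finFieldType) (R : comAlgType k).

Lemma exprq_additive e : {morph (fun x : R => x ^+ (#|k| ^ e)) : x y / x + y}.
Proof.
by move=> x y; rewrite exprDn_pchar // pnatX pchar_nat_card.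
Qed.

Lemma exprq0 e : (0 : R) ^+ (#|k| ^ e) = 0.
Proof. by rewrite expr0n expn_eq0 gtn_eqF ?(ltnW (finNzRing_gt1 k)). Qed.

Lemma exprq_sum e I r (P : pred I) (F : I -> R) :
  (\sum_(i <- r | P i) F i) ^+ (#|k| ^ e) =
    \sum_(i <- r | P i) F i ^+ (#|k| ^ e).
Proof.
by apply: (big_morph (fun x : R => x ^+ (#|k| ^ e)));
  [apply: exprq_additive | apply: exprq0].
Qed.
End FrobeniusPowers.

Section LevelFields.
Variables (k : finFieldType) (j : nat).
Hypothesis j_gt0 : (0 < j)%N.
Local Notation q := #|k|.
Local Notation R := (Fq k j).

Lemma Fq_orderE : Fq_order k j = (q ^ j)%N.
Proof. by rewrite /Fq_order prednK. Qed.

Lemma Fq_expr (x : R) : x ^+ (q ^ j) = x.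
Proof. by rewrite -[in RHS](expr_Fq x) prednK. Qed.

Lemma card_Fq : #|{: R}| = (q ^ j)%N.
Proof.
have q_gt1 := finNzRing_gt1 k.
have qj_gt1 : (1 < q ^ j)%N by rewrite -(exp1n j) ltn_exp2r.
pose P : {poly Fbar k} := 'X^(q ^ j) - 'X.
have szP : size P = (q ^ j).+1.
  by rewrite size_polyDl ?size_polyXn // size_polyN size_polyX.
have lcP : lead_coef P = 1.
  by rewrite lead_coefDl ?lead_coefXn // size_polyXn size_polyN size_polyX.
have [r rE] := closed_field_poly_normal P; rewrite lcP scale1r in rE.
have szr : size r = (q ^ j)%N.
  by apply: succn_inj; rewrite -szP rE size_prod_XsubC.
have Ur : uniq r.
  rewrite -separable_prod_XsubC -rE unlock /P derivB derivX derivXn.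
  have q0 : q%:R = 0 :> Fbar k.
    have [p p_pr pq] := pdivP q_gt1.
    have := pchar_nat_card (Fbar k) (k := k).
    move/pnatP => /(_ (ltnW q_gt1) p p_pr pq) pF.
    by apply/eqP; rewrite -(dvdn_pcharf pF).
  rewrite -[_ *+ (q ^ j)]mulr_natr -(prednK j_gt0) expnS natrM.
  rewrite -[q%:R]polyC_natr q0 mul0r mulr0 sub0r.
  by rewrite -(scaleN1r 1) coprimepZr ?oppr_eq0 ?oner_eq0 // coprimep1.
rewrite -szr cardE -(size_map (@Fq_val k j)); apply/perm_size/uniq_perm => //.
  by rewrite map_inj_uniq ?enum_uniq //; apply: val_inj.
move=> x; have -> : (x \in r) = (x ^+ (q ^ j) == x).
  by rewrite -root_prod_XsubC -rE rootE !hornerE subr_eq0.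
apply/mapP/eqP => [[y _ ->]|xq]; first by rewrite -rmorphXn Fq_expr.
have xR : x \in @Fq_pred k j by rewrite inE Fq_orderE xq.
by exists (MkFq xR); rewrite ?mem_enum.
Qed.

(** The trace from F_(q^j) to k, taken back from its image in F_(q^j). *)
Definition trR (r : R) : k :=
  odflt 0 [pick c | c%:A == \sum_(s < j) r ^+ (q ^ s)].

Lemma trRE r : (trR r)%:A = \sum_(s < j) r ^+ (q ^ s).
Proof.
rewrite /trR; case: pickP => [c /eqP //|noc].
have [] : exists c, \sum_(s < j) r ^+ (q ^ s) = in_alg R c.
  apply: fixed_by_frobenius.
  rewrite -[RHS](@sum_shift _ (fun s => r ^+ (q ^ s))); last first.
    by rewrite Fq_expr expn0 expr1.
  rewrite -[X in _ ^+ X]expn1 exprq_sum; apply: eq_bigr => s _.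
  by rewrite -exprM -expnD addn1.
by move=> c cE; have := noc c; rewrite cE eqxx.
Qed.

Lemma in_alg_Fq_inj : injective (fun c : k => c%:A : R).
Proof. exact: (fmorph_inj (in_alg R)). Qed.

(** The trace is a polynomial of degree less than q^j. *)
Lemma trR_neq0 y : y != 0 -> exists r, trR (r * y) != 0.
Proof.
move=> y0; apply/existsP; apply: contraT => /existsPn tr0.
have q_gt1 := finNzRing_gt1 k.
pose P : {poly R} := \sum_(s < j) 'X^(q ^ s).
have P0 : P != 0.
  apply/eqP => /(congr1 (coefp 1)) /eqP; rewrite /P raddf_sum /= coef0.
  rewrite (bigD1 (Ordinal j_gt0)) //= expn0 coefXn eqxx big1 ?addr0 ?oner_eq0 //.
  case=> [[|s] ?] // _; rewrite coefXn /= eq_sym gtn_eqF //.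
  by rewrite -(exp1n s.+1) ltn_exp2r.
have szP : (size P <= q ^ j)%N.
  apply: (leq_trans (size_sum _ _ _)); apply/bigmax_leqP => s _.
  by rewrite size_polyXn ltn_exp2l.
have : all (root P) (enum {: R}).
  apply/allP => r _; have := tr0 (r / y); rewrite divfK // negbK => /eqP tr_r.
  have := trRE r; rewrite tr_r scale0r => trE.
  rewrite rootE horner_sum; apply/eqP; rewrite [RHS]trE.
  by apply: eq_bigr => s _; rewrite hornerXn.
move/(max_poly_roots P0) => /(_ (enum_uniq _)).
by rewrite -cardE card_Fq ltnNge szP.
Qed.
End LevelFields.

(** * The quadratic extension and the trace to it *)

Section QuadraticExtension.
Variables (k : finFieldType) (L : quadExt k).
Local Notation q := #|k|.
Local Notation frobL := (frob (R:=L)).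

Lemma frob_fixed_scalar (x : L) : frobL x = x -> exists c : k, x = c%:A.
Proof. exact: (@fixed_by_frobenius k L (in_alg L)). Qed.

Lemma frob_nonfixed : exists x : L, frobL x != x.
Proof.
have [//|/existsPn h] := boolP [exists x : finvect_type L, frobL x != x].
  by case/existsP=> x; exists x.
have : (fullv <= <[1 : L]>)%VS.
  apply/subvP => x _; have := h x.
  rewrite negbK => /eqP/frob_fixed_scalar[c ->].
  by apply/vlineP; exists c.
by move/dimvS; rewrite quad_dim dim_vline; case: eqP.
Qed.

(** Any x with x + x^q nonzero can be rescaled. If a non-fixed x has
    x^q = - x, then 2 is nonzero and x = 1 will do. *)
Lemma frob_trace_one : exists x : L, x + frobL x = 1.
Proof.
suff [x x0] : exists x : L, x + frobL x != 0.
  exists (x / (x + frobL x)); rewrite rmorphM fmorphV rmorphD /= frobK.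
  by rewrite [frobL x + x]addrC -mulrDl mulfV.
have [x xN] := frob_nonfixed.
have [x_tr|] := eqVneq (x + frobL x) 0; last by exists x.
exists 1; rewrite rmorph1; apply: contra xN => /eqP two0.
rewrite -subr_eq0 -(addKr x (frobL x)) x_tr addr0 -opprD.
by rewrite -[x]mul1r -mulrDl two0 mul0r oppr0.
Qed.

Lemma card_quadExt : #|finvect_type L| = (q ^ 2)%N.
Proof.
have -> : #|finvect_type L| = #|(fullv : {vspace finvect_type L})|.
  by apply: eq_card => x; rewrite memvf.
by rewrite card_vspace; congr (_ ^ _)%N; apply: quad_dim.
Qed.

(** The (q + 1)-st roots of c have order dividing q^2 - 1, so they lie in L. *)
Lemma norm_onto (kappa : {lrmorphism L -> Fbar k}) (c : k) : c != 0 ->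
  exists2 x : L, x != 0 & x * frobL x = c%:A.
Proof.
move=> c0.
have /closed_rootP[y] : size ('X^(q.+1) - (Fbar_inj k c)%:P) != 1%N.
  by rewrite size_XnsubC.
rewrite rootE !hornerE subr_eq0 => /eqP yE.
have [x xE] : exists x : L, y = kappa x.
  apply: (@fixed_by_frobenius (finvect_type L) (Fbar k) kappa).
  have q_gt0 : (0 < q)%N by apply/ltnW/finNzRing_gt1.
  rewrite card_quadExt -(@prednK (q ^ 2)) ?expn_gt0 ?q_gt0 // predn_sqr.
  rewrite exprSr exprM yE -rmorphXn (_ : c ^+ q.-1 = 1) ?rmorph1 ?mul1r //.
  by apply: (mulfI c0); rewrite mulr1 -exprS prednK // expf_card.
have xN : x * frobL x = c%:A.
  apply: (fmorph_inj kappa).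
  rewrite -exprS rmorphXn /= -xE yE linearZ rmorph1.
  by rewrite [RHS]mulr1.
exists x => //; apply: contraNneq c0 => x0.
move/eqP: xN; rewrite x0 mul0r eq_sym => /eqP h.
by apply/eqP/(fmorph_inj (in_alg L)); rewrite rmorph0.
Qed.
End QuadraticExtension.

Section Tensor.
Variables (k : finFieldType) (L : quadExt k) (j : nat).
Hypothesis j_gt0 : (0 < j)%N.
Local Notation q := #|k|.
Local Notation R := (Fq k j).
Local Notation LR := (tens L R).
Local Notation frobL := (frob (R:=L)).
Local Notation F := (tens_map (frob (R:=R)) : LR -> LR).

(** The trace from L (x) F_(q^j) to L. All central characters factor through
    it, which removes the fields F_(q^(2j)) from the discussion. *)
Definition trL (z : LR) : L := \sum_i trR (z 0 i) *: tens_basis i.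

Lemma tens_of_inj : injective (@tens_of k L R).
Proof.
move=> x y xy; rewrite (tens_coordE x) (tens_coordE y); apply: eq_bigr => i _.
congr (_ *: _); apply: (in_alg_Fq_inj (j := j)).
by have := congr1 (fun z : LR => z 0 i) xy; rewrite !mxE.
Qed.

Lemma iter_tens_map s (z : LR) i : (iter s F z) 0 i = z 0 i ^+ (q ^ s).
Proof.
elim: s => [|s IHs]; first by rewrite expn0 expr1.
by rewrite iterS mxE IHs /= /frob -exprM expnSr.
Qed.

Lemma trLE (z : LR) : tens_of R (trL z) = \sum_(s < j) iter s F z.
Proof.
rewrite /trL tens_of_sum; apply/rowP => i.
rewrite !summxE.
transitivity ((trR (z 0 i))%:A : R).
  rewrite (bigD1 i) //= big1 => [|l li].
    by rewrite addr0 tens_ofZ tens_of_basis !mxE !eqxx mulr1.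
  by rewrite tens_ofZ tens_of_basis !mxE eqxx eq_sym (negPf li) mulr0.
by rewrite trRE //; apply: eq_bigr => s _; rewrite iter_tens_map.
Qed.

Lemma iter_F_add s : {morph iter s F : x y / x + y}.
Proof. by move=> x y; elim: s => //= s ->; rewrite rmorphD. Qed.

Lemma iter_F_period z : iter j F z = z.
Proof. by apply/rowP => i; rewrite iter_tens_map Fq_expr. Qed.

Lemma trLD x y : trL (x + y) = trL x + trL y.
Proof.
apply: tens_of_inj; rewrite tens_ofD !trLE -big_split; apply: eq_bigr => s _.
exact: iter_F_add.
Qed.

Lemma trL0 : trL 0 = 0.
Proof. by apply: (addrI (trL 0)); rewrite -trLD !addr0. Qed.

Lemma trLN x : trL (- x) = - trL x.
Proof. by apply: (addrI (trL x)); rewrite -trLD !subrr trL0. Qed.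

Lemma trLM a x : trL (tens_of R a * x) = a * trL x.
Proof.
apply: tens_of_inj; rewrite tens_of_mul !trLE mulr_sumr; apply: eq_bigr => s _.
by elim: (s : nat) => //= r ->; rewrite rmorphM /= tens_map_of.
Qed.

Lemma trL_frob x : trL (F x) = trL x.
Proof.
apply: tens_of_inj; rewrite !trLE.
rewrite -(@sum_shift _ (fun s => iter s F x)) ?iter_F_period //.
by apply: eq_bigr => s _; rewrite -iterSr.
Qed.

Lemma trL_conj x : trL (conjR x) = frobL (trL x).
Proof.
apply: tens_of_inj; rewrite -conjR_of !trLE raddf_sum; apply: eq_bigr => s _.
by elim: (s : nat) => //= r ->; rewrite tens_map_conj.
Qed.

(** Scaling y by F_(q^j) makes its trace nonzero, and scaling by L then moves
    this trace off k. *)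
Lemma trL_nondegenerate (y : LR) : y != 0 ->
  exists a, frobL (trL (a * y)) != trL (a * y).
Proof.
move=> y0; have [i yi] : exists i, y 0 i != 0.
  apply/existsP; apply: contraT => /existsPn y00; case/eqP: y0.
  by apply/rowP => i; rewrite mxE; apply/eqP; rewrite -[_ == _]negbK y00.
have [r r0] := trR_neq0 j_gt0 yi.
have l0 : trL (r *: y) != 0.
  apply: contra r0 => /eqP/(congr1 (coord (vbasis {:L}) i)).
  rewrite linear0 linear_sum (bigD1 i) //= big1 => [|l li].
    rewrite linearZ /= coord_free ?(basis_free (vbasisP _)) // eqxx.
    by rewrite addr0 mxE mulr1 => ->.
  by rewrite linearZ /= coord_free ?(basis_free (vbasisP _)) // (negPf li) mulr0.
have [x xN] := frob_nonfixed L.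
exists (r *: tens_of R (x / trL (r *: y))).
by rewrite -tens_scalerAl tens_scalerAr trLM divfK.
Qed.

Variable kappa : {lrmorphism L -> Fbar k}.

Lemma kappa_expr s x : kappa x ^+ (q ^ (2 * s)) = kappa x.
Proof.
elim: s => [|s IHs]; first by rewrite expn0 expr1.
rewrite mulnS expnD exprM -rmorphXn.
by rewrite (_ : x ^+ (q ^ 2) = x) // -mulnn exprM; apply: frobK.
Qed.

Lemma kappaZ c x : kappa (c *: x) = Fbar_inj k c * kappa x.
Proof. exact: linearZ. Qed.

(** For odd j the powers x^(q^(2s)), s < j, of an element of F_(q^j) are a
    permutation of its Frobenius conjugates. *)
Lemma psi_level_trL (K : closedFieldType) (psi : Fbar k -> K) z :
  odd j -> psi_level psi j (tens_eval kappa z) = psi (kappa (trL z)).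
Proof.
move=> j_odd; congr psi; rewrite /tens_eval /trL raddf_sum.
under eq_bigr => s _ do rewrite exprq_sum.
rewrite exchange_big; apply: eq_bigr => i _ /=.
under eq_bigr => s _ do rewrite exprMn kappa_expr -rmorphXn.
rewrite -mulr_sumr -rmorph_sum kappaZ mulrC; congr (_ * _).
rewrite (@sum_periodic _ (fun s => z 0 i ^+ (q ^ s))).
- by rewrite -trRE // -[RHS]mulr1.
- by rewrite coprime2n.
- by move=> s; rewrite addnC expnD exprM Fq_expr.
Qed.
End Tensor.

(** * An equivariant section of the Heisenberg group *)

Lemma hsec_ring (A : comPzRingType) (t b c d e : A) :
  t * b + t * e + c = (1 - t) * c - t * d + t * (b + c + (d + e)).
Proof. ring. Qed.

Section HeisenbergSections.
Variables (k : finFieldType) (L : quadExt k) (V : hermSpace L).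
Variables (th : L) (thP : th + frob (R:=L) th = 1).

Section OverAlgebra.
Variable R : comAlgType k.
Local Notation LR := (tens L R).
Local Notation VR := 'cV[LR]_(\dim {:V}).
Local Notation hR := (hermR (V := V) (R := R)).
Local Notation thR := (tens_of R th : LR).

Lemma conj_thR : conjR thR = 1 - thR :> LR.
Proof.
rewrite conjR_of -(addKr th (frob th)) thP addrC tens_ofD; congr (_ + _).
by apply: (addrI thR); rewrite -tens_ofD !subrr tens_of0.
Qed.

Lemma hermR_scalel (a : LR) v w : hR (a *: v) w = conjR a * hR v w.
Proof.
rewrite /hermR (_ : adjmx (a *: v) = conjR a *: adjmx v).
  by rewrite -!scalemxAl mxE.
by apply/matrixP => i l; rewrite !mxE rmorphM.
Qed.

Lemma hermR_scaler (a : LR) v w : hR v (a *: w) = a * hR v w.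
Proof. by rewrite /hermR -scalemxAr mxE. Qed.

Lemma hsec_subproof (v : VR) : heis_pred (V := V) (v, thR * hR v v).
Proof.
by rewrite /heis_pred /= rmorphM /= hermRC conj_thR -mulrDl subrK mul1r.
Qed.

(** The scalar coordinate is the equivariant choice of a solution of
    conj a + a = h(v, v): the section commutes with unitary maps, with
    Frobenius and with base change. *)
Definition hsec (v : VR) : Heis V R := mk_heis (hsec_subproof v).

Lemma hcen_subproof (y : LR) : heis_pred (V := V) (0, y - conjR y).
Proof. by rewrite /heis_pred /= rmorphB /= conjRK hermR0r subrKA subrr. Qed.
Definition hcen (y : LR) : Heis V R := mk_heis (hcen_subproof y).

Lemma hsecM v w :
  (hsec v * hsec w = hcen (conjR thR * hR v w)%R * hsec (v + w)%R)%g.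
Proof.
apply: heis_inj; first by rewrite [RHS]add0r.
rewrite [LHS]heis_scaM [RHS]heis_scaM /heis_sca /heis_vec /= hermR0l addr0.
rewrite rmorphM /= conjRK hermRC hermRDl !hermRDr conj_thR.
exact: hsec_ring.
Qed.

Lemma hsec0 : hsec 0 = 1%g.
Proof. by apply: heis_inj => //; rewrite /heis_sca /= hermR0l mulr0. Qed.

Lemma hsec_act g v : unitary_act g (hsec v) = hsec (umx g *m v).
Proof. by apply: heis_inj => //; rewrite /heis_sca /= hermR_umx. Qed.

Lemma heis_central (x y : Heis V R) : heis_vec x = 0 -> (x * y = y * x)%g.
Proof.
move=> x0; apply: heis_inj; first exact: addrC.
by rewrite [LHS]heis_scaM [RHS]heis_scaM x0 hermR0l hermR0r [_ + heis_sca y]addrC.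
Qed.

Lemma heis_vec_mul (x y : Heis V R) :
  heis_vec (x * y)%g = heis_vec x + heis_vec y.
Proof. by []. Qed.

Lemma heis_vec_inv (x : Heis V R) : heis_vec x^-1%g = - heis_vec x.
Proof. by []. Qed.

Lemma heis_sca_mulc (x y : Heis V R) : heis_vec x = 0 ->
  heis_sca (x * y)%g = heis_sca x + heis_sca y.
Proof. by move=> x0; rewrite [LHS]heis_scaM x0 hermR0l addr0. Qed.

End OverAlgebra.

Lemma hsec_map (R S : comAlgType k) (phi : {lrmorphism R -> S}) v :
  heis_map phi (hsec (R := R) v) = hsec (map_mx (tens_map phi) v).
Proof.
apply: heis_inj => //; rewrite /heis_sca /= rmorphM /= tens_map_of.
by rewrite map_hermR.
Qed.

End HeisenbergSections.

(** The Gram matrix is invertible over L, hence over L (x) R. *)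
Lemma gram_nondegenerate (k : finFieldType) (L : quadExt k) (V : hermSpace L)
    (R : comAlgType k) (v : 'cV[tens L R]_(\dim {:V})) :
  herm_nondegenerate V -> v != 0 -> exists w, hermR w v != 0.
Proof.
move=> hV v0; pose e := vbasis {:V}.
pose GL : 'M[L]_(\dim {:V}) := \matrix_(i, l) herm V e`_i e`_l.
have uG : GL \in unitmx.
  rewrite -row_free_unit -kermx_eq0; apply: contraT => /rowV0Pn[c cG c0].
  case/eqP: c0; move/sub_kermxP: cG => cG.
  pose w := \sum_i frob (c 0 i) *: e`_i.
  have w0 : w = 0.
    apply: hV => u; rewrite (coord_vbasis (memvf u)) linear_sumr big1 // => i _.
    rewrite linearZr_LR /=; suff -> : herm V w e`_i = 0 by rewrite mulr0.
    transitivity ((c *m GL) 0 i); last by rewrite cG mxE.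
    rewrite /w linear_sumlz mxE; apply: eq_bigr => l _.
    by rewrite linearZl_LR /= [GL l i]mxE frobK.
  apply/rowP => i; rewrite mxE; apply: (can_inj (@frobK k L)); rewrite rmorph0.
  have := congr1 (coord e i) w0; rewrite linear0 linear_sum (bigD1 i) //= big1.
    by rewrite linearZ /= coord_free ?(basis_free (vbasisP _)) // eqxx addr0 mulr1.
  move=> l li; rewrite linearZ /= coord_free ?(basis_free (vbasisP _)) //.
  by rewrite (negPf li) mulr0.
pose T (x : L) := tens_of R x.
pose G' : 'M[tens L R]_(\dim {:V}) := \matrix_(i, l) T (invmx GL i l).
have GG : G' *m gram V R = 1%:M.
  apply/matrixP => i l; rewrite !mxE.
  transitivity (T ((invmx GL *m GL) i l)).
    rewrite mxE /T tens_of_sum; apply: eq_bigr => s _.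
    by rewrite !mxE tens_of_mul.
  by rewrite mulVmx // mxE /T; case: eqP => _ //=; rewrite tens_of0.
have : gram V R *m v != 0.
  by apply: contra v0 => /eqP gv; rewrite -[v]mul1mx -GG -mulmxA gv mulmx0.
move=> gv0; have [i gvi] : exists i, (gram V R *m v) i 0 != 0.
  apply/existsP; apply: contraT => /existsPn gv00; case/eqP: gv0.
  by apply/colP => i; rewrite [RHS]mxE; apply/eqP; rewrite -[_ == _]negbK gv00.
exists (delta_mx i 0); rewrite /hermR -mulmxA.
have -> : adjmx (delta_mx i 0 : 'cV[tens L R]__) = delta_mx 0 i.
  apply/matrixP => a b; rewrite !mxE andbC.
  by case: (_ && _); rewrite ?rmorph0 ?rmorph1.
by rewrite -rowE mxE.
Qed.

(** * The Heisenberg-Weil representation of one level *)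

Lemma weyl_comm_ring (A : comPzRingType) (t y z : A) :
  (1 - t) * y - t * z = y + (1 - t) * z - (z + t * y).
Proof. ring. Qed.

Section EvaluationMorphism.
Variables (k : finFieldType) (L : quadExt k) (kappa : {lrmorphism L -> Fbar k}).
Variable j : nat.
Local Notation R := (Fq k j).
Local Notation LR := (tens L R).
Local Notation ev := (@tens_eval k L kappa j : LR -> Fbar k).

Fact tens_eval_is_zmod_morphism : zmod_morphism ev.
Proof.
move=> x y; rewrite /tens_eval -sumrB; apply: eq_bigr => i _.
by rewrite !mxE rmorphB mulrBr.
Qed.
HB.instance Definition _ :=
  GRing.isZmodMorphism.Build LR (Fbar k) ev tens_eval_is_zmod_morphism.

Lemma tens_evalZ a (z : LR) : ev (a *: z) = Fq_val a * ev z.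
Proof.
rewrite /tens_eval mulr_sumr; apply: eq_bigr => i _.
by rewrite mxE rmorphM /= mulrCA.
Qed.

Lemma Fq_valA (c : k) : Fq_val (c%:A : R) = Fbar_inj k c.
Proof. by rewrite -[RHS]mulr1. Qed.

Lemma tens_eval_of x : ev (tens_of R x) = kappa x.
Proof.
rewrite [in RHS](tens_coordE x) linear_sum; apply: eq_bigr => i _.
by rewrite mxE Fq_valA linearZ /= mulrC.
Qed.

Fact tens_eval_is_monoid_morphism : monoid_morphism ev.
Proof.
split=> [|x y]; first by rewrite [LHS]tens_eval_of rmorph1.
rewrite [x * y]/(tens_mul x y) /tens_mul raddf_sum [ev x]/tens_eval mulr_suml.
apply: eq_bigr => i _; rewrite raddf_sum [ev y]/tens_eval mulr_sumr.
apply: eq_bigr => l _ /=; rewrite tens_evalZ tens_eval_of !rmorphM /=; ring.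
Qed.
HB.instance Definition _ :=
  GRing.isMonoidMorphism.Build LR (Fbar k) ev tens_eval_is_monoid_morphism.

Variable V : hermSpace L.

Lemma fix_dimE (g : Unitary V R) :
  fix_dim kappa g = (\dim {:V} - \rank (map_mx ev (umx g - 1%:M)))%N.
Proof. by rewrite /fix_dim mxrank_ker mxrank_tr. Qed.

Lemma fix_dim1 : fix_dim kappa (1%g : Unitary V R) = \dim {:V}.
Proof. by rewrite fix_dimE subrr map_mx0 mxrank0 subn0. Qed.

Lemma fix_dimV (g : Unitary V R) : fix_dim kappa g^-1%g = fix_dim kappa g.
Proof.
have [gg' g'g _] := umxP g.
suff rkE : \rank (map_mx ev (umx g^-1%g - 1%:M)) =
    \rank (map_mx ev (umx g - 1%:M)).
  by rewrite [LHS]fix_dimE rkE [RHS]fix_dimE.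
have -> : umx g^-1%g - 1%:M = umx_inv g *m - (umx g - 1%:M).
  by rewrite opprB mulmxBr mulmx1 g'g.
have full : row_full (map_mx ev (umx_inv g)).
  rewrite row_full_unit; have : map_mx ev (umx_inv g) *m map_mx ev (umx g) = 1%:M.
    by rewrite -map_mxM g'g map_mx1.
  by case/mulmx1_unit.
by rewrite map_mxM (eqmxMfull _ full) map_mxN mxrank_opp.
Qed.
End EvaluationMorphism.

Section HeisenbergWeilLevel.
Variables (k : finFieldType) (L : quadExt k) (V : hermSpace L).
Variables (kappa : {lrmorphism L -> Fbar k}) (K : closedFieldType).
Variable psi : Fbar k -> K.
Hypothesis K0 : [pchar K] =i pred0.
Hypothesis hV : herm_nondegenerate V.
Hypothesis psi_char : is_char_Fplus psi.
Hypothesis psi_nontriv : nontrivial_Fplus psi.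
Variables (th : L) (thP : th + frob (R:=L) th = 1).
Local Notation q := #|k|.
Local Notation n := (\dim {:V}).
Local Notation frobL := (frob (R:=L)).
Local Notation hsec := (@hsec k L V th thP _).

(** The l - l^q fill F_(q,+), so psi extends to a character of all of L whose
    argument need not be constrained. *)
Definition chiL (l : L) : K := psi (kappa (l - frobL l)).

Lemma skew_Fplus (l : L) : frobL l = - l -> kappa l \in @Fplus k 1.
Proof.
move=> lN; rewrite inE expn1 -rmorphXn -[l ^+ q]/(frobL l) lN rmorphN /=.
by rewrite addNr.
Qed.

Lemma skew_frob (l : L) : frobL (l - frobL l) = - (l - frobL l).
Proof. by rewrite rmorphB /= frobK opprB. Qed.

Lemma chiL_add_char : add_char chiL.
Proof.
have [psiD psi0] := psi_char.
have S l := skew_Fplus (skew_frob l).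
split=> [|a b].
  have S0 := S 0; rewrite /chiL; rewrite rmorph0 subrr rmorph0 in S0 *.
  by apply: (mulfI (psi0 _ S0)); rewrite mulr1 -psiD // addr0.
have -> : chiL (a + b) = psi (kappa (a - frobL a) + kappa (b - frobL b)).
  by rewrite -rmorphD addrACA -opprD -rmorphD.
exact: psiD.
Qed.

Lemma chiL_nontrivial (l : L) : frobL l != l ->
  exists c : k, chiL (c *: l) != 1.
Proof.
move=> lN; have [x xF psix] := psi_nontriv.
have d0 : kappa (l - frobL l) != 0.
  by rewrite fmorph_eq0 subr_eq0 eq_sym.
have dF := skew_Fplus (skew_frob l).
rewrite !inE expn1 !addr_eq0 in xF dF.
have [c cE] : exists c, x / kappa (l - frobL l) = Fbar_inj k c.
  apply: fixed_by_frobenius.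
  by rewrite exprMn exprVn (eqP xF) (eqP dF) invrN mulrNN.
exists c; rewrite /chiL [frobL _]linearZ -scalerBr linearZ /=.
by rewrite [_ *: _](_ : _ = x) // -[RHS](divfK d0) cE.
Qed.

Variables (j : nat) (N : nat).
Hypothesis j_odd : odd j.
Local Notation R := (Fq k j).
Local Notation LR := (tens L R).
Local Notation VR := 'cV[LR]_n.
Local Notation hR := (hermR (V := V) (R := R)).
Variable rho : mx_representation K [set: HU V R] N.
Hypothesis HW : is_HeisenbergWeil kappa psi rho.

Let j_gt0 : (0 < j)%N. Proof. by case: j j_odd. Qed.

Let rhoM x y : rho (x * y)%g = rho x *m rho y.
Proof. by apply: repr_mxM; rewrite inE. Qed.
Let rho1 : rho 1%g = 1%:M. Proof. exact: repr_mx1. Qed.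
Let rho_unit x : rho x \in unitmx.
Proof. by apply: repr_mx_unit; rewrite inE. Qed.
Let rhoV x : rho x^-1%g = invmx (rho x).
Proof. by apply: repr_mxV; rewrite inE. Qed.

Definition rhoH (h : Heis V R) := rho (h, 1%g).
Definition rhoU (u : Unitary V R) := rho (1%g, u).

Lemma rhoHM x y : rhoH (x * y)%g = rhoH x *m rhoH y.
Proof.
rewrite -rhoM; congr (rho (_, _)); last by rewrite mulg1.
by congr (_ * _)%g; rewrite [RHS]unitary_act1.
Qed.

Lemma rhoHU h u : rho (h, u) = rhoH h *m rhoU u.
Proof.
rewrite -rhoM; congr (rho (_, _)); last by rewrite mul1g.
by rewrite [in RHS]/= unitary_act1 mulg1.
Qed.

Lemma rhoUH u h : rhoU u *m rhoH h = rhoH (unitary_act u h) *m rhoU u.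
Proof.
rewrite -!rhoM; congr (rho (_, _)); last by rewrite mulg1 mul1g.
by rewrite [LHS]mul1g [in RHS]/= unitary_act1 mulg1.
Qed.

Lemma rhoH_cent M : (forall h, M *m rhoH h = rhoH h *m M) -> is_scalar_mx M.
Proof.
move=> cM; have abs := group_closure_closed_field (HW_irr HW).
apply: (mx_abs_irr_cent_scalar abs); apply/centgmxP => -[h u].
by rewrite inE /= => /eqP->; apply: cM.
Qed.

(** The central character of the level, through the trace to L. *)
Definition zeta (a : LR) : K := psi (kappa (trL a)).

(** Central elements are scalars by Schur's lemma, and the scalar is read off
    on the vector where the centre is known to act through psi. *)
Lemma rhoH_central z : heis_vec z = 0 -> rhoH z = (zeta (heis_sca z))%:M.
Proof.
move=> z0.
have /is_scalar_mxP[c cE] : is_scalar_mx (rhoH z).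
  by apply: rhoH_cent => h; rewrite -!rhoHM heis_central.
have [v v0 vE] := HW_central HW.
have := vE (z, 1%g) erefl z0; rewrite -[rho _]/(rhoH z) cE mul_mx_scalar.
rewrite psi_level_trL //= => /eqP.
by rewrite -subr_eq0 -scalerBl scaler_eq0 (negPf v0) orbF subr_eq0 => /eqP->.
Qed.

Definition weylW (v : VR) := rhoH (hsec v).
Definition weylG (v w : VR) : L := trL (conjR (tens_of R th) * hR v w).

Lemma zeta_skew (y : LR) : zeta (y - conjR y) = chiL (trL y).
Proof. by rewrite /zeta trLD // trLN // trL_conj. Qed.

Lemma chiL_trL (y y' : LR) : y - conjR y = y' - conjR y' ->
  chiL (trL y) = chiL (trL y').
Proof. by move=> yy'; rewrite -zeta_skew yy' zeta_skew. Qed.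

Lemma weylW0 : weylW 0 = 1%:M.
Proof. by rewrite /weylW hsec0 [LHS]rho1. Qed.

Lemma weylWM v w : weylW v *m weylW w = chiL (weylG v w) *: weylW (v + w).
Proof.
rewrite -rhoHM hsecM rhoHM rhoH_central // mul_scalar_mx.
by rewrite [heis_sca _]/= zeta_skew.
Qed.

Lemma rhoH_weyl (h : Heis V R) :
  exists2 z : Heis V R, heis_vec z = 0 & h = (z * hsec (heis_vec h))%g.
Proof.
exists (h * (hsec (heis_vec h))^-1)%g; last by rewrite mulgKV.
by rewrite heis_vec_mul heis_vec_inv subrr.
Qed.

Lemma weylW_cent M : (forall v, M *m weylW v = weylW v *m M) -> is_scalar_mx M.
Proof.
move=> cM; apply: rhoH_cent => h; have [z z0 ->] := rhoH_weyl h.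
rewrite rhoHM rhoH_central // mul_scalar_mx -scalemxAr -scalemxAl.
by congr (_ *: _); apply: cM.
Qed.

(** Conjugation by a suitable W w multiplies W v by a scalar other than 1. *)
Lemma weylW_trace v : v != 0 -> \tr (weylW v) = 0.
Proof.
move=> v0; have [w0 y0] := gram_nondegenerate hV v0.
have [a aN] := trL_nondegenerate j_gt0 y0.
have [c cN] := chiL_nontrivial aN.
(* chosen so that hR w v = a * c * hR w0 v, on which chiL is nontrivial *)
pose w : VR := conjR (a * tens_of R (c%:A)) *: w0.
have wv : trL (hR w v) = c *: trL (a * hR w0 v).
  by rewrite hermR_scalel conjRK mulrAC mulrC trLM // mulr_algl.
have [chi0 chiD] := chiL_add_char; have chiN0 := add_char_neq0 _ chiL_add_char.
have comm : chiL (weylG w v) = chiL (c *: trL (a * hR w0 v)) * chiL (weylG v w).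
  rewrite -chiD -wv /weylG -(hermRC w v) -trLD //; apply: chiL_trL.
  rewrite !rmorphD !rmorphM /= !conjRK conj_thR //.
  exact: weyl_comm_ring.
have : weylW w *m weylW v = chiL (c *: trL (a * hR w0 v)) *: (weylW v *m weylW w).
  have vw := weylWM v w; rewrite [LHS]weylWM vw scalerA.
  exact: (f_equal2 (fun a u => a *: weylW u) comm (addrC w v)).
have uW : weylW w \in unitmx by apply: rho_unit.
move/(congr1 (fun M => \tr (M *m invmx (weylW w)))).
rewrite -scalemxAl mxtraceZ mulmxK // mxtrace_mulC mulKmx // => trE.
apply/eqP; move/eqP: trE; rewrite -subr_eq0 -{1}[\tr _]mul1r -mulrBl mulf_eq0.
by rewrite subr_eq0 eq_sym (negPf cN).
Qed.

(** The degree is the prescribed trace at the identity. *)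
Lemma HW_degree : N = (q ^ (j * n))%N.
Proof.
have := HW_trace HW 1%g; rewrite [rho _]rho1 mxtrace1 fix_dim1.
rewrite [X in _ * X]exprNn mulrA.
rewrite -exprD addnn -signr_odd odd_double mul1r -natrX -expnM.
by rewrite !pmulrn => /(pchar0_intr_inj K0)[].
Qed.

Lemma card_level : #|{: VR}| = (N ^ 2)%N.
Proof.
rewrite card_mx muln1 (_ : #|{: LR}| = (q ^ (j * 2))%N); last first.
  by rewrite (card_mx R 1) mul1n quad_dim card_Fq // expnM.
by rewrite HW_degree -!expnM; congr (_ ^ _)%N; rewrite mulnAC.
Qed.

Local Notation LX := {unit finvect_type L}.
(** The units of L act on V by scalars, freely away from 0 and commuting with
    the unitary group and with Frobenius: this is the group X of the abstract
    Weyl systems. *)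
Definition unitL (x : LX) : L := val x.
Definition scaleL (x : LX) (v : VR) : VR := tens_of R (unitL x) *: v.
Definition normL (x : LX) : k :=
  odflt 0 [pick c : k | c%:A == unitL x * frobL (unitL x)].

Lemma normLE x : (normL x)%:A = unitL x * frobL (unitL x).
Proof.
rewrite /normL; case: pickP => [c /eqP //|noc].
have [] : exists c : k, unitL x * frobL (unitL x) = c%:A.
  by apply: frob_fixed_scalar; rewrite rmorphM /= frobK mulrC.
by move=> c cE; have := noc c; rewrite cE eqxx.
Qed.

Lemma card_unitL : #|{: LX}| = (q ^ 2).-1.
Proof. by rewrite -cardsT card_finField_unit card_quadExt. Qed.

Lemma normL_onto c : c != 0 -> exists x, normL x = c.
Proof.
move=> c0; have [x x0 xE] := norm_onto kappa c0.
have ux : (x : finvect_type L) \is a GRing.unit by rewrite unitfE.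
exists (FinRing.Unit ux); apply: (fmorph_inj (in_alg L)).
by rewrite /= normLE -xE.
Qed.

Lemma scaleL1 v : scaleL 1%g v = v.
Proof. by rewrite /scaleL (_ : tens_of R _ = 1) ?scale1r. Qed.

Lemma scaleLM x y v : scaleL (x * y)%g v = scaleL x (scaleL y v).
Proof. by rewrite /scaleL scalerA -tens_of_mul. Qed.

Lemma scaleLD x v w : scaleL x (v + w) = scaleL x v + scaleL x w.
Proof. exact: scalerDr. Qed.

Lemma scaleL_free x v : v != 0 -> scaleL x v = v -> x = 1%g.
Proof.
move=> v0 xv; apply: val_inj => /=; apply/eqP; rewrite -subr_eq0.
apply: contraNT v0 => x1; rewrite -[v]scale1r.
have -> : 1 = tens_of R ((unitL x - 1)^-1) * tens_of R (unitL x - 1) :> LR.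
  by rewrite -tens_of_mul mulVf.
rewrite -scalerA tens_ofD scalerDl -[tens_of R (unitL x) *: v]/(scaleL x v) xv.
have -> : tens_of R (-1) = -1 :> LR.
  by apply: (addrI (tens_of R 1)); rewrite -tens_ofD subrr tens_of0 [RHS]subrr.
by rewrite scaleN1r subrr scaler0.
Qed.

Lemma weylG_scale x v w :
  weylG (scaleL x v) (scaleL x w) = normL x *: weylG v w.
Proof.
rewrite /weylG /scaleL hermR_scalel hermR_scaler.
rewrite [conjR (tens_of R (unitL x))]conjR_of.
rewrite (mulrA (tens_of R (frobL _))) -tens_of_mul mulrCA trLM //.
by rewrite -mulr_algl normLE [_ * frobL _]mulrC.
Qed.

Lemma weylG00 : weylG 0 0 = 0.
Proof. by rewrite /weylG hermR0r mulr0 trL0. Qed.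

Let q_mod : q%:R = -1 :> 'Z_q.+1.
Proof.
apply/eqP; rewrite -addr_eq0 -[1]/(1%:R) -natrD addn1 pchar_Zp //.
by rewrite ltnS ltnW // finNzRing_gt1.
Qed.

Lemma HW_degree_mod : N%:R = (-1) ^+ n :> 'Z_q.+1.
Proof.
by rewrite HW_degree natrX q_mod exprM -[(-1) ^+ j]signr_odd j_odd expr1.
Qed.

Local Notation waut := (weyl_aut scaleL weylG).
Local Notation wnormal := (weyl_normal k n weylW).
Local Notation wlift := (weyl_lift weylW).

Definition umap (u : Unitary V R) (v : VR) : VR := umx u *m v.
Definition fmap (v : VR) : VR := map_mx (tens_map (frob (R:=R))) v.

Lemma umap_aut u : waut (umap u).
Proof.
split=> [v w|v w|x v]; first exact: mulmxDr.
- by rewrite /weylG hermR_umx.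
- by rewrite /umap /scaleL -scalemxAr.
Qed.

Lemma fmap_aut : waut fmap.
Proof.
split=> [v w|v w|x v]; first exact: map_mxD.
- rewrite /weylG -map_hermR -[in RHS]trL_frob // rmorphM /= tens_map_conj.
  by rewrite tens_map_of.
- by rewrite /fmap /scaleL map_mxZ /= tens_map_of.
Qed.

Lemma waut_comp A B : waut A -> waut B -> waut (A \o B).
Proof.
move=> [AD Ag Asc] [BD Bg Bsc].
by split=> [v w|v w|x v] /=; rewrite ?BD ?AD ?Ag ?Bg ?Bsc ?Asc.
Qed.

Lemma weylW_umap u v : rhoU u *m weylW v = weylW (umap u v) *m rhoU u.
Proof. by rewrite rhoUH hsec_act. Qed.

(** The traces prescribed on the unitary group are those of normal lifts,
    because q ^ j = -1 modulo q + 1 for odd j. *)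
Lemma rhoU_normal u : wnormal (rhoU u) (umap u).
Proof.
split; first by split; [apply: rho_unit | apply: weylW_umap].
(* the trace prescribed at u, which u^-1 shares *)
exists ((-1) ^+ n * (- (q ^ j)%:Z) ^+ fix_dim kappa u).
  rewrite rmorphM !rmorphXn /= !rmorphN /= rmorph1 rmorphXn /= -pmulrn q_mod.
  by rewrite -[(-1) ^+ j]signr_odd j_odd expr1 opprK expr1n mulr1.
have trE g : \tr (rhoU g) = ((-1) ^+ n * (- (q ^ j)%:Z) ^+ fix_dim kappa g)%:~R.
  rewrite [LHS](HW_trace HW) rmorphM !rmorphXn /= !rmorphN /= rmorph1.
  by rewrite !rmorphXn /= -pmulrn.
rewrite trE; split=> //; rewrite -(fix_dimV kappa u) -trE -rhoV.
congr (\tr (rho (_, _))).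
by rewrite invg1; apply: lactE1.
Qed.

Lemma card_fix_fmap : #|weyl_fix fmap| = ((q ^ n) ^ 2)%N.
Proof.
pose inc (a : 'cV['rV[k]_(\dim {:L})]_n) : VR :=
  \col_i (\row_l (a i 0 0 l)%:A : LR).
have inc_inj : injective inc.
  move=> a b ab; apply/colP => i; apply/rowP => l.
  apply: (in_alg_Fq_inj (j := j)).
  by have := congr1 (fun v : VR => v i 0 0 l) ab; rewrite !mxE.
have -> : weyl_fix fmap = inc @: setT.
  apply/setP => v; rewrite inE; apply/eqP/imsetP => [vF|[a _ ->]]; last first.
    apply/colP => i; rewrite !mxE; apply/rowP => l.
    by rewrite !mxE /= /frob exprZn expf_card expr1n.
  have coefP i l : exists c : k, v i 0 0 l == c%:A.
    have [] := @fixed_by_frobenius k R (in_alg R) (v i 0 0 l).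
      have := congr1 (fun v : VR => v i 0 0 l) vF.
      by rewrite !mxE.
    by move=> c ->; exists c.
  exists (\col_i \row_l xchoose (coefP i l)) => //.
  apply/colP => i; rewrite !mxE; apply/rowP => l; rewrite !mxE.
  exact/eqP/(xchooseP (coefP i l)).
rewrite card_imset // cardsT card_mx muln1 (card_mx k 1) mul1n quad_dim.
by rewrite -!expnM mulnC.
Qed.

Let chiP := chiL_add_char.

Lemma wnormal_mul S T A B : waut A -> waut B ->
  wnormal S A -> wnormal T B -> wnormal (S *m T) (A \o B).
Proof.
exact: (weyl_normal_mul K0 card_unitL normL_onto scaleL1 scaleLM scaleLD
  scaleL_free weylG_scale weylG00 chiP weylW0 weylWM weylW_trace weylW_cent
  card_level HW_degree_mod).
Qed.

Lemma wnormal_inj T T' A : waut A -> wnormal T A -> wnormal T' A -> T = T'.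
Proof.
exact: (weyl_normal_inj K0 chiP weylW0 weylWM weylW_trace weylW_cent
  card_level).
Qed.

Lemma wlift_trace T A : wlift T A ->
  \tr T * \tr (invmx T) = #|weyl_fix A|%:R.
Proof.
exact: (weyl_lift_trace K0 chiP weylW0 weylWM weylW_trace weylW_cent
  card_level).
Qed.

Lemma wnormal_trace T A : wnormal T A -> exists t : int,
  [/\ t%:~R = (-1) ^+ n :> 'Z_q.+1, \tr T = t%:~R & t ^+ 2 = #|weyl_fix A|%:Z].
Proof.
case=> TA [t tE [trT trTV]]; exists t; split=> //.
apply: (pchar0_intr_inj K0); rewrite -pmulrn -(wlift_trace TA) trT trTV.
by rewrite expr2 rmorphM.
Qed.

Lemma wlift_affine_fix T A h : waut A -> wlift T A ->
  \tr (rhoH h *m T) != 0 -> exists v, heis_vec h + A v = v.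
Proof.
move=> Aaut TA; have [z z0 ->] := rhoH_weyl h.
rewrite rhoHM rhoH_central // mul_scalar_mx -scalemxAl mxtraceZ mulf_eq0.
rewrite negb_or => /andP[_ tr0]; rewrite heis_vec_mul z0 add0r.
exact: (weyl_affine_fix K0 chiP weylW0 weylWM weylW_trace weylW_cent
  card_level Aaut TA tr0).
Qed.

(** Conjugation by the lift hsec v of a fixed point v moves v to the origin and
    leaves T multiplied by a central element. *)
Lemma wlift_affine_trace T A h v : wlift T A -> heis_vec h + A v = v ->
  let z := ((hsec v)^-1 * (h * hsec (A v)))%g in
  \tr (rhoH h *m T) = zeta (heis_sca z) * \tr T.
Proof.
move=> [uT TA] hv z.
have z0 : heis_vec z = 0.
  by rewrite !heis_vec_mul heis_vec_inv [heis_vec (hsec _)]/= hv addNr.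
have uW : weylW v \in unitmx by apply: rho_unit.
have : rhoH h *m T *m weylW v = zeta (heis_sca z) *: (weylW v *m T).
  rewrite -mulmxA TA mulmxA -rhoHM -(mulKVg (hsec v) (h * _)%g) -/z.
  by rewrite rhoHM (rhoH_central z0) mul_mx_scalar scalemxAl.
move/(congr1 (fun M => \tr (M *m invmx (weylW v)))).
by rewrite mulmxK // -scalemxAl mxtraceZ [X in _ * X]mxtrace_mulC mulKmx.
Qed.

Lemma wnormal_ext T A B : A =1 B -> wnormal T A -> wnormal T B.
Proof. by move=> AB [[uT TA] t]; split=> //; split=> // v; rewrite -AB. Qed.

Lemma wnormal_frob_exists : exists T, wnormal T fmap.
Proof.
apply: (weyl_normal_exists K0 chiP weylW0 weylWM weylW_trace weylW_cent
  card_level fmap_aut (b := (q ^ n)%:Z)).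
  by rewrite -pmulrn natrX q_mod.
by rewrite card_fix_fmap PoszM -expr2.
Qed.

Lemma wlift_frob_heis T h : wlift T fmap ->
  T *m rhoH h = rhoH (heis_map (frob (R:=R)) h) *m T.
Proof.
move=> [_ TF]; have [z z0 ->] := rhoH_weyl h.
rewrite heis_map_mul !rhoHM rhoH_central // mul_scalar_mx -scalemxAr.
rewrite -[rhoH (hsec _)]/(weylW _) TF hsec_map rhoH_central; last first.
  transitivity (map_mx (tens_map (frob (R:=R))) (heis_vec z)); first by [].
  by rewrite z0 map_mx0.
rewrite mul_scalar_mx -scalemxAl; congr (_ *: _).
by rewrite /zeta -[in LHS]trL_frob.
Qed.

Lemma iter_fmap_aut i : waut (iter i fmap).
Proof.
elim: i => [|i IHi]; first by split=> [v w|v w|x v].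
exact: (waut_comp fmap_aut IHi).
Qed.

Lemma umap1 v : umap 1%g v = v.
Proof. exact: mul1mx. Qed.

Lemma wnormal_frob_pow T i : wnormal T fmap -> wnormal (T ^+ i) (iter i fmap).
Proof.
move=> TF; elim: i => [|i IHi].
  have -> : T ^+ 0 = rhoU 1%g by rewrite [RHS]rho1.
  exact: wnormal_ext umap1 (rhoU_normal _).
by rewrite exprS; apply: (wnormal_mul fmap_aut (iter_fmap_aut i)).
Qed.

Lemma fmap_period v : iter j fmap v = v.
Proof.
have iterE s : iter s fmap v = map_mx (iter s (tens_map (frob (R:=R)))) v.
  elim: s => [|s IHs]; first by apply/matrixP => i l; rewrite !mxE.
  by rewrite iterS IHs; apply/matrixP => i l; rewrite !mxE.
by rewrite iterE; apply/matrixP => i l; rewrite mxE iter_F_period.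
Qed.

(** Frobenius acts by its normal lift. Normal lifts are multiplicative and
    unique, so the relations of the semidirect product hold as soon as they hold
    for the underlying automorphisms of V. *)
Lemma HW_frobenius_operator : exists T : 'M[K]_N,
  [/\ forall x, T *m rho x = rho (HU_frob x) *m T, T ^+ j = 1%:M &
      forall i u, wnormal (rhoU u *m T ^+ i) (umap u \o iter i fmap)].
Proof.
have [T TF] := wnormal_frob_exists; exists T; split.
- case=> h u; rewrite !rhoHU mulmxA wlift_frob_heis; last by case: TF.
  rewrite -!mulmxA; congr (_ *m _).
  apply: (wnormal_inj (waut_comp fmap_aut (umap_aut u))).
    exact: (wnormal_mul fmap_aut (umap_aut u) TF (rhoU_normal u)).
  apply: (wnormal_ext (A := umap (unitary_map (frob (R:=R)) u) \o fmap)).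
    by move=> v; rewrite /= /fmap /umap map_mxM.
  exact: (wnormal_mul (umap_aut _) fmap_aut (rhoU_normal _) TF).
- apply: (wnormal_inj (iter_fmap_aut 0)).
    exact: (wnormal_ext fmap_period (wnormal_frob_pow j TF)).
  exact: (wnormal_frob_pow 0 TF).
- move=> i u.
  exact: (wnormal_mul (umap_aut _) (iter_fmap_aut i) (rhoU_normal u)
    (wnormal_frob_pow i TF)).
Qed.

End HeisenbergWeilLevel.

(** * Twisted norms and fixed points *)

Lemma iter_swap (T : Type) (f : T -> T) a b x :
  iter a f (iter b f x) = iter b f (iter a f x).
Proof. by rewrite -!iterD addnC. Qed.

(** C = A^mu E^-i and B = A^t E^-s generate the same group as A and E, because
    the matrix of exponents has determinant t i - s mu = 1. The relations are
    stated without inverses. *)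
Lemma commuting_fixed (S : Type) (A E C B : S -> S) mu i t s (x : S) :
    (t * i = s * mu + 1)%N -> injective A -> injective E ->
    (forall y, A (E y) = E (A y)) ->
    (forall y, C (iter i E y) = iter mu A y) ->
    (forall y, B (iter s E y) = iter t A y) ->
    (forall y, C (E y) = E (C y)) -> (forall y, B (E y) = E (B y)) ->
  A x = x /\ E x = x <-> C x = x /\ B x = x.
Proof.
move=> ti A_inj E_inj AE CE BE Cc Bc.
have fix_iter (f : S -> S) r y : f y = y -> iter r f y = y.
  by move=> fy; elim: r => //= r ->.
have comm_iter (f h : S -> S) r : (forall y, f (h y) = h (f y)) ->
    forall y, f (iter r h y) = iter r h (f y).
  by move=> fh y; elim: r => //= r IHr; rewrite fh IHr.
have iter_mul (f : S -> S) a b y : iter (a * b) f y = iter a (iter b f) y.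
  by elim: a => //= a IHa; rewrite mulSn iterD IHa.
have iter_inj (f : S -> S) r : injective f -> injective (iter r f).
  by move=> f_inj; elim: r => // r IHr y z /= /f_inj/IHr.
split=> [[Ax Ex]|[Cx Bx]].
  split; first by rewrite -{1}(fix_iter E i x Ex) CE fix_iter.
  by rewrite -{1}(fix_iter E s x Ex) BE fix_iter.
have Amu : iter mu A x = iter i E x by rewrite -CE (comm_iter C) // Cx.
have At : iter t A x = iter s E x by rewrite -BE (comm_iter B) // Bx.
have swap a b y : iter a A (iter b E y) = iter b E (iter a A y).
  by apply: (comm_iter (iter a A) E) => z; symmetry; apply: comm_iter.
have Amus r : iter (r * mu) A x = iter (r * i) E x.
  elim: r => // r IHr; rewrite !mulSn !iterD IHr swap Amu -!iterD.
  by rewrite addnC.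
have Ati r : iter (r * t) A x = iter (r * s) E x.
  elim: r => // r IHr; rewrite !mulSn !iterD IHr swap At -!iterD.
  by rewrite addnC.
have Ax : A x = x.
  apply: (iter_inj A (s * mu)%N A_inj); rewrite -iterSr -addn1 -ti mulnC.
  by rewrite Ati Amus mulnC.
split=> //; have Eix : iter i E x = x by rewrite -Amu fix_iter.
have Esx : iter s E x = x by rewrite -At fix_iter.
have := iter_mul E t i x; rewrite (fix_iter (iter i E)) // ti addn1 iterS.
by rewrite mulnC iter_mul (fix_iter (iter s E)).
Qed.

(** As a < gcdn m i and s < m / gcdn m i vary, a + i s runs over the residues
    modulo m. *)
Lemma sum_gcd_periodic (M : nmodType) (f : nat -> M) m i : (0 < m)%N ->
  (forall s, f (s + m)%N = f s) ->
  \sum_(a < gcdn m i) \sum_(s < m %/ gcdn m i) f (a + i * s)%N =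
    \sum_(r < m) f r.
Proof.
move=> m_gt0 fm; set d := gcdn m i; set mu := (m %/ d)%N.
have d_gt0 : (0 < d)%N by rewrite gcdn_gt0 m_gt0.
have mE : m = (d * mu)%N by rewrite mulnC divnK ?dvdn_gcdl.
have iE : i = (d * (i %/ d))%N by rewrite mulnC divnK ?dvdn_gcdr.
have co : coprime (i %/ d) mu.
  rewrite /coprime -(eqn_pmul2l d_gt0) muln1 muln_gcdr -iE -mE gcdnC.
  exact: eqxx.
have -> : \sum_(r < m) f r = \sum_(s < mu) \sum_(a < d) f (a + d * s)%N.
  rewrite mE; elim: mu {mE co} => [|r IHr]; first by rewrite muln0 !big_ord0.
  rewrite big_ord_recr /= -IHr mulnS addnC -!(big_mkord xpredT).
  rewrite (big_cat_nat (n := (d * r)%N)) ?leq_addr //=; congr (_ + _).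
  by rewrite -{1}[(d * r)%N]add0n big_addn addKn big_mkord.
rewrite [RHS]exchange_big; apply: eq_bigr => a _ /=.
rewrite -[RHS](sum_periodic co (f := fun s => f (a + d * s)%N)).
  by apply: eq_bigr => s _; rewrite mulnA -iE.
by move=> s; rewrite mulnDr -mE addnA fm.
Qed.

Section TwistedFixedPoints.
Variables (G : groupType) (S : Type) (Phi : G -> G) (phi : S -> S).
Variable act : G -> S -> S.
Hypothesis PhiM : forall x y, Phi (x * y)%g = (Phi x * Phi y)%g.
Hypothesis act1 : forall x, act 1%g x = x.
Hypothesis actM : forall a b x, act (a * b)%g x = act a (act b x).
Hypothesis phi_act : forall a x, phi (act a x) = act (Phi a) (phi x).
Hypothesis phi_inj : injective phi.

(** The G-component of the r-th power of (g, Phi^i). *)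
Definition twist_prod i (g : G) r : G :=
  (\prod_(0 <= s < r) iter (i * s)%N Phi g)%g.

Lemma iter_PhiM r x y : iter r Phi (x * y)%g = (iter r Phi x * iter r Phi y)%g.
Proof. by elim: r => //= r ->. Qed.

Lemma iter_Phi1 r : iter r Phi 1%g = 1%g.
Proof. by apply: (mulgI (iter r Phi 1%g)); rewrite -iter_PhiM !mulg1. Qed.

Lemma twist_prod0 i g : twist_prod i g 0 = 1%g.
Proof. by rewrite /twist_prod big_geq. Qed.

Lemma twist_prodS i g r :
  twist_prod i g r.+1 = (g * iter i Phi (twist_prod i g r))%g.
Proof.
rewrite /twist_prod big_nat_recl // muln0; congr (_ * _)%g.
elim: r => [|r IHr]; first by rewrite !big_geq // iter_Phi1.
by rewrite !big_nat_recr //= iter_PhiM -IHr -iterD mulnS.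
Qed.

Lemma iter_phi_act r a x : iter r phi (act a x) = act (iter r Phi a) (iter r phi x).
Proof. by elim: r => //= r ->. Qed.

Lemma iter_twisted i g r x : iter r (fun v => act g (iter i phi v)) x =
  act (twist_prod i g r) (iter (i * r) phi x).
Proof.
elim: r => [|r IHr]; first by rewrite twist_prod0 muln0 act1.
by rewrite iterS IHr iter_phi_act -actM -twist_prodS mulnS iterD.
Qed.

Lemma act_inj a : injective (act a).
Proof. by apply: (can_inj (g := act a^-1%g)) => v; rewrite -actM mulVg act1. Qed.

Variables (m i t s : nat) (g y alpha : G).
Local Notation d := (gcdn m i).
Local Notation mu := (m %/ gcdn m i)%N.
Hypothesis m_gt0 : (0 < m)%N.
Hypothesis gm : iter m Phi g = g.
Hypothesis tE : (t * i = d + m * s)%N.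
Hypothesis aE : iter d Phi alpha = (alpha * twist_prod i g t)%g.
Hypothesis yE : y = (alpha * twist_prod i g mu * alpha^-1)%g.

Lemma twist_prod_period r : iter m Phi (twist_prod i g r) = twist_prod i g r.
Proof.
elim: r => [|r IHr]; first by rewrite twist_prod0 iter_Phi1.
by rewrite twist_prodS iter_PhiM gm iter_swap IHr.
Qed.

(** Conjugation by alpha carries the group generated by g Phi^i and Phi^m to
    the one generated by y and Phi^d, so both have the same fixed points, up to
    alpha. *)
Lemma twisted_fixed v :
  act g (iter i phi v) = v /\ iter m phi v = v <->
  act y (act alpha v) = act alpha v /\ iter d phi (act alpha v) = act alpha v.
Proof.
have d_gt0 : (0 < d)%N by rewrite gcdn_gt0 m_gt0.
pose A v := act g (iter i phi v); pose E := iter m phi.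
pose C v := act (twist_prod i g mu) v.
pose B v := act (twist_prod i g t) (iter d phi v).
have mE : m = (d * mu)%N by rewrite mulnC divnK ?dvdn_gcdl.
have iE : i = (d * (i %/ d))%N by rewrite mulnC divnK ?dvdn_gcdr.
(* t i = d + m s divided by d *)
have ti : (t * (i %/ d) = s * mu + 1)%N.
  apply/eqP; rewrite -(eqn_pmul2l d_gt0) mulnCA -iE tE mulnDr muln1 addnC.
  by rewrite mulnCA -mE mulnC.
have iter_inj (f : S -> S) r : injective f -> injective (iter r f).
  by move=> f_inj; elim: r => // r IHr u w /= /f_inj/IHr.
have iter_mul (f : S -> S) a b w : iter (a * b) f w = iter a (iter b f) w.
  by elim: a => //= a IHa; rewrite mulSn iterD IHa.
have A_inj : injective A by move=> u w /act_inj/(iter_inj _ _ phi_inj).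
have E_inj : injective E by apply: iter_inj phi_inj.
have AE w : A (E w) = E (A w) by rewrite /E iter_phi_act gm iter_swap.
have CE w : C (iter (i %/ d) E w) = iter mu A w.
  have imu : (i %/ d * m = i * mu)%N by rewrite mulnC muln_divCA_gcd.
  by rewrite iter_twisted /C /E -iter_mul imu.
have BE w : B (iter s E w) = iter t A w.
  have it : (d + s * m = i * t)%N by rewrite [RHS]mulnC tE [(s * m)%N]mulnC.
  by rewrite iter_twisted /B /E -iter_mul -iterD it.
have CEc w : C (E w) = E (C w) by rewrite /C /E iter_phi_act twist_prod_period.
have BEc w : B (E w) = E (B w).
  by rewrite /B /E iter_phi_act twist_prod_period iter_swap.
have -> := commuting_fixed v ti A_inj E_inj AE CE BE CEc BEc.
have <- : act alpha (C v) = act y (act alpha v).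
  by rewrite -!actM yE mulgKV.
have <- : act alpha (B v) = iter d phi (act alpha v).
  by rewrite iter_phi_act aE actM.
by split=> [[-> ->]|[/act_inj Cv /act_inj Bv]].
Qed.
End TwistedFixedPoints.

Section AffineAction.
Variables (k : finFieldType) (L : quadExt k) (V : hermSpace L).
Local Notation n := (\dim {:V}).

(** HU acts on the Heisenberg group, as on HU / U, and on its quotient V by
    affine maps. *)
Definition aff (R : comAlgType k) (a : HU V R) (v : 'cV[tens L R]_n) :=
  heis_vec a.1 + umx a.2 *m v.

Definition vmap (R S : comAlgType k) (phi : {lrmorphism R -> S})
    (v : 'cV[tens L R]_n) : 'cV[tens L S]_n := map_mx (tens_map phi) v.

Definition hact (R : comAlgType k) (a : HU V R) (x : Heis V R) : Heis V R :=
  (a.1 * unitary_act a.2 x)%g.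

Section Equivariance.
Variable R : comAlgType k.
Implicit Types (a b : HU V R) (x z : Heis V R).

Lemma affM a b v : aff (a * b)%g v = aff a (aff b v).
Proof.
rewrite /aff [heis_vec _]heis_vec_mul -addrA; congr (_ + _).
by rewrite mulmxDr mulmxA.
Qed.

Lemma aff1 v : aff (1%g : HU V R) v = v.
Proof. by rewrite /aff add0r mul1mx. Qed.

Lemma hactM a b x : hact (a * b)%g x = hact a (hact b x).
Proof. by rewrite /hact unitary_act_mul -unitary_actM mulgA. Qed.

Lemma hact1 x : hact 1%g x = x.
Proof. by rewrite /hact unitary_act1 mul1g. Qed.

Lemma hact_vec a x : heis_vec (hact a x) = aff a (heis_vec x).
Proof. by []. Qed.

Lemma hact_central a x z : heis_vec z = 0 -> hact a (x * z)%g = (hact a x * z)%g.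
Proof.
move=> z0; rewrite /hact unitary_act_mul mulgA; congr (_ * _)%g.
apply: heis_inj => //; rewrite [LHS]/= /heis_vec /=.
by rewrite -[(val z).1]/(heis_vec z) z0 mulmx0.
Qed.
End Equivariance.

Lemma aff_map (R S : comAlgType k) (phi : {lrmorphism R -> S}) a v :
  vmap phi (aff a v) = aff (HU_map phi a) (vmap phi v).
Proof. by rewrite /vmap /aff map_mxD map_mxM. Qed.

Lemma hact_map (R S : comAlgType k) (phi : {lrmorphism R -> S}) a x :
  heis_map phi (hact a x) = hact (HU_map phi a) (heis_map phi x).
Proof. by rewrite heis_map_mul heis_map_act. Qed.

End AffineAction.

Section Norm.
Variables (k : finFieldType) (L : quadExt k) (V : hermSpace L).
Variables (m i : nat).
Hypotheses (m_gt0 : (0 < m)%N) (i_gt0 : (0 < i)%N).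
Local Notation q := #|k|.
Local Notation n := (\dim {:V}).
Local Notation d := (gcdn m i).
Local Notation mu := (m %/ gcdn m i)%N.
Local Notation Fb := (Fbar k).
Local Notation HF := (HU_frob (V := V) (R := Fb)).
Local Notation incl j := (HU_map (V := V) (@Fq_val k j)).
Local Notation G j := (HU V (Fq k j)).
Local Notation VB := 'cV[tens L Fb]_n.
Local Notation vF := (vmap (V := V) (frob (R := Fb))).
Local Notation vincl j := (vmap (V := V) (@Fq_val k j)).

Let d_gt0 : (0 < d)%N. Proof. by rewrite gcdn_gt0 m_gt0. Qed.

Local Notation frob_prod := (twist_prod (@HU_frob k L V _) i).

(** The equations of [is_norm] with the cyclic factor eliminated: t is now a
    natural number and s witnesses t i = d modulo m. *)
Definition norm_rel (g : G m) (y : G d) (t s : nat) (alpha : HU V Fb) :=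
  [/\ (t * i = d + m * s)%N,
      iter d HF alpha = (alpha * frob_prod (incl m g) t)%g
    & incl d y = (alpha * frob_prod (incl m g) mu * alpha^-1)%g].

Lemma HU_map_frob (R S : comAlgType k) (phi : {lrmorphism R -> S}) (x : HU V R) :
  HU_map phi (HU_frob x) = HU_frob (HU_map phi x).
Proof.
have mapF (z : tens L R) :
    tens_map phi (tens_map (frob (R:=R)) z) =
    tens_map (frob (R:=S)) (tens_map phi z).
  by apply/rowP => l; rewrite !mxE /= /frob rmorphXn.
congr (_, _).
  apply: heis_inj; last exact: mapF.
  by apply/matrixP => a b; rewrite !mxE mapF.
by apply: umx_inj; apply/matrixP => a b; rewrite !mxE mapF.
Qed.

Lemma incl_frob j r (x : G j) :
  incl j (iter r (HU_frob (R := Fq k j)) x) = iter r HF (incl j x).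
Proof. by elim: r => //= r <-; apply: HU_map_frob. Qed.

Lemma incl_period j r (x : G j) : (0 < j)%N ->
  iter (j * r) HF (incl j x) = incl j x.
Proof.
move=> j_gt0; rewrite -incl_frob mulnC; congr (HU_map _ _).
have per := iter_HU_frob_id x; rewrite (prednK j_gt0) in per.
by elim: r => // r IHr; rewrite mulSn iterD IHr per.
Qed.

Lemma incl_frob_prod j (x : G j) r :
  incl j (frob_prod x r) = frob_prod (incl j x) r.
Proof.
elim: r => [|r IHr]; first by rewrite !twist_prod0 HU_map1.
by rewrite !(twist_prodS (@HU_map_mul _ _ _ _ _ _)) HU_map_mul incl_frob IHr.
Qed.

Lemma incl_period1 j (x : G j) : (0 < j)%N -> iter j HF (incl j x) = incl j x.
Proof. by move=> j_gt0; have := incl_period 1 x j_gt0; rewrite muln1. Qed.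

Lemma gal_act_sigma (x : G m) r :
  gal_act (sigma m ^+ r)%g x = iter r (HU_frob (R := Fq k m)) x.
Proof.
elim: r => // r IHr; rewrite expgS gal_actM IHr iterS.
rewrite /gal_act /sigma /=; case: m x {IHr} => [|[|m']] x //=.
all: by rewrite [RHS](iter_HU_frob_id (iter r _ x)).
Qed.

Lemma sigma_pow_act (g : G m) r :
  ((((g, sigma m ^+ i) : HUG V m) ^+ r).1 = frob_prod g r)%g.
Proof.
elim: r => [|r IHr]; first by rewrite twist_prod0.
rewrite (twist_prodS (@HU_map_mul _ _ _ _ _ _)) -IHr expgS.
by congr (_ * _)%g; apply: gal_act_sigma.
Qed.

Lemma expgz_finite (gT : finGroupType) (x : gT) (t : int) (r : nat) :
  (#|{: gT}|%:Z %| t - r%:Z)%Z -> expgz x t = (x ^+ r)%g.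
Proof.
have ord_dvd : (#[x]%g%:Z %| #|{: gT}|%:Z)%Z.
  by rewrite dvdzE /= -cardsT order_dvdG ?inE.
move/(dvdz_trans ord_dvd); case: t => a /= h.
  apply/eqP; rewrite eq_expg_mod_order -eqz_nat -!modz_nat.
  by rewrite eqz_mod_dvd.
apply/eqP; rewrite eq_invg_mul -expgD -order_dvdn.
by move: h; rewrite NegzE -opprD dvdzE abszN -PoszD.
Qed.

(** In the finite semidirect product t only matters modulo the order of that
    group, so it can be replaced by a large natural number. *)
Lemma is_norm_rel (t : int) (g : G m) (y : G d) :
    (t * i%:Z = d%:Z %[mod m])%Z -> is_norm t g y ->
  exists t0 s alpha, norm_rel g y t0 s alpha.
Proof.
move=> ti [alpha [aE yE]].
pose M := (#|{: HUG V m}| * m)%N.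
have M_gt0 : (0 < M)%N.
  by rewrite muln_gt0 m_gt0 andbT; apply/card_gt0P; exists 1%g.
(* adding M makes t0 * i at least d *)
pose t0 := (`|(t %% M)%Z|%N + M)%N.
have t0E : (M%:Z %| t - t0%:Z)%Z.
  rewrite /t0 PoszD gez0_abs ?modz_ge0 ?gt_eqF //.
  rewrite {1}(divz_eq t M) opprD addrA addrK -mulN1r -mulrDl.
  exact: dvdz_mull.
have ct0 : (expgz ((g, sigma m ^+ i) : HUG V m) t).1%g = frob_prod g t0.
  rewrite -sigma_pow_act (@expgz_finite (HUG V m) _ _ t0) //.
  by apply: dvdz_trans t0E; rewrite /M PoszM dvdz_mulr.
have [s sE] : exists s, (t0 * i = d + m * s)%N.
  have le_d : (d <= t0 * i)%N.
    apply: (leq_trans (dvdn_leq i_gt0 (dvdn_gcdr m i))).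
    by rewrite leq_pmull // /t0 addn_gt0 M_gt0 orbT.
  suff : (m %| t0 * i - d)%N.
    by case/dvdnP=> s sE; exists s; rewrite [(m * s)%N]mulnC -sE subnKC.
  rewrite -eqn_mod_dvd // -eqz_nat -!modz_nat PoszM -ti.
  rewrite eqz_mod_dvd -mulrBl dvdz_mulr //.
  rewrite -opprB dvdzE abszN -dvdzE; apply: dvdz_trans t0E.
  by rewrite /M PoszM dvdz_mull.
exists t0, s, alpha; split=> //.
rewrite -incl_frob_prod -ct0 -[LHS](mulKVg alpha); congr (_ * _)%g.
rewrite [LHS]aE; congr (HU_map _ _).
rewrite -[RHS]mulg1; congr (_ * _)%g; exact: lactE1.
Qed.

(** Forgetting the Heisenberg part preserves norms and turns the affine action
    into the linear one. *)
Definition uproj (R : comAlgType k) (a : HU V R) : HU V R := (1%g, a.2).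

Lemma uprojM (R : comAlgType k) (a b : HU V R) :
  uproj (a * b)%g = (uproj a * uproj b)%g.
Proof.
congr (_, _); rewrite [RHS]mul1g; symmetry; exact: lactE1.
Qed.

Lemma aff_uproj (R : comAlgType k) (a : HU V R) v : aff (uproj a) v = umx a.2 *m v.
Proof. exact: add0r. Qed.

Lemma uproj_map (R S : comAlgType k) (phi : {lrmorphism R -> S}) (a : HU V R) :
  uproj (HU_map phi a) = HU_map phi (uproj a).
Proof.
congr (_, _); have := HU_map1 V phi.
by move/(congr1 fst).
Qed.

Lemma norm_rel_uproj g y t s alpha : norm_rel g y t s alpha ->
  norm_rel (uproj g) (uproj y) t s (uproj alpha).
Proof.
case=> tE aE yE.
have iterE r x : iter r HF (uproj x) = uproj (iter r HF x).
  by elim: r => //= r ->; rewrite [RHS]uproj_map.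
have uproj1 : uproj 1%g = 1%g :> HU V Fb by [].
have prodE (x : HU V Fb) r : frob_prod (uproj x) r = uproj (frob_prod x r).
  elim: r => [|r IHr]; first by rewrite !twist_prod0.
  by rewrite !(twist_prodS (@HU_map_mul _ _ _ _ _ _)) uprojM IHr iterE.
have uprojV x : uproj x^-1%g = (uproj x)^-1%g :> HU V Fb.
  by apply: (mulgI (uproj x)); rewrite -uprojM !mulgV.
split=> //; first by rewrite iterE aE -uproj_map prodE uprojM.
by rewrite -!uproj_map prodE -uprojV -!uprojM yE.
Qed.

Section Fixed.
Variables (g : G m) (y : G d) (t s : nat) (alpha : HU V Fb).
Hypothesis gy : norm_rel g y t s alpha.

Local Notation A := (fun v : VB => aff (incl m g) (iter i vF v)).
Local Notation E := (iter m vF).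

Lemma vF_inj : injective vF.
Proof.
move=> v w vw; apply/matrixP => a b; apply/rowP => l.
have frob_inj := fmorph_inj (frob (R := Fb) : {rmorphism Fb -> Fb}).
by have := congr1 (fun u : VB => u a b 0 l) vw; rewrite !mxE => /frob_inj.
Qed.

Lemma norm_fixed v : A v = v /\ E v = v <->
  aff (incl d y) (aff alpha v) = aff alpha v /\
  iter d vF (aff alpha v) = aff alpha v.
Proof.
have [tE aE yE] := gy.
exact: (@twisted_fixed _ _ HF vF (@aff k L V Fb) (@HU_map_mul k L V Fb Fb _)
  (@aff1 k L V Fb) (@affM k L V Fb) (@aff_map k L V Fb Fb _) vF_inj m i t s
  (incl m g) (incl d y) alpha m_gt0 (incl_period1 g m_gt0) tE aE yE v).
Qed.

Local Notation vFj j := (vmap (V := V) (frob (R := Fq k j))).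

(** A vector over the algebraic closure fixed by the j-th power of Frobenius,
    with coordinates read in F_(q^j); 0 is a default value. *)
Definition desc j (x : VB) : 'cV[tens L (Fq k j)]_n :=
  \col_a (\row_l insubd (0 : Fq k j) (x a 0 0 l) : tens L (Fq k j)).

Lemma iter_vF_entry (R : comAlgType k) r (x : 'cV[tens L R]_n) a b l :
  iter r (vmap (frob (R := R))) x a b 0 l = x a b 0 l ^+ (q ^ r).
Proof.
elim: r => [|r IHr]; first by rewrite expn0 expr1.
by rewrite iterS !mxE IHr /= /frob -exprM expnSr.
Qed.

Lemma descK j x : (0 < j)%N -> iter j vF x = x -> vincl j (desc j x) = x.
Proof.
move=> j_gt0 xF; apply/matrixP => a b; apply/rowP => l; rewrite ord1 !mxE.
apply: insubdK; rewrite inE Fq_orderE //.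
by have := congr1 (fun u : VB => u a 0 0 l) xF; rewrite iter_vF_entry => ->.
Qed.

Lemma vincl_fixed j v : (0 < j)%N -> iter j vF (vincl j v) = vincl j v.
Proof.
move=> j_gt0; apply/matrixP => a b; apply/rowP => l; rewrite iter_vF_entry !mxE.
by rewrite -rmorphXn Fq_expr.
Qed.

Lemma vincl_inj j : injective (vincl j).
Proof.
move=> v w vw; apply/matrixP => a b; apply/rowP => l; apply: val_inj.
by have := congr1 (fun u : VB => u a b 0 l) vw; rewrite !mxE.
Qed.

Lemma vincl_iter j r (v : 'cV[tens L (Fq k j)]_n) :
  vincl j (iter r (vFj j) v) = iter r vF (vincl j v).
Proof.
apply/matrixP => a b; apply/rowP => l.
by rewrite iter_vF_entry !mxE iter_vF_entry rmorphXn.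
Qed.

Lemma vincl_A v : vincl m (aff g (iter i (vFj m) v)) = A (vincl m v).
Proof. by rewrite aff_map vincl_iter. Qed.

(** The fixed points of the twisted affine map at level m, and those of its
    norm at level d. Translation by alpha matches them. *)
Definition fix_src := [set v | aff g (iter i (vFj m) v) == v].
Definition fix_dst := [set w | aff y w == w].

Lemma fix_src_dst v : v \in fix_src -> exists2 w, w \in fix_dst &
  vincl d w = aff alpha (vincl m v).
Proof.
rewrite inE => /eqP vA.
have [|yv Fv] := (norm_fixed (vincl m v)).1.
  by split; [rewrite -vincl_A vA | apply: vincl_fixed].
have dE := descK d_gt0 Fv.
exists (desc d (aff alpha (vincl m v))); last exact: dE.
rewrite inE; apply/eqP/vincl_inj; apply: (etrans (aff_map _ y _)).
exact: (etrans (congr1 (aff (incl d y)) dE) (etrans yv (esym dE))).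
Qed.

Lemma fix_dst_src w : w \in fix_dst -> exists2 v, v \in fix_src &
  vincl d w = aff alpha (vincl m v).
Proof.
rewrite inE => /eqP wy.
pose x : VB := aff alpha^-1%g (vincl d w).
have xE : aff alpha x = vincl d w by rewrite -affM mulgV aff1.
have [|Ax Ex] := (norm_fixed x).2.
  rewrite xE; split; last exact: vincl_fixed.
  exact: (etrans (esym (aff_map _ y w)) (congr1 (vincl d) wy)).
have mE := descK m_gt0 Ex; exists (desc m x); last by rewrite mE xE.
rewrite inE; apply/eqP/vincl_inj; apply: (etrans (vincl_A _)).
exact: (etrans (congr1 (fun u => A u) mE) (etrans Ax (esym mE))).
Qed.

Lemma card_fix_src_dst : #|fix_src| = #|fix_dst|.
Proof.
pose f v := desc d (aff alpha (vincl m v)).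
have fE v : v \in fix_src -> vincl d (f v) = aff alpha (vincl m v).
  by case/fix_src_dst=> w _ wE; rewrite descK // -wE vincl_fixed.
have -> : fix_dst = f @: fix_src.
  apply/setP => w; apply/idP/imsetP => [/fix_dst_src[v vS vE]|[v vS ->]].
    by exists v => //; apply: vincl_inj; rewrite vE fE.
  have [w' w'D w'E] := fix_src_dst vS; rewrite (_ : f v = w') //.
  by apply: vincl_inj; rewrite fE.
symmetry; apply: card_in_imset => v v' vS v'S vv'.
have : aff alpha (vincl m v) = aff alpha (vincl m v').
  by rewrite -(fE v vS) -(fE v' v'S) vv'.
by move/(act_inj (@aff1 k L V Fb) (@affM k L V Fb))/vincl_inj.
Qed.

End Fixed.

Variables (th : L) (thP : th + frob (R:=L) th = 1).
Local Notation hsec := (@hsec k L V th thP _).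

(** The central elements by which the twisted map and its norm move the chosen
    lifts of their fixed points; central characters of these are the phases of
    the two traces. *)
Definition defect_src (g : G m) v : Heis V (Fq k m) :=
  ((hsec v)^-1 *
    (g.1 * hsec (umx g.2 *m iter i (vmap (frob (R := Fq k m))) v)))%g.
Definition defect_dst (y : G d) w : Heis V (Fq k d) :=
  ((hsec w)^-1 * (y.1 * hsec (umx y.2 *m w)))%g.

Lemma heis_map_vec (R S : comAlgType k) (phi : {lrmorphism R -> S})
    (x : Heis V R) :
  heis_vec (heis_map phi x) = map_mx (tens_map phi) (heis_vec x).
Proof. by []. Qed.

Lemma heis_map_sca (R S : comAlgType k) (phi : {lrmorphism R -> S})
    (x : Heis V R) :
  heis_sca (heis_map phi x) = tens_map phi (heis_sca x).
Proof. by []. Qed.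

Local Notation hF := (heis_map (V := V) (frob (R := Fb))).
Local Notation tF := (tens_map (frob (R := Fb)) : tens L Fb -> tens L Fb).
Local Notation tincl j := (tens_map (@Fq_val k j) : tens L _ -> tens L Fb).

Lemma trL_incl j (a : tens L (Fq k j)) : (0 < j)%N ->
  tens_of Fb (trL a) = \sum_(s < j) iter s tF (tincl j a).
Proof.
move=> j_gt0; rewrite -(@tens_map_of k L _ _ (@Fq_val k j)) trLE // raddf_sum.
apply: eq_bigr => s _; elim: (s : nat) => //= r <-.
by apply/rowP => l; rewrite !mxE /= /frob rmorphXn.
Qed.

Lemma iter_tF_sum r I s (P : pred I) (H : I -> tens L Fb) :
  iter r tF (\sum_(x <- s | P x) H x) = \sum_(x <- s | P x) iter r tF (H x).
Proof. by elim: r => //= r ->; rewrite raddf_sum. Qed.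

Lemma iter_tF_period j (a : tens L (Fq k j)) : (0 < j)%N ->
  iter j tF (tincl j a) = tincl j a.
Proof.
move=> j_gt0; apply/rowP => l.
have entry r (x : tens L Fb) : iter r tF x 0 l = x 0 l ^+ (q ^ r).
  elim: r => [|r IHr]; first by rewrite expn0 expr1.
  by rewrite iterS mxE IHr /= /frob -exprM expnSr.
by rewrite entry mxE /= -rmorphXn Fq_expr.
Qed.

Lemma tens_ofB_inj : injective (@tens_of k L Fb).
Proof.
move=> x x' xx'; rewrite (tens_coordE x) (tens_coordE x'); apply: eq_bigr => l _.
congr (_ *: _); apply: (fmorph_inj (in_alg Fb)).
by have := congr1 (fun u : tens L Fb => u 0 l) xx'; rewrite !mxE.
Qed.

Section Defects.
Variables (g : G m) (y : G d) (t s : nat) (alpha : HU V Fb).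
Hypothesis gy : norm_rel g y t s alpha.
Variables (v : 'cV[tens L (Fq k m)]_n) (w : 'cV[tens L (Fq k d)]_n).
Hypothesis vfix : v \in fix_src g.
Hypothesis wfix : w \in fix_dst y.
Hypothesis vw : vincl d w = aff alpha (vincl m v).
Local Notation z := (defect_src g v).
Local Notation z' := (defect_dst y w).

Lemma defect_src_vec : heis_vec z = 0.
Proof.
rewrite !heis_vec_mul heis_vec_inv [heis_vec (hsec _)]/=.
by move: vfix; rewrite inE => /eqP h; rewrite -[X in _ + X]/(aff g _) h addNr.
Qed.

Lemma iter_hF_hact r (a : HU V Fb) x :
  iter r hF (hact a x) = hact (iter r HF a) (iter r hF x).
Proof. by elim: r => //= r ->; rewrite hact_map. Qed.

Lemma iter_hF_mul r (x x' : Heis V Fb) :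
  iter r hF (x * x')%g = (iter r hF x * iter r hF x')%g.
Proof. by elim: r => //= r ->; rewrite heis_map_mul. Qed.

Lemma iter_hF_sca r x : heis_sca (iter r hF x) = iter r tF (heis_sca x).
Proof. by elim: r => //= r <-. Qed.

Lemma iter_hF_vec0 r x : heis_vec x = 0 -> heis_vec (iter r hF x) = 0.
Proof.
by move=> x0; elim: r => //= r IHr; rewrite heis_map_vec IHr map_mx0.
Qed.

Lemma iter_hF_hsec r (x : VB) : iter r hF (hsec x) = hsec (iter r vF x).
Proof. by elim: r => //= r ->; rewrite hsec_map. Qed.

(** Following a fixed point through r twisted steps accumulates the Frobenius
    conjugates of its defect. *)
Lemma defect_iter r : exists Z : Heis V Fb,
  [/\ heis_vec Z = 0,
      heis_sca Z = \sum_(a < r) iter (i * a) tF (tincl m (heis_sca z))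
    & hact (frob_prod (incl m g) r)
        (iter (i * r) hF (heis_map (@Fq_val k m) (hsec v)))
      = (heis_map (@Fq_val k m) (hsec v) * Z)%g].
Proof.
set xb := heis_map _ _; set zb := heis_map (@Fq_val k m) z.
have step : hact (incl m g) (iter i hF xb) = (xb * zb)%g.
  rewrite -heis_map_mul /defect_src mulKVg heis_map_mul; congr (_ * _)%g.
  rewrite -hsec_act heis_map_act; congr (unitary_act _ _).
  transitivity (hsec (iter i vF (vincl m v))).
    by rewrite /xb hsec_map iter_hF_hsec.
  exact: esym (etrans (hsec_map _ _ _) (congr1 hsec (vincl_iter i v))).
elim: r => [|r [Z [Z0 ZE IHr]]].
  exists 1%g; split; [by [] | by rewrite big_ord0 | ].
  by rewrite twist_prod0 muln0 hact1 mulg1.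
exists (zb * iter i hF Z)%g; split.
- rewrite heis_vec_mul (iter_hF_vec0 i Z0) addr0 heis_map_vec.
  by rewrite defect_src_vec map_mx0.
- rewrite heis_sca_mulc; last by rewrite heis_map_vec defect_src_vec map_mx0.
  rewrite iter_hF_sca ZE iter_tF_sum big_ord_recl muln0; congr (_ + _).
  by apply: eq_bigr => a _; rewrite -iterD -mulnS.
- rewrite (twist_prodS (@HU_map_mul _ _ _ _ _ _)) mulnS iterD hactM.
  rewrite -iter_hF_hact IHr iter_hF_mul.
  by rewrite (hact_central _ _ (iter_hF_vec0 i Z0)) step mulgA.
Qed.

(** Transported by alpha, m / d twisted steps from v become one step of y from
    w. Hence the defect of w is the sum of the conjugates of that of v under
    the powers of Frobenius^i, and the remaining conjugates are supplied by the
    trace of level d. *)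
Lemma defect_trL : trL (heis_sca z') = trL (heis_sca z).
Proof.
have [_ _ yE] := gy.
have [Z [Z0 ZE ZA]] := defect_iter mu.
set xb := heis_map _ _ in ZA.
have imu : (i * mu = m * (i %/ d))%N by rewrite muln_divCA_gcd.
have xbF r : iter (m * r) hF xb = xb.
  rewrite /xb hsec_map iter_hF_hsec; congr (hsec _).
  elim: r => [|r IHr]; first by rewrite muln0.
  by rewrite mulnS iterD IHr; apply: vincl_fixed.
rewrite imu xbF in ZA.
pose x' := heis_map (@Fq_val k d) (hsec w).
have Zz' : Z = heis_map (@Fq_val k d) z'.
  (* X and x' lift the same vector, so c is central *)
  pose X := hact alpha xb; pose c := (x'^-1 * X)%g.
  have c0 : heis_vec c = 0.
    rewrite heis_vec_mul heis_vec_inv /X hact_vec !heis_map_vec.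
    by rewrite -[map_mx _ (heis_vec (hsec w))]/(vincl d w) vw addNr.
  have XE : X = (x' * c)%g by rewrite mulKVg.
  have yX : hact (incl d y) X = (X * Z)%g.
    by rewrite yE /X -hactM mulgKV hactM ZA (hact_central _ _ Z0).
  have yx' : hact (incl d y) x' = (x' * heis_map (@Fq_val k d) z')%g.
    rewrite -heis_map_mul -hact_map; congr (heis_map _ _).
    by rewrite /hact hsec_act [RHS]mulKVg.
  clearbody c; move: yX; rewrite XE (hact_central _ _ c0) yx' -!mulgA (heis_central _ c0).
  by move/mulgI/mulIg.
apply: tens_ofB_inj; rewrite !trL_incl // -heis_map_sca -Zz' ZE.
pose f r := iter r tF (tincl m (heis_sca z)).
rewrite -[RHS](@sum_gcd_periodic _ f m i) //; last first.
  by move=> r; rewrite /f iterD iter_tF_period.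
apply: eq_bigr => a _; rewrite iter_tF_sum; apply: eq_bigr => b _.
by rewrite /f iterD.
Qed.
End Defects.
End Norm.

(** * The extension to the semidirect product *)

(** In characteristic r the element ell would satisfy ell^r = ell, whereas its
    absolute value is 1 / ell. *)
Lemma Qlbar_pchar0 ell (K : closedFieldType) :
  prime ell -> is_Qlbar ell K -> [pchar K] =i pred0.
Proof.
move=> ell_pr [Q [nu [iota [nuP _ _ _]]]] r; rewrite [RHS]inE.
apply/negP => rK; have rQ : r \in [pchar Q] by rewrite -(fmorph_pchar iota).
have [ge0 eq0 nuM _ nu_ell] := nuP.
have nu1 : nu 1 = 1.
  have n1 : nu 1 != 0 by rewrite eq0 oner_eq0.
  by apply: (mulfI n1); rewrite -nuM !mulr1.
have nuX x a : nu (x ^+ a) = nu x ^+ a.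
  by elim: a => [|a IHa]; rewrite ?expr0 // !exprS nuM IHa.
have := pFrobenius_aut_nat rQ ell; rewrite pFrobenius_autE => /(congr1 nu).
rewrite nuX nu_ell => /eqP.
have ell0 : (ell%:R : rat) != 0 by rewrite pnatr_eq0 -lt0n prime_gt0.
have r_gt1 : (1 < r)%N by case/andP: rQ => /prime_gt1.
have ell1 : (1 : rat) < ell%:R by rewrite ltr1n prime_gt1.
rewrite exprVn -(inj_eq (@invr_inj _)) !invrK -[X in _ == X]expr1.
rewrite (inj_eq (ieexprIn (lt_trans ltr01 ell1) (negbT (gt_eqF ell1)))).
by case: r r_gt1 {rK rQ} => [|[|]].
Qed.

Section Extension.
Variables (k : finFieldType) (L : quadExt k) (V : hermSpace L).
Variables (kappa : {lrmorphism L -> Fbar k}) (K : closedFieldType).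
Variables (psi : Fbar k -> K) (m : nat) (rho_deg : nat -> nat).
Variable rho : forall j, mx_representation K [set: HU V (Fq k j)] (rho_deg j).
Hypothesis K0 : [pchar K] =i pred0.
Hypothesis hV : herm_nondegenerate V.
Hypothesis psi_char : is_char_Fplus psi.
Hypothesis psi_nontriv : nontrivial_Fplus psi.
Hypothesis m_odd : odd m.
Hypothesis HW : forall j, (j %| m)%N -> is_HeisenbergWeil kappa psi (rho j).
Variables (th : L) (thP : th + frob (R:=L) th = 1).
Local Notation F := (HU_frob (V := V) (R := Fq k m)).

Variable T : 'M[K]_(rho_deg m).
Hypothesis TF : forall x, T *m rho m x = rho m (F x) *m T.
Hypothesis Tm : T ^+ m = 1%:M.
Hypothesis Tnormal : forall i u,
  weyl_normal k (\dim {:V}) (weylW thP (rho m)) (rhoU (rho m) u *m T ^+ i)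
    (umap u \o iter i (@fmap k L V m)).

Let m_gt0 : (0 < m)%N. Proof. by case: m m_odd. Qed.

Lemma frob_powM s x : T ^+ s *m rho m x = rho m (iter s F x) *m T ^+ s.
Proof.
elim: s x => [|s IHs] x; first by rewrite expr0 mul1mx mulmx1.
by rewrite exprSr -mulmxA TF mulmxA IHs -iterSr -mulmxA.
Qed.

Lemma frob_pow_mod s : T ^+ (s %% m.-1.+1) = T ^+ s.
Proof. by apply: expr_mod; rewrite prednK. Qed.

Definition ext_fun (x : HUG V m) : 'M[K]_(rho_deg m) :=
  rho m x.1 *m T ^+ (x.2 : 'I_m.-1.+1).

Lemma ext_mx_repr : mx_repr [set: HUG V m] ext_fun.
Proof.
split=> [|x y _ _]; first by rewrite /ext_fun mulmx1; apply: repr_mx1.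
rewrite /ext_fun mulmxA -(mulmxA (rho m x.1)) frob_powM mulmxA.
rewrite -repr_mxM ?inE // -mulmxA; congr (_ *m _).
transitivity (T ^+ ((x.2 : 'I_m.-1.+1) + (y.2 : 'I_m.-1.+1))); last exact: exprD.
by rewrite -[RHS]frob_pow_mod.
Qed.

Definition ext_repr := MxRepresentation ext_mx_repr.

Lemma sigma_pow_val i : ((sigma m ^+ i)%g : 'I_m.-1.+1) = (i %% m.-1.+1)%N :> nat.
Proof.
elim: i => [|i IHi]; first by rewrite mod0n.
by rewrite expgSr /= IHi modnDm addn1.
Qed.

Lemma ext_reprE g i :
  ext_repr (g, (sigma m ^+ i)%g) = rho m g *m T ^+ i.
Proof. by rewrite /= /ext_fun /= sigma_pow_val frob_pow_mod. Qed.

(** Both traces vanish when the affine maps have no fixed point. Otherwise each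
    is the value of a central character, compared by [defect_trL], times the
    trace of a normal lift; the latter are integers with the same square, by
    the linear case of the matching of fixed points, and the same class modulo
    q + 1. *)
Lemma ext_trace_identity i (t : int) : (0 < i)%N ->
  (t * i%:Z = (gcdn m i)%:Z %[mod m])%Z -> trace_identity rho i t ext_repr.
Proof.
move=> i_gt0 ti g y /(is_norm_rel m_gt0 i_gt0 ti)[t0 [s [alpha gy]]].
rewrite ext_reprE.
set d := gcdn m i.
have d_odd : odd d by apply: dvdn_odd m_odd; apply: dvdn_gcdl.
have HWm := HW (dvdnn m); have HWd := HW (dvdn_gcdl m i).
have nS := Tnormal i g.2; have nU := rhoU_normal thP d_odd HWd y.2.
have rhoE j (x : HU V (Fq k j)) : rho j x = rhoH (rho j) x.1 *m rhoU (rho j) x.2.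
  by case: x => h u; apply: rhoHU.
rewrite !rhoE -mulmxA.
have [u [u_mod trS uE]] :=
  wnormal_trace K0 hV psi_char psi_nontriv m_odd HWm nS.
have [u' [u'_mod trU u'E]] :=
  wnormal_trace K0 hV psi_char psi_nontriv d_odd HWd nU.
(* u and u' are the traces of the normal lifts at levels m and d *)
have uu' : u = u'.
  apply: (signed_root_inj (finNzRing_gt1 k) u_mod u'_mod); rewrite uE u'E.
  have := card_fix_src_dst m_gt0 (norm_rel_uproj gy).
  have -> : fix_src i (uproj g) = weyl_fix (umap g.2 \o iter i (@fmap k L V m)).
    by apply/setP => v; rewrite !inE aff_uproj.
  have -> : fix_dst (uproj y) = weyl_fix (umap y.2).
    by apply/setP => v; rewrite !inE aff_uproj.
  by move=> ->.
have Saut : weyl_aut (@scaleL k L V m) (@weylG k L V th m)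
    (umap g.2 \o iter i (@fmap k L V m)).
  apply: waut_comp; first exact: umap_aut.
  exact: iter_fmap_aut.
have [v vS|noS] := pickP (mem (fix_src i g)).
  have [w wD wE] := fix_src_dst m_gt0 gy vS.
  have zz := defect_trL m_gt0 thP gy vS wE.
  have vfix : heis_vec g.1 + (umap g.2 \o iter i (@fmap k L V m)) v = v.
    by move: vS; rewrite /= inE => /eqP vE; exact: vE.
  have wfix : heis_vec y.1 + umap y.2 w = w.
    by move: wD; rewrite inE => /eqP wE'; exact: wE'.
  rewrite (wlift_affine_trace m_odd HWm nS.1 vfix) trS uu' -trU.
  rewrite (wlift_affine_trace d_odd HWd nU.1 wfix).
  by congr (psi (kappa _) * _); exact: (esym zz).
have no_fix v : heis_vec g.1 + (umap g.2 \o iter i (@fmap k L V m)) v != v.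
  by have := noS v; rewrite /= inE => /negbT vN; exact: vN.
transitivity (0 : K).
  apply/eqP; apply: contraT.
  case/(wlift_affine_fix K0 hV psi_char psi_nontriv m_odd HWm Saut nS.1) => v vE.
  by have := no_fix v; rewrite vE eqxx.
symmetry; apply/eqP; apply: contraT.
case/(wlift_affine_fix K0 hV psi_char psi_nontriv d_odd HWd (umap_aut _ _) nU.1).
move=> w wE; have [|v vS _] := @fix_dst_src _ _ _ _ _ m_gt0 _ _ _ _ _ gy w.
  by rewrite inE; apply/eqP.
by have := noS v; rewrite /= vS.
Qed.

Lemma is_norm1 i (t : int) :
  is_norm t (1%g : HU V (Fq k m)) (1%g : HU V (Fq k (gcdn m i))).
Proof.
have fst1 (x : HUG V m) (t' : int) : x.1%g = 1%g -> (expgz x t').1%g = 1%g.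
  move=> x1; have xX a : (x ^+ a)%g.1%g = 1%g.
    elim: a => // a IHa; rewrite expgS.
    rewrite -[LHS]/(x.1 * gal_act x.2 (x ^+ a).1)%g x1 IHa mul1g.
    exact: (lactE1 (gal_aut V m)).
  case: t' => a; first exact: xX.
  rewrite -[LHS]/(gal_act (x ^+ a.+1).2^-1 (x ^+ a.+1).1^-1)%g.
  by rewrite xX invg1; apply: (lactE1 (gal_aut V m)).
have iterF1 r : iter r (HU_frob (V := V) (R := Fbar k)) 1%g = 1%g.
  by apply: iter_Phi1; apply: HU_map_mul.
exists 1%g; split.
  rewrite iterF1 invg1 mulg1.
  rewrite [X in HU_map _ X](_ : _ = 1%g) ?HU_map1 //.
  rewrite [LHS]/= fst1 // mul1g; apply: (lactE1 (gal_aut V m)).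
rewrite invg1 mulg1 mul1g HU_map1 big1 // => r _.
by rewrite HU_map1 iterF1.
Qed.

(** By Schur's lemma two extensions differ by a scalar c on the generator, and
    comparing traces at g = 1, where the norm is 1, gives c ^+ i = 1. *)
Lemma ext_unique i (t : int)
    (rho' : mx_representation K [set: HUG V m] (rho_deg m)) :
  (0 < i)%N -> (t * i%:Z = (gcdn m i)%:Z %[mod m])%Z ->
  extends rho' (rho m) -> trace_identity rho i t rho' ->
  forall g (s : Gam m), s \in <[(sigma m ^+ i)%g]>%g ->
    rho' (g, s) = ext_repr (g, s).
Proof.
move=> i_gt0 ti rho'E rho'tr g s.
have rho'M x x' : rho' (x * x')%g = rho' x *m rho' x'.
  by apply: repr_mxM; rewrite inE.
have HWm := HW (dvdnn m).
pose T' := rho' (1%g, sigma m).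
have T'F x : T' *m rho m x = rho m (F x) *m T'.
  rewrite -!rho'E -!rho'M; congr (rho' (_, _)); last by rewrite mulg1 mul1g.
  transitivity (F x).
    by rewrite [LHS]mul1g; apply: (gal_act_sigma x 1).
  rewrite -[LHS]mulg1; congr (_ * _)%g; symmetry; apply: (lactE1 (gal_aut V m)).
have uT : T \in unitmx.
  have unit_pow a : (0 < a)%N -> T ^+ a = 1%:M -> T \in unitmx.
    by case: a => // a _; rewrite exprS => /mulmx1_unit[].
  exact: unit_pow m_gt0 Tm.
have [c T'E] : exists c, T' = c *: T.
  have /is_scalar_mxP[c cE] : is_scalar_mx (invmx T *m T').
    apply: (rhoH_cent HWm) => h; rewrite /rhoH -mulmxA T'F mulmxA.
    apply: (can_inj (mulKmx uT)); rewrite !mulmxA mulmxV // mul1mx.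
    by rewrite TF mulmxK.
  by exists c; rewrite -(mulKVmx uT T') cE mul_mx_scalar.
have T'X r : T' ^+ r = c ^+ r *: T ^+ r.
  elim: r => [|r IHr]; first by rewrite !expr0 scale1r.
  rewrite !exprS IHr T'E -[LHS]/(_ *m _) -scalemxAl -scalemxAr scalerA.
  by [].
have rho'X x r : rho' (x, (sigma m ^+ r)%g) = c ^+ r *: ext_repr (x, (sigma m ^+ r)%g).
  rewrite ext_reprE scalemxAr -T'X -rho'E.
  have -> : T' ^+ r = rho' (1%g, (sigma m ^+ r)%g).
    elim: r => [|r IHr]; first by rewrite expr0 [RHS]repr_mx1.
    rewrite exprS IHr [LHS](esym (rho'M _ _)); congr (rho' (_, _)).
      by rewrite [LHS]mul1g; apply: (lactE1 (gal_aut V m)).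
    by rewrite expgS.
  rewrite -rho'M; congr (rho' (_, _)); last by rewrite mul1g.
  rewrite -[LHS]mulg1; congr (_ * _)%g; symmetry; apply: (lactE1 (gal_aut V m)).
have ci : c ^+ i = 1.
  have n1 := is_norm1 i t.
  have tr1 := ext_trace_identity i_gt0 ti n1.
  have := rho'tr _ _ n1; rewrite rho'X mxtraceZ tr1 repr_mx1 mxtrace1.
  have N0 : (rho_deg (gcdn m i))%:R != 0 :> K.
    rewrite ((pcharf0P K).1 K0) (HW_degree K0 (HW (dvdn_gcdl m i))).
    by rewrite expn_eq0 negb_and gtn_eqF // (ltnW (finNzRing_gt1 k)).
  by move=> cE; apply: (mulIf N0); rewrite mul1r.
by case/cycleP=> r ->; rewrite -expgM rho'X exprM ci expr1n scale1r.
Qed.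

End Extension.

(* One extension serves all (i, t). The identity for a single (i, t) can only *)
(* determine an extension on the preimage of <[sigma ^+ i]>, which is the     *)
(* whole group when gcdn m i = 1.                                             *)
Theorem theorem7p1
    (p q e ell m n : nat) (k : finFieldType) (L : quadExt k)
    (kappa : {lrmorphism L -> Fbar k}) (V : hermSpace L)
    (K : closedFieldType) (psi : Fbar k -> K) (rho_deg : nat -> nat)
    (rho : forall j : nat,
       mx_representation K [set: HU V (Fq k j)] (rho_deg j)) :
  prime p -> q = (p ^ e)%N -> #|k| = q ->
  prime ell -> ell != p -> is_Qlbar ell K ->
  odd m ->
  herm_nondegenerate V -> \dim {:V} = n -> (1 <= n)%N ->
  is_char_Fplus psi -> nontrivial_Fplus psi ->
  (forall j : nat, (j %| m)%N -> is_HeisenbergWeil kappa psi (rho j)) ->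
  exists rhot : mx_representation K [set: HUG V m] (rho_deg m),
    extends rhot (rho m) /\
    forall (i : nat) (t : int),
      (1 <= i <= m)%N -> (t * i%:Z = (gcdn m i)%:Z %[mod m])%Z ->
      trace_identity rho i t rhot /\
      forall rhot' : mx_representation K [set: HUG V m] (rho_deg m),
        extends rhot' (rho m) -> trace_identity rho i t rhot' ->
        forall (g : HU V (Fq k m)) (s : Gam m),
          s \in <[(sigma m ^+ i)%g]>%g -> rhot' (g, s) = rhot (g, s).
Proof.
move=> p_pr qE kq ell_pr ell_p KQ m_odd hV nE n_gt0 psi_char psi_nontriv HW.
have K0 := Qlbar_pchar0 ell_pr KQ.
have [th thP] := frob_trace_one L.
have [T [TF Tm Tnormal]] :=
  HW_frobenius_operator K0 hV psi_char psi_nontriv thP m_odd (HW m (dvdnn m)).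
exists (ext_repr m_odd TF Tm); split.
  by move=> g; rewrite /= /ext_fun /= mulmx1.
move=> i t /andP[i_gt0 _] ti; split; first exact: (ext_trace_identity
  K0 hV psi_char psi_nontriv m_odd HW TF Tm Tnormal i_gt0 ti).
move=> rho' rho'E rho'tr g s.
exact: (ext_unique K0 hV psi_char psi_nontriv m_odd HW TF Tm Tnormal i_gt0 ti
  rho'E rho'tr).
Qed.
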